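(* If $0<\alpha\leq\frac{2}{3}$, then $$\|\mathcal{H}\|_{H^\infty_{\alpha,\log}\rightarrow H^\infty_\alpha}\leq\int_{0}^{1}\frac{t^{\alpha-1}}{(1-t)^\alpha\log\frac{(2-t)^2e^{1/\alpha}}{2-2t}}\,dt.$$ If $\frac{2}{3}<\alpha<1$, then $$\|\mathcal{H}\|_{H^\infty_{\alpha,\log}\rightarrow H^\infty_\alpha}\leq\int_{0}^{\frac{3\alpha-2}{4\alpha-2}}\frac{G(x_0)}{\log\frac{(2-t)^2e^{1/\alpha}}{2-2t}}\,dt+\int_{\frac{3\alpha-2}{4\alpha-2}}^{1}\frac{t^{\alpha-1}}{(1-t)^\alpha\log\frac{(2-t)^2e^{1/\alpha}}{2-2t}}\,dt,$$ where, for each $t$, $$G(x)=(1-x)^{2\alpha-1}\left(\frac{1-\left|\frac{x}{1-t}\right|^2}{(1-x)^2-t^2}\right)^\alpha$$ and $$x_0=\frac{\alpha+2\alpha t-t-\sqrt{4\alpha^2t-2\alpha t+\alpha^2-2\alpha+1}}{2\alpha-1}$$ (both $G$ and $x_0$ depend on $t$).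
   Context: $\mathbb{D}$ is the open unit disk in $\mathbb{C}$ and $H(\mathbb{D})$ is the set of analytic functions on $\mathbb{D}$; $\log$ is the natural logarithm. For $0<\alpha<1$, the Korenblum space $H^\infty_\alpha$ is the space of all $f\in H(\mathbb{D})$ with $\|f\|_{H^\infty_\alpha}=\sup_{z\in\mathbb{D}}(1-|z|^2)^\alpha|f(z)|<\infty$. The logarithmically weighted Korenblum space $H^\infty_{\alpha,\log}$ is the space of all $f\in H(\mathbb{D})$ with $$\|f\|_{H^\infty_{\alpha,\log}}=\sup_{z\in\mathbb{D}}(1-|z|^2)^\alpha\log\frac{2e^{1/\alpha}}{1-|z|^2}\,|f(z)|<\infty.$$ The Hilbert matrix operator $\mathcal{H}$ acts on $f(z)=\sum_{k\ge 0}a_kz^k\in H(\mathbb{D})$ by $$\mathcal{H}f(z)=\sum_{n=0}^\infty\left(\sum_{k=0}^\infty\frac{a_k}{n+k+1}\right)z^n,$$ whenever the right-hand side makes sense and defines an analytic function in $\mathbb{D}$. For normed spaces $X,Y$ of analytic functions, $\|\mathcal{H}\|_{X\to Y}=\sup\{\|\mathcal{H}f\|_Y:\ f\in X,\ \|f\|_X\le 1\}$. *)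

(* Defs.v *)
From Stdlib Require Import Reals.
From Coquelicot Require Import Coquelicot.
Local Open Scope R_scope.

(* Functions on the disk are total functions [C -> C]; every definition below
   only looks at their values on the open unit disk. *)
Definition disk (z : C) : Prop := Cmod z < 1.

Definition analytic (f : C -> C) : Prop :=
  forall w : C, disk w ->
    exists c : nat -> C,
      locally w (fun z : C => is_pseries c (Cminus z w) (f z)).

(* Supremum over the disk, in the extended reals. *)
Definition weighted_norm (v : R -> R) (f : C -> C) : Rbar :=
  Lub_Rbar (fun r : R => exists z : C,
    disk z /\ r = v (1 - Cmod z ^ 2) * Cmod (f z)).

Definition korenblum_norm (alpha : R) : (C -> C) -> Rbar :=
  weighted_norm (fun s => Rpower s alpha).

Definition korenblum_log_norm (alpha : R) : (C -> C) -> Rbar :=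
  weighted_norm (fun s => Rpower s alpha * ln (2 * exp (1 / alpha) / s)).

Definition korenblum_log (alpha : R) (f : C -> C) : Prop :=
  analytic f /\ Rbar_lt (korenblum_log_norm alpha f) p_infty.

Definition taylor (a : nat -> C) (f : C -> C) : Prop :=
  forall z : C, disk z -> is_pseries a z (f z).

(* The Hilbert matrix operator is partial: [hilbert f g] says that it is
   defined at [f], with value [g] on the disk. *)
Definition hilbert (f g : C -> C) : Prop :=
  exists a b : nat -> C,
    taylor a f /\
    (forall n : nat,
       is_series (fun k : nat => Cdiv (a k) (RtoC (INR (n + k + 1)))) (b n)) /\
    taylor b g /\ analytic g.

(* The inputs [f] outside the domain of [T] do not contribute to this supremum,
   so it is the norm of [T] on [X] only if [T] is defined on all of [X]. *)
Definition operator_norm (T : (C -> C) -> (C -> C) -> Prop)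
    (X : (C -> C) -> Prop) (normX normY : (C -> C) -> Rbar) : Rbar :=
  Rbar_lub (fun r : Rbar => exists f g : C -> C,
    X f /\ Rbar_le (normX f) 1 /\ T f g /\ r = normY g).

Definition hilbert_norm (alpha : R) : Rbar :=
  operator_norm hilbert (korenblum_log alpha)
    (korenblum_log_norm alpha) (korenblum_norm alpha).

Definition log_factor (alpha t : R) : R :=
  ln ((2 - t) ^ 2 * exp (1 / alpha) / (2 - 2 * t)).

Definition main_integrand (alpha t : R) : R :=
  Rpower t (alpha - 1) / (Rpower (1 - t) alpha * log_factor alpha t).

Definition G (alpha t x : R) : R :=
  Rpower (1 - x) (2 * alpha - 1) *
  Rpower ((1 - Rabs (x / (1 - t)) ^ 2) / ((1 - x) ^ 2 - t ^ 2)) alpha.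

Definition x0 (alpha t : R) : R :=
  (alpha + 2 * alpha * t - t
   - sqrt (4 * alpha ^ 2 * t - 2 * alpha * t + alpha ^ 2 - 2 * alpha + 1))
  / (2 * alpha - 1).

Definition G_integrand (alpha t : R) : R :=
  G alpha t (x0 alpha t) / log_factor alpha t.

Definition split_point (alpha : R) : R := (3 * alpha - 2) / (4 * alpha - 2).

(* Main.v *)
Require Import Defs.
From Stdlib Require Import Reals.
From Stdlib Require Import Lra Lia Classical.
From Coquelicot Require Import Coquelicot.
Local Open Scope R_scope.

(** For [t] in [(0, 1)] put [path z t = t / (1 - (1 - t) z)].  Integrating
    [f w / (1 - w z)] from [0] to [1] along this curve instead of the real
    segment gives [H f z] as the integral over [t] of
    [f (path z t) / (1 - (1 - t) z)]; both curves end at [1] inside a Stolz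
    angle, so the growth bound on [f] makes the change of path legitimate.
    The integrand is bounded pointwise: the weight of [f] at [path z t] depends
    on [z] only through [|1 - (1 - t) z|], which for given [|z|] is worst when
    [z >= 0], and then it is [G t x] with [x = (1 - t) |z|].  The sign of the
    logarithmic derivative of [G] in [x] is that of a quadratic, so the supremum
    over [x] is the limit at [x = 1 - t], unless [alpha > 2 / 3] and
    [t < split_point alpha], when it is attained at the root [x0].
    That [H f] exists at all needs conditional convergence of
    [sum a_k / (n + k + 1)]: Cauchy's formula and the [L^1] norm of the Dirichlet
    kernel give [|a_0 + ... + a_N| = O (N^alpha log N)], and one sums by parts. *)

(** * Complex derivatives and curves *)

(** The curve comes from a Möbius map: with [den = 1 - (1 - t) z] one has [1 - w z = (1 - z) / den]
    and [dw = (1 - z) / den ^ 2 dt], so [1 - z] cancels from the integrand. The weight of the source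
    space has two factors that pull in opposite directions: the power of [1 - |w| ^ 2] is worst when
    [|den|] is smallest, the logarithm when [|den|] is largest. They are estimated separately. The
    power is taken at [|den| = 1 - (1 - t) |z|]; the logarithm is taken at the upper bound
    [|den| = 2 - t], where [1 - |w| ^ 2] is [(4 - 4 t) / (2 - t) ^ 2]. The latter no longer depends
    on [z], so only [G] has to be maximized. The growth of [f] allows coefficients of size
    [k ^ alpha], and [f] may be unbounded near the end [1] of the curve. Hence no complex integral
    is formed along the curve: a primitive [P] of [f w / (1 - w z)] in the disk is followed instead,
    [H f z] is the limit of [P] at [1], and increments of [P] are bounded by a mean value
    inequality. *)

Ltac eqR := cbv beta; match goal with |- @eq _ ?a ?b => change (@eq R a b) end.
(** Both tactics restate an equality typed at the carrier of an algebraic structure as one in [R] or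
    [C], the form that [ring] and [field] recognize. *)
Ltac eqC := cbv beta; match goal with |- @eq _ ?a ?b => change (@eq C a b) end.

Lemma continuous_C {T : UniformSpace} (h : T -> C) (x : T) :
  continuous (fun y => Re (h y)) x -> continuous (fun y => Im (h y)) x ->
  continuous h x.
Proof.
  intros H1 H2 P [eps HP].
  assert (E1 := proj1 (filterlim_locally _ _) H1 eps).
  assert (E2 := proj1 (filterlim_locally _ _) H2 eps).
  unfold filtermap.
  generalize (filter_and _ _ E1 E2). apply filter_imp.
  intros y [A B]. apply HP. split; assumption.
Qed.

Lemma continuous_Re {T : UniformSpace} (h : T -> C) (x : T) :
  continuous h x -> continuous (fun y => Re (h y)) x.
Proof.
  intros H. apply (continuous_comp h (fun c : C => fst c)); [exact H|].
  destruct (h x). apply continuous_fst.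
Qed.

Lemma continuous_Im {T : UniformSpace} (h : T -> C) (x : T) :
  continuous h x -> continuous (fun y => Im (h y)) x.
Proof.
  intros H. apply (continuous_comp h (fun c : C => snd c)); [exact H|].
  destruct (h x). apply continuous_snd.
Qed.

Lemma continuous_Cplus {T : UniformSpace} (h k : T -> C) (x : T) :
  continuous h x -> continuous k x -> continuous (fun y => Cplus (h y) (k y)) x.
Proof.
  intros H K. apply continuous_C; simpl.
  - exact (continuous_plus _ _ _ (continuous_Re _ _ H) (continuous_Re _ _ K)).
  - exact (continuous_plus _ _ _ (continuous_Im _ _ H) (continuous_Im _ _ K)).
Qed.

Lemma continuous_Copp {T : UniformSpace} (h : T -> C) (x : T) :
  continuous h x -> continuous (fun y => Copp (h y)) x.
Proof.
  intros H. apply continuous_C; simpl.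
  - exact (continuous_opp _ _ (continuous_Re _ _ H)).
  - exact (continuous_opp _ _ (continuous_Im _ _ H)).
Qed.

Lemma continuous_Cminus {T : UniformSpace} (h k : T -> C) (x : T) :
  continuous h x -> continuous k x -> continuous (fun y => Cminus (h y) (k y)) x.
Proof.
  intros H K. apply continuous_Cplus; [exact H|now apply continuous_Copp].
Qed.

Lemma continuous_Rplus {T : UniformSpace} (f g : T -> R) (x : T) :
  continuous f x -> continuous g x -> continuous (fun y => f y + g y) x.
Proof. exact (continuous_plus f g x). Qed.

Lemma continuous_Rminus {T : UniformSpace} (f g : T -> R) (x : T) :
  continuous f x -> continuous g x -> continuous (fun y => f y - g y) x.
Proof. exact (continuous_minus f g x). Qed.

Lemma continuous_Ropp {T : UniformSpace} (f : T -> R) (x : T) :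
  continuous f x -> continuous (fun y => - f y) x.
Proof. exact (continuous_opp f x). Qed.

Lemma continuous_Rmult {T : UniformSpace} (f g : T -> R) (x : T) :
  continuous f x -> continuous g x -> continuous (fun y => f y * g y) x.
Proof. exact (continuous_mult (K := R_AbsRing) f g x). Qed.

Lemma continuous_Rinv_pt {T : UniformSpace} (f : T -> R) (x : T) :
  continuous f x -> f x <> 0 -> continuous (fun y => / f y) x.
Proof.
  intros H K. apply (continuous_comp f Rinv); [exact H|now apply continuous_Rinv].
Qed.

Lemma continuous_Cmult {T : UniformSpace} (h k : T -> C) (x : T) :
  continuous h x -> continuous k x -> continuous (fun y => Cmult (h y) (k y)) x.
Proof.
  intros H K.
  pose proof (continuous_Re _ _ H) as H1. pose proof (continuous_Im _ _ H) as H2.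
  pose proof (continuous_Re _ _ K) as K1. pose proof (continuous_Im _ _ K) as K2.
  apply continuous_C.
  - exact (continuous_Rminus _ _ _ (continuous_Rmult _ _ _ H1 K1) (continuous_Rmult _ _ _ H2 K2)).
  - exact (continuous_Rplus _ _ _ (continuous_Rmult _ _ _ H1 K2) (continuous_Rmult _ _ _ H2 K1)).
Qed.

Lemma continuous_Cmod2 {T : UniformSpace} (h : T -> C) (x : T) :
  continuous h x -> continuous (fun y => Cmod (h y) ^ 2) x.
Proof.
  intros H.
  pose proof (continuous_Re _ _ H) as H1. pose proof (continuous_Im _ _ H) as H2.
  apply (continuous_ext (fun y => Re (h y) * Re (h y) + Im (h y) * Im (h y))).
  { intro y. rewrite Cmod2_alt. eqR. ring. }
  exact (continuous_Rplus _ _ _ (continuous_Rmult _ _ _ H1 H1) (continuous_Rmult _ _ _ H2 H2)).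
Qed.

Lemma continuous_Cmod {T : UniformSpace} (h : T -> C) (x : T) :
  continuous h x -> continuous (fun y => Cmod (h y)) x.
Proof.
  intros H.
  apply (continuous_ext (fun y => sqrt (Cmod (h y) ^ 2))).
  { intro y. apply sqrt_pow2, Cmod_ge_0. }
  apply (continuous_comp (fun y => Cmod (h y) ^ 2) sqrt).
  - now apply continuous_Cmod2.
  - apply continuous_sqrt.
Qed.

Lemma continuous_Cinv {T : UniformSpace} (h : T -> C) (x : T) :
  continuous h x -> h x <> RtoC 0 -> continuous (fun y => Cinv (h y)) x.
Proof.
  intros H N.
  assert (P : Cmod (h x) ^ 2 <> 0).
  { apply Cmod_gt_0 in N. apply pow_nonzero. lra. }
  pose proof (continuous_Rinv_pt _ _ (continuous_Cmod2 _ _ H) P) as I.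
  assert (E : forall y, fst (h y) ^ 2 + snd (h y) ^ 2 = Cmod (h y) ^ 2).
  { intro y. now rewrite Cmod2_alt. }
  apply continuous_C.
  - apply (continuous_ext (fun y => Re (h y) * / (Cmod (h y) ^ 2))).
    { intro y. change (Re (h y) * / Cmod (h y) ^ 2 = fst (h y) / (fst (h y) ^ 2 + snd (h y) ^ 2)).
      now rewrite E. }
    apply continuous_Rmult; [now apply continuous_Re|exact I].
  - apply (continuous_ext (fun y => (- Im (h y)) * / (Cmod (h y) ^ 2))).
    { intro y. change (- Im (h y) * / Cmod (h y) ^ 2 = - snd (h y) / (fst (h y) ^ 2 + snd (h y) ^ 2)).
      now rewrite E. }
    apply continuous_Rmult; [|exact I].
    now apply continuous_Ropp, continuous_Im.
Qed.

(** The uniform structure of [C] is that of a product, with squares as balls. Discs and squares are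
    comparable up to the factor [sqrt 2]. *)
Lemma locally_Cmod (z : C) (P : C -> Prop) :
  locally z P <-> exists d, 0 < d /\ forall w, Cmod (Cminus w z) < d -> P w.
Proof.
  split.
  - intros [d H]. exists d; split; [apply cond_pos|].
    intros w Hw. apply H. apply C_NormedModule_mixin_compat1. exact Hw.
  - intros [d [Hd H]].
    assert (Hs : 0 < sqrt 2) by (apply sqrt_lt_R0; lra).
    exists (mkposreal (d / sqrt 2) (Rdiv_lt_0_compat _ _ Hd Hs)).
    intros w Hw. apply H.
    assert (E := C_NormedModule_mixin_compat2 z w _ Hw). simpl in E.
    replace (sqrt 2 * (d / sqrt 2)) with d in E by (field; lra). exact E.
Qed.

Lemma continuous_C_eps {T : UniformSpace} (h : T -> C) (x : T) :
  continuous h x <->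
  forall eps, 0 < eps -> locally x (fun y => Cmod (Cminus (h y) (h x)) < eps).
Proof.
  split.
  - intros H eps He. apply (H (fun w => Cmod (Cminus w (h x)) < eps)).
    apply locally_Cmod. now exists eps.
  - intros H P HP. apply locally_Cmod in HP. destruct HP as [d [Hd HP]].
    generalize (H d Hd). unfold filtermap. apply filter_imp. intros y; apply HP.
Qed.

(** Carathéodory's form of the complex derivative. *)
Definition cderiv (f : C -> C) (z l : C) : Prop :=
  exists q : C -> C, continuous q z /\ q z = l /\
    forall w, Cminus (f w) (f z) = Cmult (q w) (Cminus w z).

(** [cderiv] demands its factorization for every [w]. A local one is enough: the difference
    quotient, completed by [l] at [z], factors globally and agrees with [q] near [z]. *)
Lemma cderiv_locally (f q : C -> C) (z l : C) :
  continuous q z -> q z = l ->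
  locally z (fun w => Cminus (f w) (f z) = Cmult (q w) (Cminus w z)) ->
  cderiv f z l.
Proof.
  intros Hq Hl H.
  set (p := fun w => if Ceq_dec w z then l else Cdiv (Cminus (f w) (f z)) (Cminus w z)).
  exists p. assert (Ep : p z = l).
  { unfold p. destruct (Ceq_dec z z); congruence. }
  assert (Np : forall w, w <> z -> Cminus w z <> RtoC 0).
  { intros w N E. apply N. replace w with (Cplus (Cminus w z) z) by ring. rewrite E. ring. }
  split; [|split; [exact Ep|]].
  - apply (continuous_ext_loc _ q); [|exact Hq].
    generalize H. apply filter_imp. intros w E. unfold p.
    destruct (Ceq_dec w z) as [->|N]; [exact Hl|].
    rewrite E. eqC. field. now apply Np.
  - intros w. unfold p. destruct (Ceq_dec w z) as [->|N]; [ring|].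
    field. now apply Np.
Qed.

Lemma cderiv_quadratic (f : C -> C) (z l : C) (K : R) :
  locally z (fun w => Cmod (Cminus (Cminus (f w) (f z)) (Cmult l (Cminus w z)))
                      <= K * Cmod (Cminus w z) ^ 2) ->
  cderiv f z l.
Proof.
  intros H.
  set (p := fun w => if Ceq_dec w z then l else Cdiv (Cminus (f w) (f z)) (Cminus w z)).
  assert (Ep : p z = l).
  { unfold p. destruct (Ceq_dec z z); congruence. }
  assert (Np : forall w, w <> z -> Cminus w z <> RtoC 0).
  { intros w N E. apply N. replace w with (Cplus (Cminus w z) z) by ring. rewrite E. ring. }
  exists p. split; [|split; [exact Ep|]].
  2:{ intros w. unfold p. destruct (Ceq_dec w z) as [->|N]; [ring|].
      field. now apply Np. }
  apply continuous_C_eps. intros eps He.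
  apply locally_Cmod in H. destruct H as [d [Hd H]].
  assert (HK : 0 < Rabs K + 1) by (assert (A := Rabs_pos K); lra).
  apply locally_Cmod. exists (Rmin d (eps / (Rabs K + 1))). split.
  { apply Rmin_glb_lt; [exact Hd|now apply Rdiv_lt_0_compat]. }
  intros w Hw. rewrite Ep. unfold p.
  destruct (Ceq_dec w z) as [->|N].
  { replace (Cminus l l) with (RtoC 0) by ring. rewrite Cmod_0. exact He. }
  assert (Hm := Rmin_l d (eps / (Rabs K + 1))).
  assert (Hm' := Rmin_r d (eps / (Rabs K + 1))).
  specialize (H w ltac:(lra)).
  assert (G := proj1 (Cmod_gt_0 _) (Np w N)).
  replace (Cminus (Cdiv (Cminus (f w) (f z)) (Cminus w z)) l) with
    (Cdiv (Cminus (Cminus (f w) (f z)) (Cmult l (Cminus w z))) (Cminus w z))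
    by (field; now apply Np).
  rewrite Cmod_div by now apply Np.
  apply (Rmult_lt_reg_r (Cmod (Cminus w z))); [exact G|].
  unfold Rdiv. rewrite Rmult_assoc, Rinv_l, Rmult_1_r by lra.
  eapply Rle_lt_trans; [exact H|].
  assert (HKa := Rle_abs K).
  assert (B : Cmod (Cminus w z) * (Rabs K + 1) < eps).
  { apply (Rmult_lt_reg_r (/ (Rabs K + 1))); [now apply Rinv_0_lt_compat|].
    rewrite Rmult_assoc, Rinv_r, Rmult_1_r by lra. unfold Rdiv in Hm'. lra. }
  replace (K * Cmod (Cminus w z) ^ 2) with (K * Cmod (Cminus w z) * Cmod (Cminus w z)) by ring.
  apply Rmult_lt_compat_r; [exact G|]. nra.
Qed.

Lemma cderiv_continuous (f : C -> C) (z l : C) : cderiv f z l -> continuous f z.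
Proof.
  intros [q [Hq [E H]]].
  apply (continuous_ext (fun w => Cplus (f z) (Cmult (q w) (Cminus w z)))).
  { intros w. rewrite <- H. eqC. ring. }
  apply continuous_Cplus; [apply continuous_const|].
  apply continuous_Cmult; [exact Hq|].
  apply continuous_Cminus; [apply continuous_id|apply continuous_const].
Qed.

Lemma cderiv_ext_loc (f g : C -> C) (z l : C) :
  locally z (fun w => f w = g w) -> cderiv f z l -> cderiv g z l.
Proof.
  intros H [q [Hq [E D]]].
  apply (cderiv_locally g q); [exact Hq|exact E|].
  assert (Ez := locally_singleton _ _ H). simpl in Ez.
  generalize H. apply filter_imp. intros w Hw. rewrite <- Hw, <- Ez. apply D.
Qed.

Lemma cderiv_mult (f g : C -> C) (z lf lg : C) :
  cderiv f z lf -> cderiv g z lg ->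
  cderiv (fun w => Cmult (f w) (g w)) z (Cplus (Cmult lf (g z)) (Cmult (f z) lg)).
Proof.
  intros Df Dg. assert (Cg := cderiv_continuous _ _ _ Dg).
  destruct Df as [q [Hq [E D]]]. destruct Dg as [p [Hp [E' D']]].
  exists (fun w => Cplus (Cmult (q w) (g w)) (Cmult (f z) (p w))).
  split; [|split].
  - apply continuous_Cplus; apply continuous_Cmult; try assumption. apply continuous_const.
  - now rewrite E, E'.
  - intros w. 
    transitivity (Cplus (Cmult (Cminus (f w) (f z)) (g w)) (Cmult (f z) (Cminus (g w) (g z)))).
    { ring. } rewrite D, D'. ring.
Qed.

Lemma cderiv_inv_affine (a z : C) :
  Cminus (RtoC 1) (Cmult z a) <> RtoC 0 ->
  cderiv (fun w => Cinv (Cminus (RtoC 1) (Cmult w a))) z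
         (Cmult a (Cmult (Cinv (Cminus (RtoC 1) (Cmult z a)))
                         (Cinv (Cminus (RtoC 1) (Cmult z a))))).
Proof.
  intros N.
  assert (C1 : continuous (fun w : C => Cminus (RtoC 1) (Cmult w a)) z).
  { apply continuous_Cminus; [apply continuous_const|].
    apply continuous_Cmult; [apply continuous_id|apply continuous_const]. }
  apply (cderiv_locally _ (fun w => Cmult a (Cmult (Cinv (Cminus (RtoC 1) (Cmult w a)))
                         (Cinv (Cminus (RtoC 1) (Cmult z a)))))).
  - apply continuous_Cmult; [apply continuous_const|].
    apply continuous_Cmult; [|apply continuous_const].
    now apply continuous_Cinv.
  - reflexivity.
  - assert (P : 0 < Cmod (Cminus (RtoC 1) (Cmult z a))) by now apply Cmod_gt_0.
    generalize (proj1 (continuous_C_eps _ _) C1 _ P). apply filter_imp.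
    intros w Hw.
    assert (Nw : Cminus (RtoC 1) (Cmult w a) <> RtoC 0).
    { intros E. rewrite E in Hw.
      replace (Cminus (RtoC 0) (Cminus (RtoC 1) (Cmult z a))) with
        (Copp (Cminus (RtoC 1) (Cmult z a))) in Hw by ring.
      rewrite Cmod_opp in Hw. lra. }
    field. split; assumption.
Qed.

Lemma is_derive_caratheodory (h p : R -> R) (s : R) :
  continuous p s -> (forall t, h t - h s = p t * (t - s)) -> is_derive h s (p s).
Proof.
  intros Hp H. apply is_derive_Reals. intros eps He.
  assert (K := proj1 (filterlim_locally _ _) Hp (mkposreal eps He)).
  destruct K as [d K]. exists d. intros x Nx Hx.
  replace (h (s + x) - h s) with (p (s + x) * x) by (rewrite H; ring).
  replace (p (s + x) * x / x - p s) with (p (s + x) - p s) by (field; exact Nx).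
  apply (K (s + x)). unfold ball; simpl; unfold AbsRing_ball, abs, minus, plus, opp; simpl.
  replace (s + x + - s) with x by ring. exact Hx.
Qed.

Lemma is_derive_caratheodory_inv (h : R -> R) (s l : R) :
  is_derive h s l ->
  exists p : R -> R, continuous p s /\ p s = l /\ forall t, h t - h s = p t * (t - s).
Proof.
  intros D. apply is_derive_Reals in D.
  exists (fun t => if Req_dec_T t s then l else (h t - h s) / (t - s)).
  split; [|split].
  - apply filterlim_locally. intros eps.
    destruct (D eps (cond_pos eps)) as [d Hd]. exists d. intros t Ht.
    destruct (Req_dec_T s s) as [_|N]; [|congruence].
    destruct (Req_dec_T t s) as [E|N]; [apply ball_center|].
    unfold ball in *; simpl in *; unfold AbsRing_ball, abs, minus, plus, opp in *; simpl in *.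
    assert (N' : t - s <> 0) by lra.
    specialize (Hd (t - s) N' Ht). replace (s + (t - s)) with t in Hd by ring. exact Hd.
  - destruct (Req_dec_T s s); congruence.
  - intros t. destruct (Req_dec_T t s) as [->|N]; [ring|field; lra].
Qed.

(** Componentwise, so that the real mean value theorem and the real fundamental theorem of calculus
    apply directly. *)
Definition curve_deriv (h : R -> C) (t : R) (l : C) : Prop :=
  is_derive (fun s => Re (h s)) t (Re l) /\ is_derive (fun s => Im (h s)) t (Im l).

Lemma curve_deriv_caratheodory (h q : R -> C) (t : R) :
  continuous q t -> (forall s, Cminus (h s) (h t) = Cmult (q s) (RtoC (s - t))) ->
  curve_deriv h t (q t).
Proof.
  intros Hq H. split.
  - apply (is_derive_caratheodory _ (fun s => Re (q s))); [now apply continuous_Re|].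
    intros s. specialize (H s). apply (f_equal Re) in H. simpl in H. unfold Re in *. lra.
  - apply (is_derive_caratheodory _ (fun s => Im (q s))); [now apply continuous_Im|].
    intros s. specialize (H s). apply (f_equal Im) in H. simpl in H. unfold Im in *. lra.
Qed.

Lemma curve_deriv_caratheodory_inv (h : R -> C) (t : R) (l : C) :
  curve_deriv h t l -> exists q : R -> C, continuous q t /\ q t = l /\
    forall s, Cminus (h s) (h t) = Cmult (q s) (RtoC (s - t)).
Proof.
  intros [D1 D2].
  destruct (is_derive_caratheodory_inv _ _ _ D1) as [p1 [C1 [E1 H1]]].
  destruct (is_derive_caratheodory_inv _ _ _ D2) as [p2 [C2 [E2 H2]]].
  exists (fun s => (p1 s, p2 s)). split; [|split].
  - now apply continuous_C.
  - rewrite E1, E2. now destruct l.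
  - intros s. specialize (H1 s). specialize (H2 s). unfold Re, Im in *.
    unfold Cminus, Cplus, Copp, Cmult, RtoC; simpl. f_equal; lra.
Qed.

Lemma curve_deriv_continuous (h : R -> C) (t : R) (l : C) :
  curve_deriv h t l -> continuous h t.
Proof.
  intros [D1 D2]. apply continuous_C;
  apply (ex_derive_continuous (V := R_NormedModule)); eexists; eassumption.
Qed.

Lemma curve_deriv_ext (h k : R -> C) (t : R) (l : C) :
  (forall s, h s = k s) -> curve_deriv h t l -> curve_deriv k t l.
Proof.
  intros E [A B]. split.
  - apply (is_derive_ext (fun s => Re (h s))); [intros; now rewrite E|exact A].
  - apply (is_derive_ext (fun s => Im (h s))); [intros; now rewrite E|exact B].
Qed.

(** In Carathéodory's form the chain rule is a substitution: the quotient of the composite is the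
    product of the quotients, with no division by an increment of [gam] that could vanish. *)
Lemma curve_deriv_comp (f : C -> C) (gam : R -> C) (t : R) (l m : C) :
  cderiv f (gam t) l -> curve_deriv gam t m ->
  curve_deriv (fun s => f (gam s)) t (Cmult l m).
Proof.
  intros [q [Hq [E D]]] Dg. assert (Cg := curve_deriv_continuous _ _ _ Dg).
  destruct (curve_deriv_caratheodory_inv _ _ _ Dg) as [p [Hp [E' D']]].
  rewrite <- E, <- E'.
  apply (curve_deriv_caratheodory _ (fun s => Cmult (q (gam s)) (p s))).
  - apply continuous_Cmult; [|exact Hp].
    now apply (continuous_comp gam q).
  - intros s. rewrite D, D'. ring.
Qed.

Lemma curve_deriv_mult (h k : R -> C) (t : R) (l m : C) :
  curve_deriv h t l -> curve_deriv k t m ->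
  curve_deriv (fun s => Cmult (h s) (k s)) t (Cplus (Cmult l (k t)) (Cmult (h t) m)).
Proof.
  intros Dh Dk. assert (Ck := curve_deriv_continuous _ _ _ Dk).
  destruct (curve_deriv_caratheodory_inv _ _ _ Dh) as [q [Hq [E D]]].
  destruct (curve_deriv_caratheodory_inv _ _ _ Dk) as [p [Hp [E' D']]].
  rewrite <- E, <- E'.
  apply (curve_deriv_caratheodory _ (fun s => Cplus (Cmult (q s) (k s)) (Cmult (h t) (p s)))).
  - apply continuous_Cplus; apply continuous_Cmult; try assumption. apply continuous_const.
  - intros s.
    transitivity (Cplus (Cmult (Cminus (h s) (h t)) (k s)) (Cmult (h t) (Cminus (k s) (k t)))).
    { ring. } rewrite D, D'. ring.
Qed.

Lemma curve_deriv_const (c : C) (t : R) : curve_deriv (fun _ => c) t (RtoC 0).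
Proof. split; apply (is_derive_const (V := R_NormedModule)). Qed.

Lemma curve_deriv_RtoC (t : R) : curve_deriv RtoC t (RtoC 1).
Proof.
  split; simpl; [apply (is_derive_id (K := R_AbsRing))|apply (is_derive_const (V := R_NormedModule))].
Qed.

Lemma curve_deriv_plus (h k : R -> C) (t : R) (l m : C) :
  curve_deriv h t l -> curve_deriv k t m ->
  curve_deriv (fun s => Cplus (h s) (k s)) t (Cplus l m).
Proof.
  intros [A B] [A' B']. split; simpl.
  - exact (is_derive_plus _ _ _ _ _ A A').
  - exact (is_derive_plus _ _ _ _ _ B B').
Qed.

(** Both values are the derivative of [f] along the horizontal line through [z]. *)
Lemma cderiv_unique (f : C -> C) (z l m : C) : cderiv f z l -> cderiv f z m -> l = m.
Proof.
  intros D1 D2.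
  assert (G : curve_deriv (fun s => Cplus z (RtoC s)) 0 (RtoC 1)).
  { replace (RtoC 1) with (Cplus (RtoC 0) (RtoC 1)) by ring.
    apply curve_deriv_plus; [apply curve_deriv_const|apply curve_deriv_RtoC]. }
  assert (Z : z = Cplus z (RtoC 0)) by ring.
  rewrite Z in D1, D2.
  destruct (curve_deriv_comp f (fun s => Cplus z (RtoC s)) 0 _ _ D1 G) as [A B].
  destruct (curve_deriv_comp f (fun s => Cplus z (RtoC s)) 0 _ _ D2 G) as [A' B'].
  apply is_derive_unique in A, B, A', B'. rewrite A in A'. rewrite B in B'.
  rewrite !Cmult_1_r in A', B'. destruct l, m; simpl in *. congruence.
Qed.

Lemma Re_le_Cmod (c : C) : Re c <= Cmod c.
Proof. eapply Rle_trans; [apply Rle_abs|apply re_le_Cmod]. Qed.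

(** Reduces an upper bound for a modulus to one for the real part of a rotated quantity, for which
    the real order and the real theorems on series and integrals are available. *)
Lemma Cmod_rotation (c : C) : exists u : C, Cmod u = 1 /\ Cmult u c = RtoC (Cmod c).
Proof.
  destruct (Ceq_dec c (RtoC 0)) as [->|N].
  { exists (RtoC 1). rewrite Cmod_1, Cmod_0. split; [reflexivity|ring]. }
  assert (P := proj1 (Cmod_gt_0 _) N).
  assert (NP : RtoC (Cmod c) <> RtoC 0).
  { intros E. apply RtoC_inj in E. lra. }
  exists (Cdiv (RtoC (Cmod c)) c). split.
  - rewrite Cmod_div, Cmod_R, Rabs_pos_eq by (assumption || lra). field. lra.
  - field. exact N.
Qed.

(** Complex functions have no mean value equality. Rotating the increment onto the positive axis and
    applying the real theorem to [Re (u h) - B] yields the inequality. The majorant enters through a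
    primitive [B], so integrability of [dh] is never discussed. *)
Lemma curve_mean_value (h dh : R -> C) (B : R -> R) (dB : R -> R) (a b : R) :
  a <= b ->
  (forall t, a <= t <= b -> curve_deriv h t (dh t)) ->
  (forall t, a <= t <= b -> is_derive B t (dB t)) ->
  (forall t, a <= t <= b -> Cmod (dh t) <= dB t) ->
  Cmod (Cminus (h b) (h a)) <= B b - B a.
Proof.
  intros Hab Dh DB Hle.
  destruct (Cmod_rotation (Cminus (h b) (h a))) as [u [Hu Eu]].
  set (k := fun t => Re (Cmult u (h t)) - B t).
  assert (Dk : forall t, a <= t <= b -> is_derive k t (Re (Cmult u (dh t)) - dB t)).
  { intros t Ht. apply (is_derive_minus (V := R_NormedModule)); [|now apply DB].
    destruct (curve_deriv_mult (fun _ => u) h t _ _ (curve_deriv_const u t) (Dh t Ht)) as [A _].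
    replace (Cplus (Cmult (RtoC 0) (h t)) (Cmult u (dh t))) with (Cmult u (dh t)) in A by ring.
    exact A. }
  destruct (MVT_gen k a b (fun t => Re (Cmult u (dh t)) - dB t)) as [c [Hc E]].
  { rewrite Rmin_left, Rmax_right by lra. intros x Hx. apply Dk. lra. }
  { rewrite Rmin_left, Rmax_right by lra. intros x Hx. 
    apply continuity_pt_filterlim. apply (ex_derive_continuous (V := R_NormedModule)).
    eexists. apply Dk. lra. }
  rewrite Rmin_left, Rmax_right in Hc by lra.
  assert (L := Re_le_Cmod (Cmult u (dh c))). rewrite Cmod_mult, Hu, Rmult_1_l in L.
  specialize (Hle c Hc).
  assert (F : Re (Cmult u (Cminus (h b) (h a))) = Cmod (Cminus (h b) (h a))).
  { now rewrite Eu. }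
  replace (Cmult u (Cminus (h b) (h a))) with (Cminus (Cmult u (h b)) (Cmult u (h a))) in F by ring.
  replace (Re (Cminus (Cmult u (h b)) (Cmult u (h a)))) with
     (Re (Cmult u (h b)) - Re (Cmult u (h a))) in F by (unfold Re; simpl; ring).
  unfold k in E.
  assert ((Re (Cmult u (dh c)) - dB c) * (b - a) <= 0) by nra.
  lra.
Qed.

(** * Complex power series *)

Lemma sum_n_C (a : nat -> C) (n : nat) :
  sum_n (G := C_NormedModule) a n =
  (sum_n (fun k => Re (a k)) n, sum_n (fun k => Im (a k)) n).
Proof.
  induction n as [|n IH].
  - rewrite !sum_O. now destruct (a 0%nat).
  - rewrite !sum_Sn, IH. reflexivity.
Qed.

Lemma is_series_C (a : nat -> C) (l : C) :
  is_series (V := C_NormedModule) a l <->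
  is_series (fun n => Re (a n)) (Re l) /\ is_series (fun n => Im (a n)) (Im l).
Proof.
  unfold is_series. split.
  - intros H. split.
    + apply (filterlim_ext (fun n => fst (sum_n (G := C_NormedModule) a n))).
      { intros n. now rewrite sum_n_C. }
      apply (filterlim_comp _ _ _ (sum_n (G := C_NormedModule) a) (fun c : C => fst c) _ _ _ H).
      destruct l. apply continuous_fst.
    + apply (filterlim_ext (fun n => snd (sum_n (G := C_NormedModule) a n))).
      { intros n. now rewrite sum_n_C. }
      apply (filterlim_comp _ _ _ (sum_n (G := C_NormedModule) a) (fun c : C => snd c) _ _ _ H).
      destruct l. apply continuous_snd.
  - intros [H1 H2].
    apply (filterlim_ext (fun n => (sum_n (fun k => Re (a k)) n, sum_n (fun k => Im (a k)) n))).
    { intros n. now rewrite sum_n_C. }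
    intros P [eps HP].
    assert (E1 := proj1 (filterlim_locally _ _) H1 eps).
    assert (E2 := proj1 (filterlim_locally _ _) H2 eps).
    unfold filtermap. generalize (filter_and _ _ E1 E2). apply filter_imp.
    intros n [A B]. apply HP. split; assumption.
Qed.

Lemma is_series_C_unique (a : nat -> C) (l m : C) :
  is_series (V := C_NormedModule) a l -> is_series (V := C_NormedModule) a m -> l = m.
Proof.
  intros [A B]%is_series_C [A' B']%is_series_C.
  apply is_series_unique in A, B, A', B'.
  destruct l, m; simpl in *. congruence.
Qed.

Lemma is_series_Cmult (c : C) (a : nat -> C) (l : C) :
  is_series (V := C_NormedModule) a l ->
  is_series (V := C_NormedModule) (fun n => Cmult c (a n)) (Cmult c l).
Proof. exact (is_series_scal c a l). Qed.

Lemma is_series_Cminus (a b : nat -> C) (l m : C) :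
  is_series (V := C_NormedModule) a l -> is_series (V := C_NormedModule) b m ->
  is_series (V := C_NormedModule) (fun n => Cminus (a n) (b n)) (Cminus l m).
Proof. exact (is_series_minus a b l m). Qed.

Lemma is_series_Cmod_le (a : nat -> C) (b : nat -> R) (l : C) :
  is_series (V := C_NormedModule) a l -> (forall n, Cmod (a n) <= b n) ->
  ex_series b -> Cmod l <= Series b.
Proof.
  intros H Hb Eb.
  destruct (Cmod_rotation l) as [u [Hu E]].
  apply (is_series_Cmult u) in H. rewrite E in H.
  apply is_series_C in H. destruct H as [H _]. simpl in H.
  assert (L : is_lim_seq (sum_n (fun n => Re (Cmult u (a n)))) (Cmod l)) by exact H.
  apply Series_correct in Eb.
  assert (L' : is_lim_seq (sum_n b) (Series b)) by exact Eb.
  refine (is_lim_seq_le _ _ _ _ (fun n => sum_n_m_le _ _ 0 n (fun k => _)) L L').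
  apply (Rle_trans _ _ _ (Re_le_Cmod _)). rewrite Cmod_mult, Hu, Rmult_1_l. apply Hb.
Qed.

Definition Cseries (a : nat -> C) : C :=
  (Series (fun n => Re (a n)), Series (fun n => Im (a n))).

Lemma Cseries_correct (a : nat -> C) :
  ex_series (fun n => Cmod (a n)) -> is_series (V := C_NormedModule) a (Cseries a).
Proof.
  intros H. apply is_series_C. split; apply Series_correct;
  apply (ex_series_le (V := R_CompleteNormedModule) _ (fun n => Cmod (a n))); try exact H;
  intros n; apply (Rle_trans _ (Rmax (Rabs (fst (a n))) (Rabs (snd (a n))))); try apply Rmax_Cmod.
  - apply Rmax_l.
  - apply Rmax_r.
Qed.

Definition Cpseries (a : nat -> C) (z : C) : C := Cseries (fun n => Cmult (Cpow z n) (a n)).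

Lemma is_pseries_Cpow (a : nat -> C) (z l : C) :
  is_pseries (V := C_NormedModule) a z l <->
  is_series (V := C_NormedModule) (fun n => Cmult (Cpow z n) (a n)) l.
Proof.
  split; intros H; exact H.
Qed.

(** Equivalent to a lower bound on [CV_radius] of the moduli, through which the real theory settles
    convergence of the differentiated and integrated coefficients. *)
Definition abs_conv (a : nat -> C) (rad : R) : Prop :=
  forall r, 0 <= r < rad -> ex_series (fun n => Cmod (a n) * r ^ n).

Lemma abs_conv_bounded (a : nat -> C) (rad : R) :
  (forall r, 0 <= r < rad -> exists M, forall n, Cmod (a n) * r ^ n <= M) ->
  forall r, 0 <= r < rad -> Rbar_lt r (CV_radius (fun n => Cmod (a n))).
Proof.
  intros H r Hr. destruct (CV_radius_bounded (fun n => Cmod (a n))) as [U _].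
  apply (Rbar_lt_le_trans _ ((r + rad) / 2)); [simpl; lra|].
  apply U. destruct (H ((r + rad) / 2)) as [M HM]; [lra|].
  exists M. intros n. rewrite Rabs_pos_eq; [apply HM|].
  apply Rmult_le_pos; [apply Cmod_ge_0|apply pow_le; lra].
Qed.

Lemma radius_abs_conv (a : nat -> C) (rad : R) :
  (forall r, 0 <= r < rad -> Rbar_lt r (CV_radius (fun n => Cmod (a n)))) -> abs_conv a rad.
Proof.
  intros H r Hr.
  apply (ex_series_ext (fun n => Rabs (Cmod (a n) * r ^ n))).
  { intros n. apply Rabs_pos_eq.
    apply Rmult_le_pos; [apply Cmod_ge_0|apply pow_le; lra]. }
  apply CV_disk_inside. rewrite Rabs_pos_eq by lra. now apply H.
Qed.

Lemma ex_series_bounded (a : nat -> R) :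
  ex_series a -> exists M, forall n, Rabs (a n) <= M.
Proof.
  intros H. destruct (filterlim_bounded (K := R_AbsRing) (V := R_NormedModule) a) as [M HM].
  { exists 0. now apply ex_series_lim_0. }
  exists M. exact HM.
Qed.

Lemma series_terms_bounded (a : nat -> C) (l : C) :
  is_series (V := C_NormedModule) a l -> exists M, forall n, Cmod (a n) <= M.
Proof.
  intros [A B]%is_series_C.
  destruct (ex_series_bounded _ (ex_intro _ _ A)) as [M HM].
  destruct (ex_series_bounded _ (ex_intro _ _ B)) as [N HN].
  exists (sqrt 2 * Rmax M N). intros n.
  eapply Rle_trans; [apply Cmod_2Rmax|].
  apply Rmult_le_compat_l; [apply sqrt_pos|].
  apply Rmax_lub; [eapply Rle_trans; [apply HM|apply Rmax_l]|eapply Rle_trans; [apply HN|apply Rmax_r]].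
Qed.

(** Convergence at the real point [r] already bounds [|a_n| r ^ n], and bounded terms at larger
    radii give absolute convergence at smaller ones. *)
Lemma pseries_abs_conv (a : nat -> C) (rad : R) (f : C -> C) :
  (forall z, Cmod z < rad -> is_pseries (V := C_NormedModule) a z (f z)) -> abs_conv a rad.
Proof.
  intros H. apply radius_abs_conv, abs_conv_bounded. intros r Hr.
  assert (Hz : Cmod (RtoC r) < rad) by (rewrite Cmod_R, Rabs_pos_eq; lra).
  specialize (H _ Hz). apply (proj1 (is_pseries_Cpow _ _ _)) in H.
  destruct (series_terms_bounded _ _ H) as [M HM]. exists M. intros n.
  specialize (HM n). rewrite Cmod_mult, Cmod_pow, Cmod_R, Rabs_pos_eq in HM by lra. lra.
Qed.

Lemma abs_conv_radius (a : nat -> C) (rad : R) :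
  abs_conv a rad -> forall r, 0 <= r < rad -> Rbar_lt r (CV_radius (fun n => Cmod (a n))).
Proof.
  intros H. apply abs_conv_bounded. intros r Hr. specialize (H r Hr).
  destruct (ex_series_bounded _ H) as [M HM].
  exists M. intros n. eapply Rle_trans; [apply Rle_abs|apply HM].
Qed.

Lemma Cpseries_correct (a : nat -> C) (rad : R) (z : C) :
  abs_conv a rad -> Cmod z < rad -> is_pseries (V := C_NormedModule) a z (Cpseries a z).
Proof.
  intros H Hz. apply (proj2 (is_pseries_Cpow _ _ _)). apply Cseries_correct.
  apply (ex_series_ext (fun n => Cmod (a n) * Cmod z ^ n)).
  { intros n. rewrite Cmod_mult, Cmod_pow. apply Rmult_comm. }
  apply H. split; [apply Cmod_ge_0|exact Hz].
Qed.

Lemma is_pseries_Cpseries (a : nat -> C) (z l : C) :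
  is_pseries (V := C_NormedModule) a z l -> Cpseries a z = l.
Proof.
  intros H. apply (proj1 (is_pseries_Cpow _ _ _)) in H.
  apply (is_series_C_unique (fun n => Cmult (Cpow z n) (a n))); [|exact H].
  apply is_series_C in H. destruct H as [A B].
  apply is_series_C. split; apply Series_correct; eexists; eassumption.
Qed.

Definition deriv_seq (a : nat -> C) (n : nat) : C := Cmult (RtoC (INR (S n))) (a (S n)).

Lemma Cmod_deriv_seq (a : nat -> C) (n : nat) :
  Cmod (deriv_seq a n) = PS_derive (fun n => Cmod (a n)) n.
Proof.
  unfold deriv_seq, PS_derive. rewrite Cmod_mult, Cmod_R, Rabs_pos_eq; [reflexivity|apply pos_INR].
Qed.

Lemma abs_conv_deriv (a : nat -> C) (rad : R) : abs_conv a rad -> abs_conv (deriv_seq a) rad.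
Proof.
  intros H. apply radius_abs_conv. intros r Hr.
  rewrite (CV_radius_ext _ _ (Cmod_deriv_seq a)), CV_radius_derive.
  now apply (abs_conv_radius a rad).
Qed.

(** The index is left unshifted so that this series can be subtracted termwise from the one of
    [Cpseries a]. The factor [INR 0] kills the term in which [pred] truncates. *)
Lemma is_series_deriv (a : nat -> C) (rad : R) (z : C) : abs_conv a rad -> Cmod z < rad ->
  is_series (V := C_NormedModule) (fun n => Cmult (Cmult (RtoC (INR n)) (Cpow z (pred n))) (a n))
    (Cpseries (deriv_seq a) z).
Proof.
  intros H Hz. assert (Sd := Cpseries_correct _ rad z (abs_conv_deriv _ _ H) Hz).
  apply (proj1 (is_pseries_Cpow _ _ _)) in Sd.
  apply is_series_decr_1.
  replace (plus _ _) with (Cpseries (deriv_seq a) z).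
  2:{ simpl. unfold plus, opp; simpl. eqC. ring. }
  revert Sd. apply is_series_ext. intros n. unfold deriv_seq. simpl pred. eqC. ring.
Qed.

Definition pow_remainder (w z : C) (n : nat) : C :=
  Cminus (Cminus (Cpow w n) (Cpow z n))
         (Cmult (Cmult (RtoC (INR n)) (Cpow z (pred n))) (Cminus w z)).

(** The remainders satisfy [R_(m+1) = w R_m + m z ^ (m-1) (w - z) ^ 2], whence an induction. The
    constant is twice the sharp one; it is exactly the factor that two applications of [deriv_seq]
    put on the coefficient. *)
Lemma pow_remainder_bound (w z : C) (r : R) (n : nat) :
  Cmod w <= r -> Cmod z <= r ->
  Cmod (pow_remainder w z (S (S n))) <=
  INR (S n) * INR (S (S n)) * r ^ n * Cmod (Cminus w z) ^ 2.
Proof.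
  intros Hw Hz.
  assert (Hr : 0 <= r) by (eapply Rle_trans; [apply Cmod_ge_0|exact Hw]).
  assert (Rec : forall n, pow_remainder w z (S (S n)) =
    Cplus (Cmult w (pow_remainder w z (S n)))
      (Cmult (Cmult (RtoC (INR (S n))) (Cpow z n)) (Cmult (Cminus w z) (Cminus w z)))).
  { intros m. unfold pow_remainder. simpl pred. rewrite !Cpow_S, !S_INR, !RtoC_plus. ring. }
  assert (Step : forall n X, Cmod (pow_remainder w z (S n)) <= X ->
     Cmod (pow_remainder w z (S (S n))) <= r * X + INR (S n) * r ^ n * Cmod (Cminus w z) ^ 2).
  { intros m X HX. rewrite Rec. eapply Rle_trans; [apply Cmod_triangle|].
    rewrite !Cmod_mult, Cmod_pow, Cmod_R, (Rabs_pos_eq (INR _)) by apply pos_INR.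
    apply Rplus_le_compat.
    - apply Rmult_le_compat; try apply Cmod_ge_0; assumption.
    - replace (Cmod (Cminus w z) ^ 2) with (Cmod (Cminus w z) * Cmod (Cminus w z)) by ring.
      apply Rmult_le_compat_r; [apply Rmult_le_pos; apply Cmod_ge_0|].
      apply Rmult_le_compat_l; [apply pos_INR|].
      apply pow_incr. split; [apply Cmod_ge_0|exact Hz]. }
  assert (D2 := pow2_ge_0 (Cmod (Cminus w z))).
  induction n as [|n IH].
  - eapply Rle_trans. { apply (Step 0%nat 0).
    unfold pow_remainder. simpl. replace (Cminus _ _) with (RtoC 0) by ring. rewrite Cmod_0. lra. }
    simpl. lra.
  - eapply Rle_trans; [apply (Step (S n)); exact IH|].
    set (D := Cmod (Cminus w z) ^ 2) in *.
    assert (P : 0 <= r * r ^ n * D).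
    { apply Rmult_le_pos; [|exact D2]. apply Rmult_le_pos; [exact Hr|now apply pow_le]. }
    rewrite !S_INR. simpl pow. assert (N := pos_INR n). nra.
Qed.

(** Termwise second order remainders are summed on the disc of radius [r] midway between [|z|] and
    [rad]. The resulting quadratic error constant is the majorant series of the second derivative at
    [r]. *)
Lemma cderiv_Cpseries (a : nat -> C) (rad : R) (z : C) :
  abs_conv a rad -> Cmod z < rad -> cderiv (Cpseries a) z (Cpseries (deriv_seq a) z).
Proof.
  intros H Hz. assert (Z0 := Cmod_ge_0 z).
  set (r := (Cmod z + rad) / 2).
  assert (Hd := abs_conv_deriv _ _ H). assert (Hdd := abs_conv_deriv _ _ Hd).
  specialize (Hdd r ltac:(unfold r; lra)).
  set (B := fun n => Cmod (deriv_seq (deriv_seq a) n) * r ^ n) in *.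
  apply (cderiv_quadratic _ _ _ (Series B)).
  apply locally_Cmod. exists (r - Cmod z). split; [unfold r; lra|].
  intros w Hw.
  assert (Hwr : Cmod w < r).
  { replace w with (Cplus z (Cminus w z)) by ring.
    eapply Rle_lt_trans; [apply Cmod_triangle|lra]. }
  assert (Sw := Cpseries_correct a rad w H ltac:(unfold r in *; lra)).
  assert (Sz := Cpseries_correct a rad z H Hz).
  apply (proj1 (is_pseries_Cpow _ _ _)) in Sw, Sz.
  set (D := fun n => Cmult (Cmult (RtoC (INR n)) (Cpow z (pred n))) (a n)).
  assert (SD := is_series_deriv a rad z H Hz : is_series (V := C_NormedModule) D _).
  assert (T := is_series_Cminus _ _ _ _ (is_series_Cminus _ _ _ _ Sw Sz)
                 (is_series_Cmult (Cminus w z) _ _ SD)).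
  rewrite (Cmult_comm (Cpseries (deriv_seq a) z)).
  set (h := Cminus w z) in *.
  (* The terms of degree 0 and 1 have no remainder; from degree 2 on, the bound is indexed by the
     second derivative. *)
  set (B' := fun n => match n with O => 0 | S O => 0 | S (S m) => B m * Cmod h ^ 2 end).
  assert (EB : is_series B' (Series B * Cmod h ^ 2)).
  { apply is_series_decr_1, is_series_decr_1. simpl B'.
    replace (plus _ _) with (Series B * Cmod h ^ 2).
    2:{ unfold plus, opp; simpl. eqR. ring. }
    apply is_series_scal_r. now apply Series_correct. }
  rewrite <- (is_series_unique _ _ EB).
  apply (is_series_Cmod_le _ B' _ T); [|now exists (Series B * Cmod h ^ 2)].
  intros n. unfold D.
  replace (Cminus _ _) with (Cmult (a n) (pow_remainder w z n)).
  2:{ unfold pow_remainder. fold h. ring. }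
  rewrite Cmod_mult.
  destruct n as [|[|n]]; simpl B'.
  - unfold pow_remainder. simpl. replace (Cminus _ _) with (RtoC 0) by ring. rewrite Cmod_0. lra.
  - unfold pow_remainder. simpl. replace (Cminus _ _) with (RtoC 0) by ring. rewrite Cmod_0. lra.
  - assert (K := pow_remainder_bound w z r n ltac:(lra) ltac:(unfold r; lra)). fold h in K.
    unfold B. rewrite Cmod_deriv_seq. unfold PS_derive. rewrite Cmod_deriv_seq. unfold PS_derive.
    apply (Rmult_le_compat_l (Cmod (a (S (S n))))) in K; [|apply Cmod_ge_0]. lra.
Qed.

Lemma is_series_0 : is_series (fun _ : nat => 0) 0.
Proof.
  apply (filterlim_ext (fun _ => 0)); [|apply filterlim_const].
  intros n. rewrite sum_n_const. eqR. ring.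
Qed.

Lemma Cpseries_zero (a : nat -> C) : Cpseries a (RtoC 0) = a 0%nat.
Proof.
  apply is_pseries_Cpseries, (proj2 (is_pseries_Cpow _ _ _)). apply is_series_decr_1.
  replace (plus _ _) with (RtoC 0).
  2:{ simpl. unfold plus, opp; simpl. eqC. ring. }
  apply (is_series_ext (fun _ => RtoC 0)).
  { intros n. rewrite Cpow_S. eqC. ring. }
  apply is_series_C. split; apply is_series_0.
Qed.

Lemma RtoC_INR_neq_0 (n : nat) : (0 < n)%nat -> RtoC (INR n) <> RtoC 0.
Proof.
  intros Hn E. apply RtoC_inj in E. apply lt_0_INR in Hn. lra.
Qed.

(** Induction through the derived series: if the sum vanishes on a disc, so does its derivative, and
    each constant term is a value at 0. *)
Lemma Cpseries_zero_coeff (a : nat -> C) (rad : R) :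
  0 < rad -> abs_conv a rad -> (forall z, Cmod z < rad -> Cpseries a z = RtoC 0) ->
  forall n, a n = RtoC 0.
Proof.
  intros HR H Z n. revert a H Z. induction n as [|n IH]; intros a H Z.
  - rewrite <- (Cpseries_zero a). apply Z. now rewrite Cmod_0.
  - assert (E : deriv_seq a n = RtoC 0).
    { apply IH; [now apply abs_conv_deriv|]. intros z Hz.
      apply (cderiv_unique (Cpseries a) z); [now apply (cderiv_Cpseries a rad)|].
      apply (cderiv_locally _ (fun _ => RtoC 0)); [apply continuous_const|reflexivity|].
      apply locally_Cmod. exists (rad - Cmod z). split; [lra|]. intros w Hw.
      rewrite !Z; [ring|lra|].
      replace w with (Cplus z (Cminus w z)) by ring.
      eapply Rle_lt_trans; [apply Cmod_triangle|lra]. }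
    unfold deriv_seq in E.
    destruct (Ceq_dec (a (S n)) (RtoC 0)) as [|N]; [assumption|exfalso].
    assert (N' := RtoC_INR_neq_0 (S n) ltac:(lia)).
    apply (Cmult_neq_0 _ _ N' N E).
Qed.

Lemma abs_conv_minus (a b : nat -> C) (rad : R) :
  abs_conv a rad -> abs_conv b rad -> abs_conv (fun n => Cminus (a n) (b n)) rad.
Proof.
  intros H K r Hr.
  apply (ex_series_le (V := R_CompleteNormedModule) _ (fun n => Cmod (a n) * r ^ n + Cmod (b n) * r ^ n)).
  - intros n. assert (P : 0 <= r ^ n) by (apply pow_le; lra).
    change (Rabs (Cmod (Cminus (a n) (b n)) * r ^ n) <= Cmod (a n) * r ^ n + Cmod (b n) * r ^ n).
    rewrite Rabs_pos_eq by (apply Rmult_le_pos; [apply Cmod_ge_0|exact P]).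
    rewrite <- Rmult_plus_distr_r. apply Rmult_le_compat_r; [exact P|].
    unfold Cminus. eapply Rle_trans; [apply Cmod_triangle|]. rewrite Cmod_opp. lra.
  - apply (ex_series_plus (V := R_NormedModule)); [now apply H|now apply K].
Qed.

Lemma pseries_coeff_unique (a b : nat -> C) (rad : R) (f : C -> C) :
  0 < rad ->
  (forall z, Cmod z < rad -> is_pseries (V := C_NormedModule) a z (f z)) ->
  (forall z, Cmod z < rad -> is_pseries (V := C_NormedModule) b z (f z)) ->
  forall n, a n = b n.
Proof.
  intros HR Ha Hb n.
  assert (Aa := pseries_abs_conv _ _ _ Ha). assert (Ab := pseries_abs_conv _ _ _ Hb).
  assert (E : Cminus (a n) (b n) = RtoC 0).
  { apply (Cpseries_zero_coeff (fun n => Cminus (a n) (b n)) rad HR).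
    - now apply abs_conv_minus.
    - intros z Hz. apply is_pseries_Cpseries, (proj2 (is_pseries_Cpow _ _ _)).
      replace (RtoC 0) with (Cminus (f z) (f z)) by ring.
      assert (S := is_series_Cminus _ _ _ _ (proj1 (is_pseries_Cpow _ _ _) (Ha z Hz))
                                            (proj1 (is_pseries_Cpow _ _ _) (Hb z Hz))).
      revert S. apply is_series_ext. intros m. eqC. ring. }
  replace (a n) with (Cplus (Cminus (a n) (b n)) (b n)) by ring. rewrite E. ring.
Qed.

Definition prim_seq (a : nat -> C) (n : nat) : C :=
  match n with O => RtoC 0 | S m => Cdiv (a m) (RtoC (INR (S m))) end.

Lemma deriv_prim_seq (a : nat -> C) (n : nat) : deriv_seq (prim_seq a) n = a n.
Proof.
  unfold deriv_seq, prim_seq. field. apply RtoC_INR_neq_0. lia.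
Qed.

Lemma Cpseries_ext (a b : nat -> C) (z : C) :
  (forall n, a n = b n) -> Cpseries a z = Cpseries b z.
Proof.
  intros E. unfold Cpseries, Cseries. f_equal; apply Series_ext; intros n; now rewrite E.
Qed.

Lemma abs_conv_prim (a : nat -> C) (rad : R) : abs_conv a rad -> abs_conv (prim_seq a) rad.
Proof.
  intros H. apply radius_abs_conv. intros r Hr.
  rewrite <- CV_radius_derive.
  rewrite (CV_radius_ext _ (fun n => Cmod (a n))); [now apply (abs_conv_radius a rad)|].
  intros n. rewrite <- Cmod_deriv_seq, deriv_prim_seq. reflexivity.
Qed.

Lemma cderiv_prim (a : nat -> C) (rad : R) (z : C) :
  abs_conv a rad -> Cmod z < rad -> cderiv (Cpseries (prim_seq a)) z (Cpseries a z).
Proof.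
  intros H Hz. rewrite (Cpseries_ext a (deriv_seq (prim_seq a))).
  - apply (cderiv_Cpseries _ rad); [now apply abs_conv_prim|exact Hz].
  - intros n. now rewrite deriv_prim_seq.
Qed.

(** * Cauchy's formula *)

Lemma filterlim_C_squeeze (u : nat -> C) (l : C) (e : nat -> R) :
  (forall n, Cmod (Cminus (u n) l) <= e n) -> is_lim_seq e 0 ->
  filterlim u eventually (locally l).
Proof.
  intros H He P HP. apply locally_Cmod in HP. destruct HP as [d [Hd HP]].
  assert (K := proj1 (filterlim_locally (F := eventually) e 0) He (mkposreal d Hd)).
  unfold filtermap. generalize K. apply filter_imp. intros n Hn. apply HP.
  eapply Rle_lt_trans; [apply H|].
  unfold ball in Hn; simpl in Hn; unfold AbsRing_ball, abs, minus, plus, opp in Hn; simpl in Hn.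
  eapply Rle_lt_trans; [apply Rle_abs|]. replace (e n) with (e n + - 0) by ring. exact Hn.
Qed.

Definition cint (h : R -> C) : C :=
  (RInt (fun t => Re (h t)) 0 (2 * PI), RInt (fun t => Im (h t)) 0 (2 * PI)).

Lemma two_PI_pos : 0 < 2 * PI.
Proof. generalize PI_RGT_0. lra. Qed.

Lemma ex_RInt_cont (f : R -> R) (a b : R) : (forall t, continuous f t) -> ex_RInt f a b.
Proof. intros H. apply (ex_RInt_continuous (V := R_CompleteNormedModule)). intros; apply H. Qed.

Lemma cint_ext (h k : R -> C) : (forall t, h t = k t) -> cint h = cint k.
Proof.
  intros E. unfold cint. f_equal; apply RInt_ext; intros; now rewrite E.
Qed.

Lemma cint_minus (h k : R -> C) :
  (forall t, continuous h t) -> (forall t, continuous k t) ->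
  cint (fun t => Cminus (h t) (k t)) = Cminus (cint h) (cint k).
Proof.
  intros H K. unfold cint, Cminus, Cplus, Copp; simpl. f_equal.
  - apply (RInt_minus (V := R_CompleteNormedModule) (fun t => Re (h t)) (fun t => Re (k t)));
    apply ex_RInt_cont; intros; now apply continuous_Re.
  - apply (RInt_minus (V := R_CompleteNormedModule) (fun t => Im (h t)) (fun t => Im (k t)));
    apply ex_RInt_cont; intros; now apply continuous_Im.
Qed.

Lemma Re_cint_mult (c : C) (h : R -> C) : (forall t, continuous h t) ->
  Re (Cmult c (cint h)) = RInt (fun t => Re (Cmult c (h t))) 0 (2 * PI).
Proof.
  intros H. symmetry. apply is_RInt_unique.
  apply (is_RInt_minus (V := R_NormedModule) (fun t => Re c * Re (h t)) (fun t => Im c * Im (h t)));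
  apply (is_RInt_scal (V := R_NormedModule)); apply (RInt_correct (V := R_CompleteNormedModule));
  apply ex_RInt_cont; intros; [now apply continuous_Re|now apply continuous_Im].
Qed.

(** Turns an identity between complex integrals into a family of real ones, so that differentiation
    under the integral sign is needed for real integrands only. *)
Lemma C_eq_Re (a b : C) : (forall c, Re (Cmult c a) = Re (Cmult c b)) -> a = b.
Proof.
  intros H. assert (H1 := H (RtoC 1)). assert (H2 := H Ci).
  destruct a, b; unfold Re in *; simpl in *. f_equal; lra.
Qed.

Lemma cint_mult (c : C) (h : R -> C) : (forall t, continuous h t) ->
  cint (fun t => Cmult c (h t)) = Cmult c (cint h).
Proof.
  intros H. apply C_eq_Re. intros d.
  rewrite Re_cint_mult.
  2:{ intros t. apply continuous_Cmult; [apply continuous_const|apply H]. }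
  rewrite Cmult_assoc, Re_cint_mult by exact H.
  apply RInt_ext. intros t _. now rewrite Cmult_assoc.
Qed.

Lemma cint_le (h : R -> C) (b : R -> R) :
  (forall t, continuous h t) -> ex_RInt b 0 (2 * PI) ->
  (forall t, 0 < t < 2 * PI -> Cmod (h t) <= b t) -> Cmod (cint h) <= RInt b 0 (2 * PI).
Proof.
  intros H Eb Hb. destruct (Cmod_rotation (cint h)) as [u [Hu E]].
  replace (Cmod (cint h)) with (Re (Cmult u (cint h))) by now rewrite E.
  rewrite Re_cint_mult by exact H.
  apply RInt_le; [generalize two_PI_pos; lra| |exact Eb|].
  - apply ex_RInt_cont. intros t. apply continuous_Re.
    apply continuous_Cmult; [apply continuous_const|apply H].
  - intros t Ht. eapply Rle_trans; [apply Re_le_Cmod|].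
    rewrite Cmod_mult, Hu, Rmult_1_l. now apply Hb.
Qed.

Lemma cint_le_const (h : R -> C) (M : R) :
  (forall t, continuous h t) -> (forall t, 0 <= t <= 2 * PI -> Cmod (h t) <= M) ->
  Cmod (cint h) <= 2 * PI * M.
Proof.
  intros H Hb. eapply Rle_trans.
  - apply (cint_le h (fun _ => M) H); [apply ex_RInt_const|intros; apply Hb; lra].
  - rewrite RInt_const. unfold scal; simpl; unfold mult; simpl. lra.
Qed.

Definition circ (r t : R) : C := (r * cos t, r * sin t).

Lemma circ_2PI (r : R) : circ r (2 * PI) = circ r 0.
Proof. unfold circ. now rewrite cos_2PI, sin_2PI, cos_0, sin_0. Qed.

Lemma Cmod_circ (r t : R) : 0 <= r -> Cmod (circ r t) = r.
Proof.
  intros Hr. unfold Cmod, circ; simpl.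
  replace (_ + _) with (r ^ 2 * (Rsqr (sin t) + Rsqr (cos t))) by (unfold Rsqr; ring).
  rewrite sin2_cos2, Rmult_1_r. now apply sqrt_pow2.
Qed.

Lemma circ_neq_0 (r t : R) : 0 < r -> circ r t <> RtoC 0.
Proof. intros Hr. apply Cmod_gt_0. rewrite Cmod_circ; lra. Qed.

Lemma curve_deriv_circ (r t : R) : curve_deriv (circ r) t (Cmult Ci (circ r t)).
Proof.
  split; unfold circ; simpl.
  - auto_derive; [exact I|]. ring.
  - auto_derive; [exact I|]. ring.
Qed.

Lemma continuous_circ (r t : R) : continuous (circ r) t.
Proof. eapply curve_deriv_continuous, curve_deriv_circ. Qed.

Lemma circ_minus_neq_0 (r t : R) (z : C) : Cmod z < r -> Cminus (circ r t) z <> RtoC 0.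
Proof.
  intros Hz E. assert (P := Cmod_ge_0 z).
  assert (Q : circ r t = z).
  { replace z with (Cplus (RtoC 0) z) by ring. rewrite <- E. ring. }
  assert (Hr : 0 <= r) by lra. rewrite <- Q, Cmod_circ in Hz; lra.
Qed.

(** [w / (w - z)] for [w] on the circle of radius [r]: the Cauchy kernel for [dt]. *)
Definition kern (r : R) (z : C) (t : R) : C := Cdiv (circ r t) (Cminus (circ r t) z).

Lemma continuous_kern (r t : R) (z : C) : Cmod z < r -> continuous (kern r z) t.
Proof.
  intros H. apply continuous_Cmult; [apply continuous_circ|].
  apply continuous_Cinv; [|now apply circ_minus_neq_0].
  apply continuous_Cminus; [apply continuous_circ|apply continuous_const].
Qed.

(** Continuity of the derivative is part of the notion because the homotopy argument differentiates
    under an integral sign. Power series provide it at once. *)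
Definition holo (f f' : C -> C) (rad : R) : Prop :=
  forall z, Cmod z < rad -> cderiv f z (f' z) /\ continuous f' z.

Section Homotopy.
Variables (f f' : C -> C) (R0 r : R) (z c : C).
Hypotheses (Hf : holo f f' R0) (Hz : Cmod z < r) (Hr : r < R0).

(** [pos] moves from [z] at [u = 0] to the circle at [u = 1]. In the derivative of [F] in [u] the
    chain rule produces [circ r t - z], which cancels the denominator of [kern] and leaves [dF]. *)
Let pos (u t : R) : C := Cplus z (Cmult (RtoC u) (Cminus (circ r t) z)).
Let F (u t : R) : R := Re (Cmult c (Cmult (f (pos u t)) (kern r z t))).
Let dF (u t : R) : R := Re (Cmult c (Cmult (f' (pos u t)) (circ r t))).

Lemma homotopy_bound (l : R) : 0 <= l <= 1 ->
  locally l (fun u => forall t, Cmod (pos u t) < R0).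
Proof.
  intros Hl. assert (P := Cmod_ge_0 z).
  (* For [u = l] the point lies within radius [r], and [|circ r t - z| <= 2 r]; a change of [u] by
     less than this amount moves it by less than [R0 - r], for all [t] at once. *)
  assert (Hd : 0 < (R0 - r) / (2 * r)) by (apply Rdiv_lt_0_compat; lra).
  exists (mkposreal _ Hd). intros u Hu t.
  unfold ball in Hu; simpl in Hu; unfold AbsRing_ball, abs, minus, plus, opp in Hu; simpl in Hu.
  assert (Ec := Cmod_circ r t ltac:(lra)).
  replace (pos u t) with (Cplus (Cplus (Cmult (RtoC (1 - l)) z) (Cmult (RtoC l) (circ r t)))
     (Cmult (RtoC (u + - l)) (Cminus (circ r t) z))).
  2:{ unfold pos. rewrite RtoC_minus, RtoC_plus, RtoC_opp. ring. }
  eapply Rle_lt_trans; [apply Cmod_triangle|].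
  eapply Rle_lt_trans; [apply Rplus_le_compat_r, Cmod_triangle|].
  rewrite !Cmod_mult, !Cmod_R, Ec, (Rabs_pos_eq (1 - l)), (Rabs_pos_eq l) by lra.
  assert (B : Cmod (Cminus (circ r t) z) <= 2 * r).
  { unfold Cminus. eapply Rle_trans; [apply Cmod_triangle|]. rewrite Cmod_opp, Ec. lra. }
  assert (Hm : Rabs (u + - l) * (2 * r) < R0 - r).
  { apply (Rmult_lt_compat_r (2 * r)) in Hu; [|lra].
    replace ((R0 - r) / (2 * r) * (2 * r)) with (R0 - r) in Hu by (field; lra). exact Hu. }
  assert (Q := Rabs_pos (u + - l)). assert (Q' := Cmod_ge_0 (Cminus (circ r t) z)).
  nra.
Qed.

Lemma homotopy_derive (u t : R) : Cmod (pos u t) < R0 ->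
  is_derive (fun v => F v t) u (dF u t).
Proof.
  intros H. destruct (Hf _ H) as [D _].
  assert (G : curve_deriv (fun v => pos v t) u (Cminus (circ r t) z)).
  { replace (Cminus (circ r t) z) with (Cplus (RtoC 0) (Cplus (Cmult (RtoC 1) (Cminus (circ r t) z))
       (Cmult (RtoC u) (RtoC 0)))) by ring.
    apply curve_deriv_plus; [apply curve_deriv_const|].
    apply (curve_deriv_mult RtoC (fun _ => Cminus (circ r t) z)); 
      [apply curve_deriv_RtoC|apply curve_deriv_const]. }
  assert (K := curve_deriv_comp f (fun v => pos v t) u _ _ D G).
  assert (K' := curve_deriv_mult _ _ _ _ _ (curve_deriv_const c u) 
     (curve_deriv_mult _ _ _ _ _ K (curve_deriv_const (kern r z t) u))).
  destruct K' as [K' _].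
  replace (dF u t) with (Re (Cplus
             (Cmult (RtoC 0) (Cmult (f (pos u t)) (kern r z t)))
             (Cmult c (Cplus (Cmult (Cmult (f' (pos u t)) (Cminus (circ r t) z)) (kern r z t))
                   (Cmult (f (pos u t)) (RtoC 0)))))).
  { exact K'. }
  unfold dF. f_equal. unfold kern. field. now apply circ_minus_neq_0.
Qed.

Lemma homotopy_continuous_2d (u t : R) : Cmod (pos u t) < R0 -> continuity_2d_pt dF u t.
Proof.
  intros H. apply continuity_2d_pt_filterlim.
  assert (Cc : continuous (fun p : R * R => circ r (snd p)) (u, t)).
  { apply (continuous_comp snd (circ r)); [apply continuous_snd|apply continuous_circ]. }
  apply (continuous_Re (fun p : R * R =>
     Cmult c (Cmult (f' (pos (fst p) (snd p))) (circ r (snd p)))) (u, t)).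
  apply continuous_Cmult; [apply continuous_const|].
  apply continuous_Cmult; [|exact Cc].
  apply (continuous_comp (fun p : R * R => pos (fst p) (snd p)) f').
  2: now apply Hf.
  apply continuous_Cplus; [apply continuous_const|].
  apply continuous_Cmult.
  - apply continuous_C; simpl; [apply continuous_fst|apply continuous_const].
  - apply continuous_Cminus; [exact Cc|apply continuous_const].
Qed.

Lemma homotopy_integrable (u : R) : (forall t, Cmod (pos u t) < R0) ->
  ex_RInt (fun t => F u t) 0 (2 * PI).
Proof.
  intros H. apply ex_RInt_cont. intros t. apply continuous_Re.
  apply continuous_Cmult; [apply continuous_const|].
  apply continuous_Cmult; [|now apply continuous_kern].
  apply (continuous_comp (pos u) f).
  - apply continuous_Cplus; [apply continuous_const|].
    apply continuous_Cmult; [apply continuous_const|].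
    apply continuous_Cminus; [apply continuous_circ|apply continuous_const].
  - eapply cderiv_continuous. now apply Hf.
Qed.

(** Since [pos u] has derivative [i u circ r t] in [t], [dF u] is the derivative of
    [Re (c f (pos u t) / (i u))], which takes the same value at both ends of the closed curve. The
    division by [u] excludes [u = 0]. *)
Lemma homotopy_integral_zero (u : R) : u <> 0 -> (forall t, Cmod (pos u t) < R0) ->
  RInt (fun t => dF u t) 0 (2 * PI) = 0.
Proof.
  intros Hu H. apply is_RInt_unique.
  assert (Nu : RtoC u <> RtoC 0) by (intros E; apply RtoC_inj in E; lra).
  assert (Ni : Ci <> RtoC 0) by (intros E; inversion E; lra).
  set (K := fun t => Re (Cmult (Cdiv c (Cmult Ci (RtoC u))) (f (pos u t)))).
  replace 0 with (minus (K (2 * PI)) (K 0)) at 2.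
  2:{ unfold K, pos. rewrite circ_2PI. unfold minus, plus, opp; simpl. ring. }
  apply (is_RInt_derive (V := R_CompleteNormedModule) K (fun t => dF u t)).
  - intros t _. destruct (Hf _ (H t)) as [D _].
    assert (G : curve_deriv (fun s => pos u s) t (Cmult (RtoC u) (Cmult Ci (circ r t)))).
    { replace (Cmult (RtoC u) (Cmult Ci (circ r t))) with (Cplus (RtoC 0) (Cplus
         (Cmult (RtoC 0) (Cminus (circ r t) z))
         (Cmult (RtoC u) (Cplus (Cmult Ci (circ r t)) (RtoC 0))))) by ring.
      apply curve_deriv_plus; [apply curve_deriv_const|].
      apply (curve_deriv_mult (fun _ => RtoC u)); [apply curve_deriv_const|].
      apply curve_deriv_plus; [apply curve_deriv_circ|apply curve_deriv_const]. }
    assert (K1 := curve_deriv_mult _ _ _ _ _ (curve_deriv_const (Cdiv c (Cmult Ci (RtoC u))) t)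
      (curve_deriv_comp f _ t _ _ D G)).
    destruct K1 as [K1 _].
    replace (dF u t) with (Re (Cplus (Cmult (RtoC 0) (f (pos u t)))
             (Cmult (Cdiv c (Cmult Ci (RtoC u)))
                (Cmult (f' (pos u t)) (Cmult (RtoC u) (Cmult Ci (circ r t))))))).
    { exact K1. }
    unfold dF. f_equal. field. split; assumption.
  - intros t _.
    assert (E := homotopy_continuous_2d u t (H t)).
    apply continuity_2d_pt_filterlim in E.
    apply (continuous_comp_2 (fun _ : R => u) (fun t : R => t) dF); 
      [apply continuous_const|apply continuous_id|exact E].
Qed.

Lemma homotopy_end : RInt (fun t => F 1 t) 0 (2 * PI) = RInt (fun t => F 0 t) 0 (2 * PI).
Proof.
  set (U := fun u => RInt (fun t => F u t) 0 (2 * PI)).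
  assert (DU : forall u, 0 <= u <= 1 ->
     is_derive U u (RInt (fun t => Derive (fun v => F v t) u) 0 (2 * PI))).
  { intros u Hu. assert (L := homotopy_bound u Hu).
    apply is_derive_RInt_param.
    - generalize L. apply filter_imp. intros v Hv t _. eexists. apply homotopy_derive, Hv.
    - intros t _.
      apply (continuity_2d_pt_ext_loc dF).
      2:{ apply homotopy_continuous_2d. exact (locally_singleton _ _ L t). }
      destruct L as [d L]. exists d. intros v s Hv Hs.
      symmetry. apply is_derive_unique. apply homotopy_derive. now apply L.
    - generalize L. apply filter_imp. intros v Hv. now apply homotopy_integrable. }
  (* The derivative of [U] is known to vanish only for [u > 0]; the mean value theorem asks no more
     than continuity at [u = 0]. *)
  destruct (MVT_gen U 0 1 (fun _ => 0)) as [x [_ E]].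
  - rewrite Rmin_left, Rmax_right by lra. intros u Hu.
    assert (B := locally_singleton _ _ (homotopy_bound u ltac:(lra))). simpl in B.
    rewrite <- (homotopy_integral_zero u) by (lra || exact B).
    rewrite (RInt_ext (fun t => dF u t) (fun t => Derive (fun v => F v t) u)).
    { apply DU. lra. }
    intros t _. symmetry. apply is_derive_unique, homotopy_derive, B.
  - rewrite Rmin_left, Rmax_right by lra. intros u Hu.
    apply continuity_pt_filterlim. apply (ex_derive_continuous (V := R_NormedModule)).
    eexists. now apply DU.
  - unfold U in E. lra.
Qed.

End Homotopy.

(** Shrinking the circle to [z] along segments does not change the integral:
    the derivative in the shrinking parameter is the integral of a total
    derivative along the circle. *)
Lemma cauchy_kernel (f f' : C -> C) (R0 r : R) (z : C) :
  holo f f' R0 -> Cmod z < r -> r < R0 ->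
  cint (fun t => Cmult (f (circ r t)) (kern r z t)) = Cmult (f z) (cint (kern r z)).
Proof.
  intros Hf Hz Hr. apply C_eq_Re. intros c.
  rewrite Re_cint_mult.
  2:{ intros t. apply continuous_Cmult; [|now apply continuous_kern].
      apply (continuous_comp (circ r) f); [apply continuous_circ|].
      eapply cderiv_continuous. apply Hf. rewrite Cmod_circ; [exact Hr|].
      generalize (Cmod_ge_0 z). lra. }
  rewrite <- cint_mult, Re_cint_mult.
  2:{ intros t. apply continuous_Cmult; [apply continuous_const|now apply continuous_kern]. }
  2:{ intros t. now apply continuous_kern. }
  transitivity (RInt (fun t => Re (Cmult c (Cmult (f (Cplus z (Cmult (RtoC 1) (Cminus (circ r t) z))))
     (kern r z t)))) 0 (2 * PI)).
  { apply RInt_ext. intros t _. do 3 f_equal. f_equal. ring. }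
  rewrite (homotopy_end f f' R0 r z c Hf Hz Hr).
  apply RInt_ext. intros t _. do 3 f_equal. f_equal. ring.
Qed.

Lemma continuous_Cpow {T : UniformSpace} (h : T -> C) (x : T) (n : nat) :
  continuous h x -> continuous (fun y => Cpow (h y) n) x.
Proof.
  intros H. induction n as [|n IH]; [apply continuous_const|].
  apply (continuous_ext (fun y => Cmult (h y) (Cpow (h y) n))); [intros; now rewrite Cpow_S|].
  now apply continuous_Cmult.
Qed.

Lemma continuous_circ_inv (r t : R) : 0 < r -> continuous (fun t => Cinv (circ r t)) t.
Proof.
  intros Hr. apply continuous_Cinv; [apply continuous_circ|now apply circ_neq_0].
Qed.

Lemma continuous_circle_bound (h : R -> C) :
  (forall t, continuous h t) -> exists M, 0 <= M /\ forall t, 0 <= t <= 2 * PI -> Cmod (h t) <= M.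
Proof.
  intros H. assert (P := two_PI_pos).
  destruct (continuous_ab_maj_consistent (fun t => Cmod (h t)) 0 (2 * PI)) as [x [Hx _]].
  - lra.
  - intros t _. now apply continuous_Cmod.
  - exists (Cmod (h x)). split; [apply Cmod_ge_0|exact Hx].
Qed.

(** [kern] is a geometric series in [z / circ r t]. Keeping the remainder [h n] exact makes the
    partial sums telescope, so no exchange of sum and integral is needed: the integral of [h n] is
    [O ((|z| / r) ^ n)]. *)
Lemma is_series_kern (phi : R -> C) (r : R) (z : C) :
  (forall t, continuous phi t) -> Cmod z < r ->
  is_series (V := C_NormedModule)
    (fun n => Cmult (Cpow z n) (cint (fun t => Cmult (phi t) (Cpow (Cinv (circ r t)) n))))
    (cint (fun t => Cmult (phi t) (kern r z t))).
Proof.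
  intros Hphi Hz. assert (Pz := Cmod_ge_0 z). assert (Hr : 0 < r) by lra.
  set (g := fun t => Cmult (phi t) (kern r z t)).
  set (h := fun n t => Cmult (g t) (Cpow (Cmult z (Cinv (circ r t))) n)).
  assert (Cg : forall t, continuous g t).
  { intros t. apply continuous_Cmult; [apply Hphi|now apply continuous_kern]. }
  assert (Ch : forall n t, continuous (h n) t).
  { intros n t. apply continuous_Cmult; [apply Cg|]. apply continuous_Cpow.
    apply continuous_Cmult; [apply continuous_const|now apply continuous_circ_inv]. }
  assert (Step : forall n, Cmult (Cpow z n) (cint (fun t => Cmult (phi t) (Cpow (Cinv (circ r t)) n)))
                 = Cminus (cint (h n)) (cint (h (S n)))).
  { intros n. rewrite <- cint_minus by apply Ch. rewrite <- cint_mult.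
    2:{ intros t. apply continuous_Cmult; [apply Hphi|].
        apply continuous_Cpow. now apply continuous_circ_inv. }
    apply cint_ext. intros t. unfold h, g, kern. rewrite Cpow_S, !Cpow_mult_l. field.
    split; [now apply circ_neq_0|now apply circ_minus_neq_0]. }
  assert (Sum : forall N, sum_n (G := C_NormedModule) (fun n => Cmult (Cpow z n)
     (cint (fun t => Cmult (phi t) (Cpow (Cinv (circ r t)) n)))) N
     = Cminus (cint g) (cint (h (S N)))).
  { assert (E0 : cint (h 0%nat) = cint g).
    { apply cint_ext. intros t. unfold h. simpl. ring. }
    induction N as [|N IH].
    - rewrite sum_O, Step, E0. reflexivity.
    - rewrite sum_Sn, IH, Step. unfold plus; simpl. eqC. ring. }
  destruct (continuous_circle_bound g Cg) as [M [HM0 HM]].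
  apply (filterlim_C_squeeze _ _ (fun N => 2 * PI * (M * (Cmod z / r) ^ S N))).
  - intros N. rewrite Sum.
    replace (Cminus _ _) with (Copp (cint (h (S N)))) by ring. rewrite Cmod_opp.
    apply cint_le_const; [apply Ch|]. intros t Ht. unfold h.
    rewrite Cmod_mult, Cmod_pow, Cmod_mult, Cmod_inv, Cmod_circ by (lra || now apply circ_neq_0).
    apply Rmult_le_compat_r; [|now apply HM].
    apply pow_le. apply Rmult_le_pos; [lra|]. left. now apply Rinv_0_lt_compat.
  - replace (Finite 0) with (Rbar_mult (2 * PI) (Rbar_mult M 0)).
    2:{ simpl. f_equal. ring. }
    apply is_lim_seq_scal_l, is_lim_seq_scal_l.
    apply (is_lim_seq_incr_1 (fun n => (Cmod z / r) ^ n)).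
    apply is_lim_seq_geom. rewrite Rabs_pos_eq.
    + apply (Rmult_lt_reg_r r); [exact Hr|]. unfold Rdiv. rewrite Rmult_assoc, Rinv_l by lra. lra.
    + apply Rmult_le_pos; [lra|]. left. now apply Rinv_0_lt_compat.
Qed.

Lemma Cpow_circ_inv (r t : R) (n : nat) : 0 < r ->
  Cpow (Cinv (circ r t)) n =
  Cmult (RtoC (/ r ^ n)) (cos (INR n * t), - sin (INR n * t)).
Proof.
  intros Hr. assert (E1 : Cinv (circ r t) = Cmult (RtoC (/ r)) (cos t, - sin t)).
  { assert (N := circ_neq_0 r t Hr).
    replace (Cmult (RtoC (/ r)) (cos t, - sin t)) with
      (Cmult (Cinv (circ r t)) (Cmult (circ r t) (Cmult (RtoC (/ r)) (cos t, - sin t)))).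
    2:{ field. exact N. }
    replace (Cmult (circ r t) (Cmult (RtoC (/ r)) (cos t, - sin t))) with (RtoC 1).
    { ring. }
    unfold circ, Cmult, RtoC; simpl. assert (Q := sin2_cos2 t). unfold Rsqr in Q.
    f_equal; field_simplify; try lra. }
  induction n as [|n IH].
  - simpl. rewrite Rmult_0_l, cos_0, sin_0, Rinv_1. unfold Cmult, RtoC; simpl. f_equal; ring.
  - rewrite Cpow_S, IH, E1, S_INR.
    replace ((INR n + 1) * t) with (INR n * t + t) by ring. rewrite cos_plus, sin_plus.
    assert (P : r ^ n <> 0) by (apply pow_nonzero; lra).
    unfold Cmult, RtoC; simpl. f_equal; field; split; lra.
Qed.

Lemma cint_Cpow_circ_inv (r : R) (n : nat) : 0 < r ->
  cint (fun t => Cpow (Cinv (circ r t)) n) = match n with O => RtoC (2 * PI) | _ => RtoC 0 end.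
Proof.
  intros Hr.
  assert (Cc : forall t : R, continuous (fun t : R => (cos (INR n * t), - sin (INR n * t)) : C) t).
  { intros t. apply continuous_C; simpl;
    apply (ex_derive_continuous (V := R_NormedModule)); auto_derive; exact I. }
  rewrite (cint_ext _ _ (fun t => Cpow_circ_inv r t n Hr)).
  rewrite (cint_mult (RtoC (/ r ^ n)) _ Cc).
  destruct n as [|n].
  - unfold cint. simpl. rewrite (RInt_ext _ (fun _ => 1)), (RInt_ext (fun t => - sin (0 * t)) (fun _ => 0)).
    + rewrite !RInt_const. unfold scal, RtoC, Cmult; simpl; unfold mult; simpl.
      f_equal; field.
    + intros. rewrite Rmult_0_l, sin_0. eqR. ring.
    + intros. rewrite Rmult_0_l, cos_0. reflexivity.
  - replace (cint _) with (RtoC 0); [ring|].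
    assert (Hn : INR (S n) <> 0) by (apply not_0_INR; lia).
    assert (P1 : cos (INR (S n) * (2 * PI)) = 1).
    { replace (INR (S n) * (2 * PI)) with (0 + 2 * INR (S n) * PI) by ring.
      now rewrite cos_period, cos_0. }
    assert (P2 : sin (INR (S n) * (2 * PI)) = 0).
    { replace (INR (S n) * (2 * PI)) with (0 + 2 * INR (S n) * PI) by ring.
      now rewrite sin_period, sin_0. }
    remember (INR (S n)) as m eqn:Em. clear Em.
    apply injective_projections;
      [change (0 = RInt (fun t => cos (m * t)) 0 (2 * PI))
      |change (0 = RInt (fun t => - sin (m * t)) 0 (2 * PI))];
      symmetry; apply (is_RInt_unique (V := R_CompleteNormedModule)).
    + replace 0 with (minus (sin (m * (2 * PI)) / m) (sin (m * 0) / m)) at 2.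
      2:{ rewrite P2, Rmult_0_r, sin_0. unfold minus, plus, opp; simpl. field. exact Hn. }
      apply (is_RInt_derive (V := R_CompleteNormedModule) (fun t => sin (m * t) / m)).
      * intros t _. auto_derive; [exact I|]. field. exact Hn.
      * intros t _. now apply (continuous_Re (fun t : R => (cos (m * t), - sin (m * t)) : C)).
    + replace 0 with (minus (cos (m * (2 * PI)) / m) (cos (m * 0) / m)) at 2.
      2:{ rewrite P1, Rmult_0_r, cos_0. unfold minus, plus, opp; simpl. field. exact Hn. }
      apply (is_RInt_derive (V := R_CompleteNormedModule) (fun t => cos (m * t) / m)).
      * intros t _. auto_derive; [exact I|]. field. exact Hn.
      * intros t _. now apply (continuous_Im (fun t : R => (cos (m * t), - sin (m * t)) : C)).
Qed.

(** The expansion for the constant function 1; orthogonality of the powers leaves only the term of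
    index 0. *)
Lemma cint_kern (r : R) (z : C) : Cmod z < r -> cint (kern r z) = RtoC (2 * PI).
Proof.
  intros Hz. assert (Hr : 0 < r) by (generalize (Cmod_ge_0 z); lra).
  assert (H := is_series_kern (fun _ => RtoC 1) r z (fun t => continuous_const _ _) Hz).
  rewrite (cint_ext _ (kern r z)) in H by (intros; ring).
  apply (is_series_C_unique _ _ _ H).
  apply is_series_decr_1.
  rewrite (cint_ext _ (fun t => Cpow (Cinv (circ r t)) 0)) by (intros; ring).
  rewrite cint_Cpow_circ_inv by exact Hr.
  replace (plus _ _) with (RtoC 0).
  2:{ unfold plus, opp; simpl. eqC. ring. }
  apply (is_series_ext (fun _ => RtoC 0)).
  2:{ apply is_series_C. split; apply is_series_0. }
  intros n.
  rewrite (cint_ext _ (fun t => Cpow (Cinv (circ r t)) (S n))) by (intros; ring).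
  rewrite cint_Cpow_circ_inv by exact Hr. eqC. ring.
Qed.

Definition cauchy_coeff (f : C -> C) (r : R) (n : nat) : C :=
  Cmult (RtoC (/ (2 * PI))) (cint (fun t => Cmult (f (circ r t)) (Cpow (Cinv (circ r t)) n))).

Theorem cauchy_series (f f' : C -> C) (R0 r : R) (z : C) :
  holo f f' R0 -> Cmod z < r -> r < R0 ->
  is_pseries (V := C_NormedModule) (cauchy_coeff f r) z (f z).
Proof.
  intros Hf Hz Hr. assert (Hr0 : 0 < r) by (generalize (Cmod_ge_0 z); lra).
  assert (P := two_PI_pos).
  assert (NP : RtoC (2 * PI) <> RtoC 0) by (intros E; apply RtoC_inj in E; lra).
  assert (Cf : forall t, continuous (fun t => f (circ r t)) t).
  { intros t. apply (continuous_comp (circ r) f); [apply continuous_circ|].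
    eapply cderiv_continuous. apply Hf. rewrite Cmod_circ; lra. }
  assert (H := is_series_kern (fun t => f (circ r t)) r z Cf Hz). cbv beta in H.
  rewrite (cauchy_kernel f f' R0 r z Hf Hz Hr), cint_kern in H by exact Hz.
  apply (is_series_Cmult (RtoC (/ (2 * PI)))) in H.
  apply (proj2 (is_pseries_Cpow _ _ _)).
  replace (Cmult (RtoC (/ (2 * PI))) (Cmult (f z) (RtoC (2 * PI)))) with (f z) in H.
  2:{ rewrite RtoC_inv by lra. field. exact NP. }
  revert H. apply is_series_ext. intros n. unfold cauchy_coeff. eqC. ring.
Qed.

(** The coefficients must not depend on [z], but the Cauchy formula at [z] needs a circle beyond
    [|z|]. They are taken on radius [R0 / 2]; uniqueness identifies those of every larger circle
    with them. *)
Corollary holo_pseries (f f' : C -> C) (R0 : R) :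
  0 < R0 -> holo f f' R0 ->
  exists a, forall z, Cmod z < R0 -> is_pseries (V := C_NormedModule) a z (f z).
Proof.
  intros HR Hf. exists (cauchy_coeff f (R0 / 2)). intros z Hz.
  set (r := (Rmax (Cmod z) (R0 / 2) + R0) / 2).
  assert (M1 := Rmax_l (Cmod z) (R0 / 2)). assert (M2 := Rmax_r (Cmod z) (R0 / 2)).
  assert (M3 : Rmax (Cmod z) (R0 / 2) < R0) by (apply Rmax_lub_lt; lra).
  assert (H := cauchy_series f f' R0 r z Hf ltac:(unfold r; lra) ltac:(unfold r; lra)).
  revert H. apply is_series_ext. intros n. f_equal.
  apply (pseries_coeff_unique _ _ (R0 / 2) f ltac:(lra)).
  - intros w Hw. apply (cauchy_series f f' R0); [exact Hf|unfold r; lra|unfold r; lra].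
  - intros w Hw. apply (cauchy_series f f' R0); [exact Hf|lra|lra].
Qed.

(** * Taylor coefficients on the disk *)

Lemma cderiv_shift (g : C -> C) (w z l : C) :
  cderiv g (Cminus z w) l -> cderiv (fun x => g (Cminus x w)) z l.
Proof.
  intros [q [Hq [E D]]].
  exists (fun x => q (Cminus x w)). split; [|split].
  - apply (continuous_comp (fun x : C => Cminus x w) q); [|exact Hq].
    apply continuous_Cminus; [apply continuous_id|apply continuous_const].
  - exact E.
  - intros x. rewrite D. f_equal. ring.
Qed.

(** Derivative in the real direction as a total function. Analyticity yields a derivative point by
    point, whereas [holo] asks for a single function. *)
Definition part_deriv (f : C -> C) (z : C) : C :=
  (Derive (fun t => Re (f (Cplus z (RtoC t)))) 0, Derive (fun t => Im (f (Cplus z (RtoC t)))) 0).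

Lemma part_deriv_correct (f : C -> C) (z l : C) : cderiv f z l -> part_deriv f z = l.
Proof.
  intros D1.
  assert (G : curve_deriv (fun s => Cplus z (RtoC s)) 0 (RtoC 1)).
  { replace (RtoC 1) with (Cplus (RtoC 0) (RtoC 1)) by ring.
    apply curve_deriv_plus; [apply curve_deriv_const|apply curve_deriv_RtoC]. }
  assert (Z : z = Cplus z (RtoC 0)) by ring.
  rewrite Z in D1.
  destruct (curve_deriv_comp f (fun s => Cplus z (RtoC s)) 0 _ _ D1 G) as [A B].
  apply is_derive_unique in A, B. rewrite Cmult_1_r in A, B.
  apply injective_projections; [exact A|exact B].
Qed.

Lemma taylor_abs_conv (a : nat -> C) (f : C -> C) : taylor a f -> abs_conv a 1.
Proof. intros H. apply (pseries_abs_conv a 1 f). exact H. Qed.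

Lemma disk_ball (z w : C) : Cmod (Cminus w z) < 1 - Cmod z -> disk w.
Proof.
  intros H. unfold disk. replace w with (Cplus z (Cminus w z)) by ring.
  eapply Rle_lt_trans; [apply Cmod_triangle|lra].
Qed.

Lemma locally_disk (z : C) : disk z -> locally z disk.
Proof.
  intros H. apply locally_Cmod. exists (1 - Cmod z). split; [unfold disk in H; lra|].
  intros w. apply disk_ball.
Qed.

Lemma taylor_holo (a : nat -> C) (f : C -> C) :
  taylor a f -> holo f (Cpseries (deriv_seq a)) 1.
Proof.
  intros H z Hz. assert (A := taylor_abs_conv _ _ H). split.
  - apply (cderiv_ext_loc (Cpseries a)); [|now apply (cderiv_Cpseries a 1)].
    generalize (locally_disk z Hz). apply filter_imp. intros w Hw.
    now apply is_pseries_Cpseries, H.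
  - eapply cderiv_continuous. apply (cderiv_Cpseries _ 1); [|exact Hz].
    now apply abs_conv_deriv.
Qed.

Lemma analytic_holo (f : C -> C) : analytic f -> holo f (part_deriv f) 1.
Proof.
  intros H w Hw. destruct (H w Hw) as [c Hc].
  apply locally_Cmod in Hc. destruct Hc as [d [Hd Hc]].
  assert (A : abs_conv c d).
  { apply (pseries_abs_conv c d (fun h => f (Cplus h w))). intros h Hh.
    replace h with (Cminus (Cplus h w) w) at 1 by ring. apply Hc.
    replace (Cminus (Cplus h w) w) with h by ring. exact Hh. }
  assert (D : forall z, Cmod (Cminus z w) < d -> cderiv f z (Cpseries (deriv_seq c) (Cminus z w))).
  { intros z Hz. apply (cderiv_ext_loc (fun x => Cpseries c (Cminus x w))).
    - apply locally_Cmod. exists (d - Cmod (Cminus z w)). split; [lra|].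
      intros x Hx. apply is_pseries_Cpseries, Hc.
      replace (Cminus x w) with (Cplus (Cminus x z) (Cminus z w)) by ring.
      eapply Rle_lt_trans; [apply Cmod_triangle|lra].
    - apply cderiv_shift. now apply (cderiv_Cpseries c d). }
  assert (W : Cmod (Cminus w w) < d).
  { replace (Cminus w w) with (RtoC 0) by ring. now rewrite Cmod_0. }
  split.
  - rewrite (part_deriv_correct f w _ (D w W)). now apply D.
  - apply (continuous_ext_loc _ (fun z => Cpseries (deriv_seq c) (Cminus z w))).
    + apply locally_Cmod. exists d. split; [exact Hd|]. intros z Hz.
      symmetry. now apply part_deriv_correct, D.
    + eapply cderiv_continuous. apply cderiv_shift.
      apply (cderiv_Cpseries _ d); [now apply abs_conv_deriv|exact W].
Qed.

Lemma analytic_taylor (f : C -> C) : analytic f -> exists a, taylor a f.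
Proof.
  intros H. destruct (holo_pseries f _ 1 Rlt_0_1 (analytic_holo f H)) as [a Ha].
  exists a. exact Ha.
Qed.

(** Expansion about [w] by applying Cauchy's formula to the translated function, which avoids
    rearranging a double series. *)
Lemma taylor_analytic (b : nat -> C) (g : C -> C) : taylor b g -> analytic g.
Proof.
  intros H w Hw. assert (HR : 0 < 1 - Cmod w) by (unfold disk in Hw; lra).
  assert (K : forall h, Cmod h < 1 - Cmod w -> disk (Cminus h (Copp w))).
  { intros h Hh. apply (disk_ball w).
    replace (Cminus (Cminus h (Copp w)) w) with h by ring. exact Hh. }
  destruct (holo_pseries (fun h => g (Cminus h (Copp w)))
     (fun h => Cpseries (deriv_seq b) (Cminus h (Copp w))) _ HR) as [c Hc].
  { intros h Hh. destruct (taylor_holo _ _ H _ (K h Hh)) as [D Cc]. split.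
    - now apply cderiv_shift.
    - apply (continuous_comp (fun h : C => Cminus h (Copp w))); [|exact Cc].
      apply continuous_Cminus; [apply continuous_id|apply continuous_const]. }
  exists c. apply locally_Cmod. exists (1 - Cmod w). split; [exact HR|].
  intros z Hz. specialize (Hc _ Hz). cbv beta in Hc.
  replace (Cminus (Cminus z w) (Copp w)) with z in Hc by ring. exact Hc.
Qed.

Lemma taylor_cauchy_coeff (a : nat -> C) (f : C -> C) (r : R) (n : nat) :
  taylor a f -> 0 < r < 1 -> a n = cauchy_coeff f r n.
Proof.
  intros H Hr. apply (pseries_coeff_unique _ _ r f); [lra| |].
  - intros z Hz. apply H. unfold disk. lra.
  - intros z Hz. apply (cauchy_series f _ 1 r z (taylor_holo _ _ H)); lra.
Qed.

(** * Partial sums of the coefficients through the Dirichlet kernel *)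

(** A weakening of the norm bound, without the logarithm and with [1 - |z|] in place of
    [1 - |z| ^ 2]. Convergence and the change of path rest on this alone. *)
Definition growth (M alpha : R) (f : C -> C) : Prop :=
  forall z, disk z -> Cmod (f z) <= M * Rpower (1 - Cmod z) (- alpha).

(** The alternating series gives [sin x >= x - x ^ 3 / 6], and [x ^ 2 <= 4]. It is applied to half
    angles, which reach at most about [PI / 2]. *)
Lemma sin_half_lower (x : R) : 0 <= x <= 2 -> x / 3 <= sin x.
Proof.
  intros Hx. assert (P := PI2_3_2). assert (HP : x <= PI) by lra.
  destruct (SIN x ltac:(lra) HP) as [L _]. eapply Rle_trans; [|exact L].
  assert (E : sin_lb x = x - x * x * x / 6 + x * (x * x) * (x * x) * (42 - x * x) / 5040).
  { unfold sin_lb, sin_approx, sum_f_R0, sin_term.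
    replace (INR (Factorial.fact (2 * 0 + 1))) with 1 by (simpl; lra).
    replace (INR (Factorial.fact (2 * 1 + 1))) with 6 by (simpl; lra).
    replace (INR (Factorial.fact (2 * 2 + 1))) with 120 by (rewrite INR_IZR_INZ; reflexivity).
    replace (INR (Factorial.fact (2 * 3 + 1))) with 5040 by (rewrite INR_IZR_INZ; reflexivity).
    simpl. field. }
  rewrite E.
  assert (0 <= x * (x * x) * (x * x) * (42 - x * x)).
  { apply Rmult_le_pos; [|nra]. repeat apply Rmult_le_pos; lra. }
  assert (0 <= x * (4 - x * x)) by (apply Rmult_le_pos; nra).
  lra.
Qed.

Lemma Cmod_circ_minus_1 (r t : R) :
  Cmod (Cminus (circ r t) (RtoC 1)) ^ 2 = (1 - r) ^ 2 + 4 * r * sin (t / 2) ^ 2.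
Proof.
  rewrite Cmod2_alt. unfold circ; simpl. unfold Re, Im; simpl.
  assert (E : cos t = 1 - 2 * sin (t / 2) * sin (t / 2)).
  { replace t with (2 * (t / 2)) at 1 by field. apply cos_2a_sin. }
  assert (Q := sin2_cos2 t). unfold Rsqr in Q.
  replace ((r * cos t + - (1)) * ((r * cos t + - (1)) * 1) + (r * sin t + - 0) * ((r * sin t + - 0) * 1))
    with (r * r * (sin t * sin t + cos t * cos t) - 2 * r * cos t + 1) by ring.
  rewrite Q, E. ring.
Qed.

(** From [sin (t / 2) >= t / 6] and [4 r >= 2] the squared distance is at least
    [(1 - r) ^ 2 + t ^ 2 / 18]; then [(a + b) ^ 2 <= 2 a ^ 2 + 2 b ^ 2]. The range of [t] covers the
    upper half circle. *)
Lemma circ_distance_lower (r t : R) : 1 / 2 <= r < 1 -> 0 <= t <= 4 ->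
  (1 - r + t) / 6 <= Cmod (Cminus (circ r t) (RtoC 1)).
Proof.
  intros Hr Ht. apply Rsqr_incr_0; [|lra|apply Cmod_ge_0].
  assert (S := sin_half_lower (t / 2) ltac:(lra)).
  assert (E := Cmod_circ_minus_1 r t). unfold Rsqr.
  assert (S2 : (t / 6) ^ 2 <= sin (t / 2) ^ 2) by (apply pow_incr; lra).
  assert (S3 : 2 * sin (t / 2) ^ 2 <= 4 * r * sin (t / 2) ^ 2).
  { apply Rmult_le_compat_r; [apply pow2_ge_0|lra]. }
  assert (S4 := pow2_ge_0 (1 - r - t)). assert (S5 := pow2_ge_0 (1 - r)).
  nra.
Qed.

(** The lower half circle is handled by the reflection [t -> 2 PI - t]. Adding the two bounds gives
    one integrand with an elementary primitive instead of a case distinction. *)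
Lemma circ_distance_inv (r t : R) : 1 / 2 <= r < 1 -> 0 <= t <= 2 * PI ->
  / Cmod (Cminus (circ r t) (RtoC 1)) <= 6 / (1 - r + t) + 6 / (1 - r + (2 * PI - t)).
Proof.
  intros Hr Ht. assert (PB := PI_4).
  assert (A : forall s, 0 <= s <= 4 ->
     / Cmod (Cminus (circ r s) (RtoC 1)) <= 6 / (1 - r + s)).
  { intros s Hs. assert (L := circ_distance_lower r s Hr Hs).
    replace (6 / (1 - r + s)) with (/ ((1 - r + s) / 6)) by (field; lra).
    apply Rinv_le_contravar; [lra|exact L]. }
  assert (P1 : 0 < 6 / (1 - r + t)) by (apply Rdiv_lt_0_compat; lra).
  assert (P2 : 0 < 6 / (1 - r + (2 * PI - t))) by (apply Rdiv_lt_0_compat; lra).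
  destruct (Rle_dec t PI) as [L|L].
  - specialize (A t ltac:(lra)). lra.
  - specialize (A (2 * PI - t) ltac:(lra)).
    assert (E : Cmod (Cminus (circ r (2 * PI - t)) (RtoC 1)) = Cmod (Cminus (circ r t) (RtoC 1))).
    { apply Rsqr_inj; try apply Cmod_ge_0. unfold Rsqr.
      assert (E1 := Cmod_circ_minus_1 r t). assert (E2 := Cmod_circ_minus_1 r (2 * PI - t)).
      replace ((2 * PI - t) / 2) with (PI - t / 2) in E2 by field.
      rewrite sin_PI_x in E2. lra. }
    rewrite E in A. lra.
Qed.

Lemma RInt_circ_distance_inv (u : R) : 0 < u <= 1 ->
  is_RInt (fun t => 6 / (u + t) + 6 / (u + (2 * PI - t))) 0 (2 * PI)
    (12 * ln ((u + 2 * PI) / u)).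
Proof.
  intros Hu. assert (P := two_PI_pos).
  set (F := fun t => 6 * ln (u + t) - 6 * ln (u + (2 * PI - t))).
  replace (12 * ln ((u + 2 * PI) / u)) with (minus (F (2 * PI)) (F 0)).
  2:{ unfold F, minus, plus, opp; simpl. rewrite ln_div by lra.
      replace (u + (2 * PI - 2 * PI)) with u by ring.
      replace (u + (2 * PI - 0)) with (u + 2 * PI) by ring.
      replace (u + 0) with u by ring. ring. }
  apply (is_RInt_derive (V := R_CompleteNormedModule) F).
  - intros t Ht. rewrite Rmin_left, Rmax_right in Ht by lra. unfold F.
    auto_derive; [lra|]. field. lra.
  - intros t Ht. rewrite Rmin_left, Rmax_right in Ht by lra.
    apply (ex_derive_continuous (V := R_NormedModule)). auto_derive. lra.
Qed.

Lemma geom_sum_C (x : C) (N : nat) :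
  Cmult (Cminus (RtoC 1) x) (sum_n (G := C_NormedModule) (Cpow x) N) =
  Cminus (RtoC 1) (Cpow x (S N)).
Proof.
  induction N as [|N IH].
  - rewrite sum_O. simpl. ring.
  - rewrite sum_Sn. change (plus ?u ?v) with (Cplus u v).
    rewrite Cmult_plus_distr_l, IH, !Cpow_S. ring.
Qed.

Lemma continuous_sum_n_C (h : nat -> R -> C) (t : R) (N : nat) :
  (forall n, continuous (h n) t) ->
  continuous (fun s => sum_n (G := C_NormedModule) (fun n => h n s) N) t.
Proof.
  intros H. induction N as [|N IH].
  - apply (continuous_ext (h 0%nat)); [intros; now rewrite sum_O|apply H].
  - apply (continuous_ext (fun s => Cplus (sum_n (G := C_NormedModule) (fun n => h n s) N) (h (S N) s))).
    + intros. now rewrite sum_Sn.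
    + now apply continuous_Cplus.
Qed.

Lemma cint_plus (h k : R -> C) :
  (forall t, continuous h t) -> (forall t, continuous k t) ->
  cint (fun t => Cplus (h t) (k t)) = Cplus (cint h) (cint k).
Proof.
  intros H K.
  rewrite (cint_ext _ (fun t => Cminus (h t) (Cmult (Copp (RtoC 1)) (k t)))).
  - rewrite cint_minus, cint_mult; try assumption.
    + ring.
    + intros t. apply continuous_Cmult; [apply continuous_const|apply K].
  - intros t. ring.
Qed.

Lemma cauchy_coeff_sum (f : C -> C) (r : R) (N : nat) :
  0 < r -> (forall t, continuous (fun t => f (circ r t)) t) ->
  sum_n (G := C_NormedModule) (cauchy_coeff f r) N =
  Cmult (RtoC (/ (2 * PI)))
    (cint (fun t => Cmult (f (circ r t)) (sum_n (G := C_NormedModule) (Cpow (Cinv (circ r t))) N))).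
Proof.
  intros Hr Hf.
  assert (Cp : forall n t, continuous (fun t => Cpow (Cinv (circ r t)) n) t).
  { intros n t. apply continuous_Cpow. now apply continuous_circ_inv. }
  induction N as [|N IH].
  - rewrite sum_O. unfold cauchy_coeff. f_equal. apply cint_ext. intros t. now rewrite sum_O.
  - rewrite sum_Sn, IH. unfold cauchy_coeff. change (plus ?u ?v) with (Cplus u v).
    rewrite <- Cmult_plus_distr_l, <- cint_plus.
    + f_equal. apply cint_ext. intros t. rewrite sum_Sn.
      change (plus ?u ?v) with (Cplus u v). ring.
    + intros t. apply continuous_Cmult; [apply Hf|].
      apply (continuous_sum_n_C (fun n t => Cpow (Cinv (circ r t)) n)). intros n. apply Cp.
    + intros t. apply continuous_Cmult; [apply Hf|apply Cp].
Qed.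

(** The sum is geometric with ratio [x = 1 / circ r t], and [1 / (1 - x)] is
    [circ r t / (circ r t - 1)]. As [|x| > 1], the power [x ^ (N+1)] costs [r ^ (-(N+1))], which
    stays bounded once [1 - r] is of order [1 / N]. *)
Lemma dirichlet_bound (r t : R) (N : nat) : 1 / 2 <= r < 1 -> 0 <= t <= 2 * PI ->
  Cmod (sum_n (G := C_NormedModule) (Cpow (Cinv (circ r t))) N) <=
  (1 + / r ^ S N) * (6 / (1 - r + t) + 6 / (1 - r + (2 * PI - t))).
Proof.
  intros Hr Ht. set (x := Cinv (circ r t)).
  assert (N0 := circ_neq_0 r t ltac:(lra)).
  assert (N1 : Cminus (circ r t) (RtoC 1) <> RtoC 0).
  { intros E. assert (L : Cmod (circ r t) = 1).
    { replace (circ r t) with (Cplus (Cminus (circ r t) (RtoC 1)) (RtoC 1)) by ring.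
      rewrite E. replace (Cplus (RtoC 0) (RtoC 1)) with (RtoC 1) by ring. apply Cmod_1. }
    rewrite Cmod_circ in L; lra. }
  assert (E : sum_n (G := C_NormedModule) (Cpow x) N =
     Cmult (Cminus (RtoC 1) (Cpow x (S N))) (Cdiv (circ r t) (Cminus (circ r t) (RtoC 1)))).
  { rewrite <- geom_sum_C. set (s := sum_n (G := C_NormedModule) (Cpow x) N : C).
    change (s = Cmult (Cmult (Cminus (RtoC 1) x) s) (Cdiv (circ r t) (Cminus (circ r t) (RtoC 1)))).
    unfold x. field. split; assumption. }
  rewrite E, Cmod_mult, Cmod_div, Cmod_circ by (assumption || lra).
  assert (B1 : Cmod (Cminus (RtoC 1) (Cpow x (S N))) <= 1 + / r ^ S N).
  { unfold Cminus. eapply Rle_trans; [apply Cmod_triangle|].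
    rewrite Cmod_opp, Cmod_1, Cmod_pow. unfold x. rewrite Cmod_inv, Cmod_circ by (assumption || lra).
    rewrite pow_inv. lra. }
  assert (B2 := circ_distance_inv r t Hr Ht).
  assert (P := Cmod_ge_0 (Cminus (RtoC 1) (Cpow x (S N)))).
  assert (Q : 0 < / Cmod (Cminus (circ r t) (RtoC 1))) by (apply Rinv_0_lt_compat, Cmod_gt_0; exact N1).
  apply Rmult_le_compat; [exact P| |exact B1|].
  - apply Rmult_le_pos; lra.
  - unfold Rdiv at 1. nra.
Qed.

(** Cauchy's formula for the sum of the first coefficients, with the Dirichlet kernel estimated in
    the [L^1] norm. The 9 comes from [1 - r + 2 PI <= 9], the 2 from [12 / (2 PI) <= 2]. *)
Lemma partial_sum_bound_radius (a : nat -> C) (f : C -> C) (M alpha r : R) (N : nat) :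
  taylor a f -> 0 <= M -> growth M alpha f -> 1 / 2 <= r < 1 ->
  Cmod (sum_n (G := C_NormedModule) a N) <=
  M * Rpower (1 - r) (- alpha) * (1 + / r ^ S N) * (2 * ln (9 / (1 - r))).
Proof.
  intros Ta HM Hg Hr. assert (PI0 := two_PI_pos). assert (PI4 := PI_4). assert (PI3 := PI2_3_2).
  assert (Hd : forall t, disk (circ r t)) by (intros t; unfold disk; rewrite Cmod_circ; lra).
  assert (Cf : forall t, continuous (fun t => f (circ r t)) t).
  { intros t. apply (continuous_comp (circ r) f); [apply continuous_circ|].
    eapply cderiv_continuous. apply (taylor_holo _ _ Ta), Hd. }
  rewrite (sum_n_ext a (cauchy_coeff f r)).
  2:{ intros n. apply taylor_cauchy_coeff; [exact Ta|lra]. }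
  rewrite cauchy_coeff_sum by (lra || exact Cf).
  rewrite Cmod_mult, Cmod_R, Rabs_pos_eq.
  2:{ left. now apply Rinv_0_lt_compat. }
  set (A := M * Rpower (1 - r) (- alpha) * (1 + / r ^ S N)).
  assert (I := RInt_circ_distance_inv (1 - r) ltac:(lra)).
  assert (I' := is_RInt_scal _ _ _ A _ I). 
  assert (P1 : 0 <= M * Rpower (1 - r) (- alpha)).
  { apply Rmult_le_pos; [exact HM|]. left. apply exp_pos. }
  assert (P2 : 0 < / r ^ S N) by (apply Rinv_0_lt_compat, pow_lt; lra).
  assert (B : Cmod (cint (fun t => Cmult (f (circ r t)) (sum_n (G := C_NormedModule) (Cpow (Cinv (circ r t))) N)))
     <= A * (12 * ln ((1 - r + 2 * PI) / (1 - r)))).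
  { eapply Rle_trans; [apply (cint_le _ (fun t => A * (6 / (1 - r + t) + 6 / (1 - r + (2 * PI - t)))))|].
    - intros t. apply continuous_Cmult; [apply Cf|].
      apply (continuous_sum_n_C (fun n t => Cpow (Cinv (circ r t)) n)). intros n.
      apply continuous_Cpow. apply continuous_circ_inv. lra.
    - eexists. exact I'.
    - intros t Ht. rewrite Cmod_mult. unfold A. rewrite (Rmult_assoc (M * _)).
      apply Rmult_le_compat; try apply Cmod_ge_0.
      + eapply Rle_trans; [apply Hg, Hd|]. rewrite Cmod_circ by lra. lra.
      + apply dirichlet_bound; lra.
    - right. apply is_RInt_unique. exact I'. }
  assert (L : 0 < ln ((1 - r + 2 * PI) / (1 - r)) <= ln (9 / (1 - r))).
  { assert (Q : 0 < / (1 - r)) by (apply Rinv_0_lt_compat; lra).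
    assert (E : (1 - r + 2 * PI) / (1 - r) = 1 + 2 * PI * / (1 - r)) by (field; lra).
    split.
    - rewrite <- ln_1. apply ln_increasing; [lra|]. rewrite E. nra.
    - apply ln_le.
      + rewrite E. nra.
      + unfold Rdiv. apply Rmult_le_compat_r; lra. }
  assert (PA : 0 <= A) by (unfold A; apply Rmult_le_pos; lra).
  apply (Rmult_le_reg_l (2 * PI)); [exact PI0|].
  rewrite <- Rmult_assoc, Rinv_r, Rmult_1_l by lra.
  eapply Rle_trans; [exact B|].
  replace (2 * PI * (A * (2 * ln (9 / (1 - r))))) with (A * (4 * PI * ln (9 / (1 - r)))) by ring.
  apply Rmult_le_compat_l; [exact PA|].
  nra.
Qed.

(** * Convergence of the Hilbert matrix *)

Lemma Rpower_pos (x y : R) : 0 < Rpower x y.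
Proof. apply exp_pos. Qed.

Lemma Rpower_ge_1 (x y : R) : 1 <= x -> 0 <= y -> 1 <= Rpower x y.
Proof.
  intros Hx Hy. rewrite <- (Rpower_O x) by lra. now apply Rle_Rpower.
Qed.

Lemma ln_le_sub_1 (x : R) : 0 < x -> ln x <= x - 1.
Proof.
  intros Hx. assert (H := exp_ineq1_le (ln x)). rewrite exp_ln in H by exact Hx. lra.
Qed.

(** The left side is [(1 + 1 / (N+1)) ^ (N+1)], at most [e]. *)
Lemma pow_inv_near_1_le_3 (N : nat) : / (1 - / (INR N + 2)) ^ S N <= 3.
Proof.
  assert (P := pos_INR N).
  rewrite <- pow_inv.
  replace (/ (1 - / (INR N + 2))) with (1 + / (INR N + 1)) by (field; lra).
  eapply Rle_trans; [|apply exp_le_3].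
  apply (Rle_trans _ (exp (/ (INR N + 1)) ^ S N)).
  - apply pow_incr. split; [|apply exp_ineq1_le].
    assert (0 < / (INR N + 1)) by (apply Rinv_0_lt_compat; lra). lra.
  - rewrite <- Rpower_pow by apply exp_pos. unfold Rpower.
    right. f_equal. rewrite ln_exp, S_INR. field. lra.
Qed.

(** The radius is [1 - 1 / (N+2)], which is at least 1/2 for every [N]. The bound is then of order
    [N ^ alpha log N]; the exponent midway between [alpha] and 1 leaves room for the logarithm and
    stays below 1, as summation by parts requires. *)
Lemma partial_sum_bound (a : nat -> C) (f : C -> C) (M alpha : R) :
  taylor a f -> 0 <= M -> 0 < alpha < 1 -> growth M alpha f ->
  exists K, 0 <= K /\ forall N, Cmod (sum_n (G := C_NormedModule) a N) <=
    K * Rpower (INR N + 2) ((1 + alpha) / 2).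
Proof.
  intros Ta HM Ha Hg.
  assert (L9 : 0 < ln 9) by (rewrite <- ln_1; apply ln_increasing; lra).
  assert (E0 : 0 < 2 / (1 - alpha)) by (apply Rdiv_lt_0_compat; lra).
  exists (8 * M * (ln 9 + 2 / (1 - alpha))). split.
  { apply Rmult_le_pos; lra. }
  intros N. assert (P := pos_INR N).
  assert (I1 : 0 < / (INR N + 2) <= / 2).
  { split; [apply Rinv_0_lt_compat; lra|apply Rinv_le_contravar; lra]. }
  eapply Rle_trans; [apply (partial_sum_bound_radius a f M alpha (1 - / (INR N + 2)) N Ta HM Hg); lra|].
  replace (1 - (1 - / (INR N + 2))) with (/ (INR N + 2)) by ring.
  assert (B := pow_inv_near_1_le_3 N).
  set (y := INR N + 2) in *.
  replace (9 / / y) with (9 * y) by (field; unfold y; lra).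
  replace (Rpower (/ y) (- alpha)) with (Rpower y alpha).
  2:{ unfold Rpower. f_equal. rewrite ln_Rinv by (unfold y; lra). ring. }
  set (e := (1 - alpha) / 2).
  assert (Eb : Rpower y ((1 + alpha) / 2) = Rpower y alpha * Rpower y e).
  { rewrite <- Rpower_plus. f_equal. unfold e. field. }
  rewrite Eb.
  assert (L : 0 <= ln (9 * y) <= (ln 9 + 2 / (1 - alpha)) * Rpower y e).
  { rewrite ln_mult by (unfold y; lra). 
    assert (Ly : 0 <= ln y) by (rewrite <- ln_1; apply ln_le; unfold y; lra).
    split; [lra|].
    assert (R1 := Rpower_ge_1 y e ltac:(unfold y; lra) ltac:(unfold e; lra)).
    (* [ln u <= u - 1] at [u = y ^ e] bounds [e ln y] by [y ^ e]. *)
    assert (R2 := ln_le_sub_1 (Rpower y e) (Rpower_pos _ _)).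
    rewrite ln_Rpower in R2.
    assert (ln y <= 2 / (1 - alpha) * Rpower y e).
    { replace (ln y) with (2 / (1 - alpha) * (e * ln y)) by (unfold e; field; lra).
      apply Rmult_le_compat_l; lra. }
    nra. }
  assert (Q := Rpower_pos y alpha).
  apply (Rle_trans _ (M * Rpower y alpha * 4 * (2 * ((ln 9 + 2 / (1 - alpha)) * Rpower y e)))).
  2:{ right. ring. }
  assert (0 < / (1 - / y) ^ S N) by (apply Rinv_0_lt_compat, pow_lt; lra).
  assert (0 <= M * Rpower y alpha) by (apply Rmult_le_pos; lra).
  apply Rmult_le_compat; [apply Rmult_le_pos; lra|lra| |lra].
  apply Rmult_le_compat_l; lra.
Qed.

Lemma is_lim_seq_Rpower_neg (b : R) : b < 0 ->
  is_lim_seq (fun n => Rpower (INR n + 1) b) 0.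
Proof.
  intros Hb. unfold Rpower.
  apply (is_lim_comp_seq exp (fun n => b * ln (INR n + 1)) m_infty).
  - apply is_lim_exp_m.
  - exists 0%nat. intros; discriminate.
  - replace m_infty with (Rbar_mult b p_infty).
    + apply is_lim_seq_scal_l.
      apply (is_lim_comp_seq ln (fun n => INR n + 1) p_infty).
      * apply is_lim_ln_p.
      * exists 0%nat. intros; discriminate.
      * apply (is_lim_seq_plus _ _ p_infty 1); [apply is_lim_seq_INR|apply is_lim_seq_const|].
        reflexivity.
    + simpl. destruct (Rle_dec 0 b) as [H|H]; [exfalso; lra|reflexivity].
Qed.

Lemma is_series_telescope (T : nat -> R) : is_lim_seq T 0 ->
  is_series (fun n => T n - T (S n)) (T 0%nat).
Proof.
  intros H. change (is_lim_seq (sum_n (fun n => T n - T (S n))) (T 0%nat)).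
  apply (is_lim_seq_ext (fun n => T 0%nat - T (S n))).
  - intros n. induction n as [|n IH]; [now rewrite sum_O|].
    rewrite sum_Sn, <- IH. unfold plus; simpl. ring.
  - replace (Finite (T 0%nat)) with (Finite (T 0%nat - 0)) by (f_equal; ring).
    apply is_lim_seq_minus'; [apply is_lim_seq_const|].
    now apply is_lim_seq_incr_1 in H.
Qed.

(** Bounds a term of order [x ^ (b-2)] by a difference of values of [x ^ (b-1)], so that the series
    obtained by summation by parts is dominated by a telescoping one. It follows from
    [exp u >= 1 + u] and [ln (x+1) - ln x >= 1 / (x+1)]. *)
Lemma Rpower_telescope (b x : R) : 0 < b < 1 -> 1 <= x ->
  (1 - b) * (Rpower (x + 1) (b - 1) / (x + 1)) <= Rpower x (b - 1) - Rpower (x + 1) (b - 1).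
Proof.
  intros Hb Hx.
  assert (E : Rpower x (b - 1) = Rpower (x + 1) (b - 1) * exp ((1 - b) * (ln (x + 1) - ln x))).
  { unfold Rpower. rewrite <- exp_plus. f_equal. ring. }
  assert (L := ln_le_sub_1 (x / (x + 1)) ltac:(apply Rdiv_lt_0_compat; lra)).
  rewrite ln_div in L by lra.
  replace (x / (x + 1) - 1) with (- / (x + 1)) in L by (field; lra).
  assert (X := exp_ineq1_le ((1 - b) * (ln (x + 1) - ln x))).
  assert (P := Rpower_pos (x + 1) (b - 1)).
  assert (I : 0 < / (x + 1)) by (apply Rinv_0_lt_compat; lra).
  rewrite E.
  apply (Rle_trans _ (Rpower (x + 1) (b - 1) * ((1 - b) * / (x + 1)))).
  { right. unfold Rdiv. ring. }
  replace (Rpower (x + 1) (b - 1) * exp ((1 - b) * (ln (x + 1) - ln x)) - Rpower (x + 1) (b - 1))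
    with (Rpower (x + 1) (b - 1) * (exp ((1 - b) * (ln (x + 1) - ln x)) - 1)) by ring.
  apply Rmult_le_compat_l; [lra|]. nra.
Qed.

(** Summation by parts against the weights [1 / (n + k + 1)]. *)
Lemma series_div_conv (a : nat -> C) (K b : R) (n : nat) :
  0 <= K -> 0 < b < 1 ->
  (forall N, Cmod (sum_n (G := C_NormedModule) a N) <= K * Rpower (INR N + 2) b) ->
  exists l, is_series (V := C_NormedModule) (fun k => Cdiv (a k) (RtoC (INR (n + k + 1)))) l.
Proof.
  intros HK Hb Hs.
  set (s := fun N => sum_n (G := C_NormedModule) a N : C).
  set (c := fun k => / INR (n + k + 1)).
  set (T := fun k => Rpower (INR k + 1) (b - 1)).
  assert (HT : is_lim_seq T 0) by (apply is_lim_seq_Rpower_neg; lra).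
  assert (Pc : forall k, 0 < INR (n + k + 1) /\ INR k + 1 <= INR (n + k + 1)).
  { intros k. rewrite !plus_INR. simpl. assert (P := pos_INR n). assert (P' := pos_INR k). lra. }
  assert (Hc : forall k, 0 < c k <= / (INR k + 1)).
  { intros k. destruct (Pc k). assert (P' := pos_INR k). unfold c.
    split; [now apply Rinv_0_lt_compat|apply Rinv_le_contravar; lra]. }
  (* Consecutive denominators differ by 1. *)
  assert (Dc : forall k, c k - c (S k) = c k * c (S k)).
  { intros k. unfold c. destruct (Pc k), (Pc (S k)).
    replace (INR (n + S k + 1)) with (INR (n + k + 1) + 1) in *.
    2:{ rewrite <- S_INR. f_equal. lia. }
    field. lra. }
  assert (Rs : forall k, Rpower (INR k + 2) b = T (S k) * (INR k + 2)).
  { intros k. assert (P' := pos_INR k). unfold T. rewrite S_INR.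
    replace (INR k + 1 + 1) with (INR k + 2) by ring.
    rewrite <- (Rpower_1 (INR k + 2)) at 3 by lra. rewrite <- Rpower_plus. f_equal. ring. }
  set (d := fun k => Cmult (s k) (RtoC (c k - c (S k)))).
  assert (Ed : ex_series (fun k => Cmod (d k))).
  (* The factor [1 / (1 - b)] comes from [Rpower_telescope], the factor 2 from
     [1 / (k+1) <= 2 / (k+2)]. *)
  { apply (ex_series_le (V := R_CompleteNormedModule) _
       (fun k => 2 * K / (1 - b) * (T k - T (S k)))).
    2:{ apply (ex_series_scal (V := R_NormedModule)). eexists. now apply is_series_telescope. }
    intros k. change (Rabs (Cmod (d k)) <= 2 * K / (1 - b) * (T k - T (S k))).
    rewrite Rabs_pos_eq by apply Cmod_ge_0. unfold d. rewrite Cmod_mult, Cmod_R, Dc.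
    destruct (Hc k) as [c0 c1]. destruct (Hc (S k)) as [c2 c3]. rewrite S_INR in c3.
    assert (P' := pos_INR k).
    rewrite Rabs_pos_eq by (apply Rmult_le_pos; lra).
    assert (Tl := Rpower_telescope b (INR k + 1) Hb ltac:(lra)).
    assert (TS : T (S k) = Rpower (INR k + 1 + 1) (b - 1)) by (unfold T; now rewrite S_INR).
    rewrite <- TS in Tl. fold (T k) in Tl.
    specialize (Hs k). rewrite Rs in Hs. fold (s k) in Hs.
    assert (PT : 0 < T (S k)) by apply Rpower_pos.
    apply (Rle_trans _ (K * (T (S k) * (INR k + 2)) * (/ (INR k + 1) * / (INR k + 1 + 1)))).
    { apply Rmult_le_compat; [apply Cmod_ge_0| |exact Hs|].
      - apply Rmult_le_pos; lra.
      - apply Rmult_le_compat; lra. }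
    apply (Rle_trans _ (2 * K / (1 - b) * ((1 - b) * (T (S k) / (INR k + 1 + 1))))).
    2:{ apply Rmult_le_compat_l; [|exact Tl].
        apply Rmult_le_pos; [lra|]. left. apply Rinv_0_lt_compat. lra. }
    replace (K * (T (S k) * (INR k + 2)) * (/ (INR k + 1) * / (INR k + 1 + 1))) with
       (K * T (S k) * / (INR k + 1)) by (field; lra).
    replace (2 * K / (1 - b) * ((1 - b) * (T (S k) / (INR k + 1 + 1)))) with
       (K * T (S k) * (2 / (INR k + 2))) by (field; lra).
    apply Rmult_le_compat_l; [apply Rmult_le_pos; lra|].
    apply (Rmult_le_reg_r ((INR k + 1) * (INR k + 2))); [apply Rmult_lt_0_compat; lra|].
    field_simplify; lra. }
  apply Cseries_correct in Ed.
  exists (Cseries d).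
  assert (S1 : forall N, sum_n (G := C_NormedModule) (fun k => Cdiv (a k) (RtoC (INR (n + k + 1)))) N
     = Cplus (Cmult (s N) (RtoC (c (S N)))) (sum_n (G := C_NormedModule) d N)).
  { assert (A : forall k, Cdiv (a k) (RtoC (INR (n + k + 1))) = Cmult (a k) (RtoC (c k))).
    { intros k. unfold Cdiv, c. rewrite RtoC_inv; [reflexivity|]. destruct (Pc k). lra. }
    induction N as [|N IH].
    - rewrite !sum_O, A. unfold d, s. rewrite sum_O, RtoC_minus. eqC. ring.
    - rewrite !sum_Sn, IH, A. change (plus ?u ?v) with (Cplus u v).
      change (d (S N)) with (Cmult (s (S N)) (RtoC (c (S N) - c (S (S N))))).
      assert (ES : s (S N) = Cplus (s N) (a (S N))) by (unfold s; now rewrite sum_Sn).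
      rewrite ES, RtoC_minus. set (X := sum_n d N : C). fold X. eqC. ring. }
  unfold is_series.
  apply (filterlim_ext (fun N => plus (Cmult (s N) (RtoC (c (S N)))) (sum_n (G := C_NormedModule) d N))).
  { intros N. symmetry. apply S1. }
  rewrite <- (plus_zero_l (G := C_NormedModule) (Cseries d)).
  apply (filterlim_comp_2 (H := locally (Cseries d)) (G := locally (zero : C_NormedModule))); 
    [|exact Ed|apply (filterlim_plus (V := C_NormedModule))].
  (* The boundary term [s_N c_(N+1)] of the summation by parts is at most [K (N+2) ^ (b-1)]. *)
  apply (filterlim_C_squeeze _ _ (fun N => K * T (S N))).
  - intros N. replace (Cminus _ _) with (Cmult (s N) (RtoC (c (S N)))).
    2:{ change (@zero C_NormedModule) with (RtoC 0). ring. }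
    destruct (Hc (S N)) as [c2 c3]. rewrite S_INR in c3. assert (P' := pos_INR N).
    rewrite Cmod_mult, Cmod_R, Rabs_pos_eq by lra.
    specialize (Hs N). rewrite Rs in Hs.
    assert (PT : 0 < T (S N)) by apply Rpower_pos.
    apply (Rle_trans _ (K * (T (S N) * (INR N + 2)) * / (INR N + 1 + 1))).
    + apply Rmult_le_compat; [apply Cmod_ge_0|lra|exact Hs|exact c3].
    + right. field. lra.
  - replace (Finite 0) with (Rbar_mult K 0) by (simpl; f_equal; ring).
    apply is_lim_seq_scal_l. now apply is_lim_seq_incr_1 in HT.
Qed.

(** * Abel limits and moments *)

(** If the radius of convergence exceeds 1 this is continuity at an interior point; if it equals 1
    it is Abel's theorem. *)
Lemma abel_R (c : nat -> R) (l : R) : is_series c l ->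
  filterlim (PSeries c) (at_left 1) (locally l).
Proof.
  intros H.
  assert (E1 : forall k, c k = scal (pow_n (K := R_AbsRing) 1 k) (c k)).
  { intros k. rewrite pow_n_pow, pow1. unfold scal; simpl; unfold mult; simpl. ring. }
  assert (X : is_pseries c 1 l) by (revert H; apply is_series_ext; exact E1).
  assert (E : PSeries c 1 = l) by now apply is_pseries_unique.
  assert (R1 : Rbar_le 1 (CV_radius c)).
  { destruct (CV_radius_bounded c) as [U _]. apply U.
    destruct (ex_series_bounded c (ex_intro _ _ H)) as [M HM]. exists M. intros n.
    rewrite pow1, Rmult_1_r. apply HM. }
  destruct (Rbar_le_lt_or_eq_dec _ _ R1) as [L|Q].
  - apply (filterlim_filter_le_1 (F := locally 1) (G := at_left 1)).
    { apply filter_le_within. }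
    rewrite <- E. apply continuity_pt_filterlim, PSeries_continuity.
    now rewrite Rabs_R1.
  - assert (A := Abel c). rewrite <- Q in A. rewrite <- E. apply A; simpl; [lra|exact I|].
    now exists l.
Qed.

Lemma filterlim_C {T : Type} {F : (T -> Prop) -> Prop} {FF : Filter F} (h : T -> C) (l : C) :
  filterlim (fun t => Re (h t)) F (locally (Re l)) ->
  filterlim (fun t => Im (h t)) F (locally (Im l)) -> filterlim h F (locally l).
Proof.
  intros H1 H2 P [eps HP].
  assert (E1 := proj1 (filterlim_locally _ _) H1 eps).
  assert (E2 := proj1 (filterlim_locally _ _) H2 eps).
  unfold filtermap. generalize (filter_and _ _ E1 E2). apply filter_imp.
  intros y [A B]. apply HP. split; assumption.
Qed.

Lemma abel_C (q : nat -> C) (l : C) : is_series (V := C_NormedModule) q l ->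
  filterlim (fun r => Cpseries q (RtoC r)) (at_left 1) (locally l).
Proof.
  intros H. apply is_series_C in H. destruct H as [A B].
  apply filterlim_C.
  - apply (filterlim_ext (PSeries (fun n => Re (q n)))); [|now apply abel_R].
    intros r. unfold Cpseries, Cseries, PSeries. simpl. apply Series_ext. intros n.
    rewrite <- RtoC_pow. unfold Re; simpl. ring.
  - apply (filterlim_ext (PSeries (fun n => Im (q n)))); [|now apply abel_R].
    intros r. unfold Cpseries, Cseries, PSeries. simpl. apply Series_ext. intros n.
    rewrite <- RtoC_pow. unfold Im; simpl. ring.
Qed.

Lemma filterlim_Cmult {T : Type} {F : (T -> Prop) -> Prop} {FF : Filter F}
  (h k : T -> C) (l m : C) :
  filterlim h F (locally l) -> filterlim k F (locally m) ->
  filterlim (fun t => Cmult (h t) (k t)) F (locally (Cmult l m)).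
Proof.
  intros H K.
  apply (filterlim_comp_2 (G := locally l) (H := locally m) h k Cmult H K).
  intros P HP.
  assert (X : continuous (fun p : C * C => Cmult (fst p) (snd p)) (l, m)).
  { apply continuous_Cmult; [apply continuous_fst|apply continuous_snd]. }
  destruct (X P HP) as [d Hd].
  exists (ball l d) (ball m d); try apply locally_ball.
  intros x y Hx Hy. apply (Hd (x, y)). split; assumption.
Qed.

Lemma abs_conv_le (a b : nat -> C) (rad : R) :
  (forall n, Cmod (b n) <= Cmod (a n)) -> abs_conv a rad -> abs_conv b rad.
Proof.
  intros H A r Hr.
  apply (ex_series_le (V := R_CompleteNormedModule) _ (fun n => Cmod (a n) * r ^ n)); [|now apply A].
  intros n. assert (P : 0 <= r ^ n) by (apply pow_le; lra).
  change (Rabs (Cmod (b n) * r ^ n) <= Cmod (a n) * r ^ n).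
  rewrite Rabs_pos_eq by (apply Rmult_le_pos; [apply Cmod_ge_0|exact P]).
  now apply Rmult_le_compat_r.
Qed.

Definition moment_seq (a : nat -> C) (n k : nat) : C := Cdiv (a k) (RtoC (INR (n + k + 1))).

(** [moment a n t] is the integral of [s ^ n * f s] for [s] from [0] to [t]. *)
Definition moment (a : nat -> C) (n : nat) (t : R) : C :=
  Cmult (RtoC (t ^ S n)) (Cpseries (moment_seq a n) (RtoC t)).

Lemma abs_conv_moment (a : nat -> C) (n : nat) (rad : R) :
  abs_conv a rad -> abs_conv (moment_seq a n) rad.
Proof.
  apply abs_conv_le. intros k. unfold moment_seq.
  assert (P := pos_INR (n + k)).
  rewrite Cmod_div, Cmod_R by (apply RtoC_INR_neq_0; lia).
  rewrite Rabs_pos_eq by apply pos_INR.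
  rewrite <- (Rmult_1_r (Cmod (a k))) at 2. apply Rmult_le_compat_l; [apply Cmod_ge_0|].
  rewrite <- Rinv_1. apply Rinv_le_contravar; [lra|]. rewrite plus_INR. simpl. lra.
Qed.

Lemma curve_deriv_pow (n : nat) (t : R) :
  curve_deriv (fun s => RtoC (s ^ S n)) t (RtoC (INR (S n) * t ^ n)).
Proof.
  split.
  - change (is_derive (fun s => s ^ S n) t (INR (S n) * t ^ n)).
    auto_derive; [exact I|]. change (1 * (INR (S n) * t ^ n) = INR (S n) * t ^ n). ring.
  - change (is_derive (fun _ : R => 0) t 0). apply (is_derive_const (V := R_NormedModule)).
Qed.

Lemma curve_deriv_moment (a : nat -> C) (f : C -> C) (n : nat) (t : R) :
  taylor a f -> Rabs t < 1 ->
  curve_deriv (moment a n) t (Cmult (RtoC (t ^ n)) (f (RtoC t))).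
Proof.
  intros Ta Ht. assert (A := taylor_abs_conv _ _ Ta).
  assert (Am := abs_conv_moment a n 1 A).
  assert (Hd : Cmod (RtoC t) < 1) by now rewrite Cmod_R.
  set (q := moment_seq a n) in *.
  assert (D1 : curve_deriv (fun s => RtoC (s ^ S n)) t (RtoC (INR (S n) * t ^ n))).
  { apply curve_deriv_pow. }
  assert (D2 := curve_deriv_comp _ RtoC t _ _ (cderiv_Cpseries q 1 (RtoC t) Am Hd) (curve_deriv_RtoC t)).
  assert (D := curve_deriv_mult _ _ _ _ _ D1 D2).
  replace (Cmult (RtoC (t ^ n)) (f (RtoC t))) with
    (Cplus (Cmult (RtoC (INR (S n) * t ^ n)) (Cpseries q (RtoC t)))
           (Cmult (RtoC (t ^ S n)) (Cmult (Cpseries (deriv_seq q) (RtoC t)) (RtoC 1)))); [exact D|].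
  (* Termwise, [(n+1) + k] cancels the denominator [n + k + 1] of [q], so [f = (n+1) q + t q']. *)
  assert (E : f (RtoC t) = Cplus (Cmult (RtoC (INR (S n))) (Cpseries q (RtoC t)))
                                 (Cmult (RtoC t) (Cpseries (deriv_seq q) (RtoC t)))).
  { apply (is_series_C_unique _ _ _ (proj1 (is_pseries_Cpow _ _ _) (Ta _ Hd))).
    assert (S1 := is_series_Cmult (RtoC (INR (S n))) _ _
                    (proj1 (is_pseries_Cpow _ _ _) (Cpseries_correct q 1 _ Am Hd))).
    assert (S2 := is_series_Cmult (RtoC t) _ _ (is_series_deriv q 1 _ Am Hd)).
    assert (S3 := is_series_plus _ _ _ _ S1 S2).
    revert S3. apply is_series_ext. intros k. change (plus ?u ?v) with (Cplus u v). unfold q, moment_seq.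
    assert (N := RtoC_INR_neq_0 (n + k + 1) ltac:(lia)).
    assert (T : Cmult (RtoC t) (Cmult (RtoC (INR k)) (Cpow (RtoC t) (pred k))) =
                Cmult (RtoC (INR k)) (Cpow (RtoC t) k)).
    { destruct k; [simpl; ring|]. simpl pred. rewrite Cpow_S. ring. }
    set (X := Cdiv (a k) (RtoC (INR (n + k + 1)))).
    replace (Cmult (RtoC t) (Cmult (Cmult (RtoC (INR k)) (Cpow (RtoC t) (pred k))) X))
      with (Cmult (Cmult (RtoC (INR k)) (Cpow (RtoC t) k)) X) by (rewrite <- T; ring).
    unfold X.
    replace (RtoC (INR (S n))) with (Cminus (RtoC (INR (n + k + 1))) (RtoC (INR k))).
    2:{ rewrite <- RtoC_minus. f_equal. rewrite !plus_INR, (S_INR n). change (INR 1) with 1. ring. }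
    eqC. field. exact N. }
  rewrite E. simpl (t ^ S n). rewrite !RtoC_mult. ring.
Qed.

Lemma moment_0 (a : nat -> C) (n : nat) : moment a n 0 = RtoC 0.
Proof. unfold moment. simpl. rewrite Rmult_0_l. ring. Qed.

Lemma is_derive_Rpower_maj (alpha t : R) : alpha < 1 -> t < 1 ->
  is_derive (fun s => - (Rpower (1 - s) (1 - alpha) / (1 - alpha))) t (Rpower (1 - t) (- alpha)).
Proof.
  intros Ha Ht. unfold Rpower. auto_derive; [lra|].
  replace ((1 - alpha) * ln (1 + - t)) with (- alpha * ln (1 - t) + ln (1 - t))
    by (unfold Rminus; ring).
  rewrite exp_plus, exp_ln by lra. field. lra.
Qed.

(** The right side is the integral of the majorant over the whole of [[0, 1)], finite because
    [alpha < 1]; this is why the bound does not depend on [r]. *)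
Lemma radial_bound (h dh : R -> C) (M alpha r : R) :
  0 <= M -> 0 < alpha < 1 -> 0 <= r < 1 -> 
  (forall t, 0 <= t < 1 -> curve_deriv h t (dh t)) ->
  (forall t, 0 <= t < 1 -> Cmod (dh t) <= M * Rpower (1 - t) (- alpha)) ->
  Cmod (Cminus (h r) (h 0)) <= M / (1 - alpha).
Proof.
  intros HM Ha Hr Hd Hb.
  assert (B := curve_mean_value h dh (fun s => M * - (Rpower (1 - s) (1 - alpha) / (1 - alpha)))
     (fun t => M * Rpower (1 - t) (- alpha)) 0 r ltac:(lra)).
  eapply Rle_trans; [apply B|].
  - intros t Ht. apply Hd. lra.
  - intros t Ht. apply is_derive_scal. apply is_derive_Rpower_maj; lra.
  - intros t Ht. apply Hb. lra.
  - replace (1 - 0) with 1 by ring.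
    assert (E : Rpower 1 (1 - alpha) = 1) by (unfold Rpower; now rewrite ln_1, Rmult_0_r, exp_0).
    rewrite E. assert (P := Rpower_pos (1 - r) (1 - alpha)).
    assert (Q : 0 < / (1 - alpha)) by (apply Rinv_0_lt_compat; lra).
    assert (0 <= M * (Rpower (1 - r) (1 - alpha) / (1 - alpha))).
    { apply Rmult_le_pos; [exact HM|]. apply Rmult_le_pos; lra. }
    unfold Rdiv in *. lra.
Qed.

Lemma growth_radial (M alpha t : R) (f : C -> C) : growth M alpha f -> 0 <= t < 1 ->
  Cmod (f (RtoC t)) <= M * Rpower (1 - t) (- alpha).
Proof.
  intros Hg Ht. assert (E : Cmod (RtoC t) = t) by (rewrite Cmod_R, Rabs_pos_eq; lra).
  assert (H := Hg (RtoC t)). rewrite E in H. apply H. unfold disk. rewrite E. lra.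
Qed.

Lemma moment_bound (a : nat -> C) (f : C -> C) (M alpha r : R) (n : nat) :
  taylor a f -> 0 <= M -> 0 < alpha < 1 -> growth M alpha f -> 0 <= r < 1 ->
  Cmod (moment a n r) <= M / (1 - alpha).
Proof.
  intros Ta HM Ha Hg Hr.
  replace (moment a n r) with (Cminus (moment a n r) (moment a n 0)) by (rewrite moment_0; ring).
  apply (radial_bound _ (fun t => Cmult (RtoC (t ^ n)) (f (RtoC t))) M alpha r HM Ha Hr).
  - intros t Ht. apply curve_deriv_moment; [exact Ta|]. rewrite Rabs_pos_eq; lra.
  - intros t Ht. assert (G := growth_radial M alpha t f Hg Ht).
    rewrite Cmod_mult, Cmod_R.
    assert (P : 0 <= t ^ n) by (apply pow_le; lra). rewrite Rabs_pos_eq by exact P.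
    assert (P1 : t ^ n <= 1) by (rewrite <- (pow1 n); apply pow_incr; lra).
    assert (P2 := Cmod_ge_0 (f (RtoC t))). nra.
Qed.

Lemma moment_lim (a : nat -> C) (n : nat) (l : C) :
  is_series (V := C_NormedModule) (moment_seq a n) l ->
  filterlim (moment a n) (at_left 1) (locally l).
Proof.
  intros H. replace l with (Cmult (RtoC (1 ^ S n)) l) by (rewrite pow1; ring).
  apply filterlim_Cmult; [|now apply abel_C].
  apply (filterlim_filter_le_1 (F := locally 1) (G := at_left 1)); [apply filter_le_within|].
  apply (curve_deriv_continuous (fun t : R => RtoC (t ^ S n)) 1 (RtoC (INR (S n) * 1 ^ n))).
  apply curve_deriv_pow.
Qed.

Lemma at_left_interval (u v : R) : u < v -> at_left v (fun t => u < t < v).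
Proof.
  intros Huv. assert (Hd : 0 < v - u) by lra. exists (mkposreal _ Hd). intros t Ht Hv.
  apply Rabs_def2 in Ht. unfold minus, plus, opp in Ht; simpl in Ht. lra.
Qed.

Lemma at_right_interval (u v : R) : u < v -> at_right u (fun t => u < t < v).
Proof.
  intros Huv. assert (Hd : 0 < v - u) by lra. exists (mkposreal _ Hd). intros t Ht Hv.
  apply Rabs_def2 in Ht. unfold minus, plus, opp in Ht; simpl in Ht. lra.
Qed.

Lemma at_left_near (x y : R) (P : R -> Prop) : y < x -> at_left x P ->
  exists t, y < t < x /\ P t.
Proof.
  intros Hy H.
  destruct (filter_ex _ (filter_and _ _ H (at_left_interval _ _ Hy))) as [t [A B]]. now exists t.
Qed.

Lemma filterlim_Cmod_near {T : Type} {F : (T -> Prop) -> Prop} (h : T -> C) (l : C) (eps : R) :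
  0 < eps -> filterlim h F (locally l) -> F (fun t => Cmod (Cminus (h t) l) < eps).
Proof.
  intros He H. apply (H (fun w => Cmod (Cminus w l) < eps)).
  apply locally_Cmod. now exists eps.
Qed.

(** The point is uniformity in [n]: bounded coefficients make the power series of [H f] converge in
    the disk. *)
Lemma moment_series_bound (a : nat -> C) (f : C -> C) (M alpha : R) (n : nat) (l : C) :
  taylor a f -> 0 <= M -> 0 < alpha < 1 -> growth M alpha f ->
  is_series (V := C_NormedModule) (moment_seq a n) l -> Cmod l <= M / (1 - alpha).
Proof.
  intros Ta HM Ha Hg H. apply le_epsilon. intros eps He.
  destruct (at_left_near 1 0 _ Rlt_0_1 (filterlim_Cmod_near _ _ eps He (moment_lim a n l H)))
    as [r [Hr B]].
  assert (K := moment_bound a f M alpha r n Ta HM Ha Hg ltac:(lra)).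
  replace l with (Cplus (moment a n r) (Copp (Cminus (moment a n r) l))) by ring.
  eapply Rle_trans; [apply Cmod_triangle|]. rewrite Cmod_opp. lra.
Qed.

Lemma bounded_abs_conv (b : nat -> C) (K : R) : (forall n, Cmod (b n) <= K) -> abs_conv b 1.
Proof.
  intros H. apply radius_abs_conv, abs_conv_bounded. intros r Hr. exists K. intros n.
  assert (P : 0 <= r ^ n) by (apply pow_le; lra).
  assert (P1 : r ^ n <= 1) by (rewrite <- (pow1 n); apply pow_incr; lra).
  specialize (H n). assert (Q := Cmod_ge_0 (b n)). nra.
Qed.

Theorem hilbert_defined (f : C -> C) (M alpha : R) :
  analytic f -> 0 <= M -> 0 < alpha < 1 -> growth M alpha f -> exists g, hilbert f g.
Proof.
  intros Af HM Ha Hg. destruct (analytic_taylor f Af) as [a Ta].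
  destruct (partial_sum_bound a f M alpha Ta HM Ha Hg) as [K [HK Hs]].
  assert (E : forall n, exists l, is_series (V := C_NormedModule) (moment_seq a n) l).
  { intros n. apply (series_div_conv a K ((1 + alpha) / 2) n HK); [lra|exact Hs]. }
  set (b := fun n => Cseries (moment_seq a n)).
  assert (Hb : forall n, is_series (V := C_NormedModule) (moment_seq a n) (b n)).
  { intros n. destruct (E n) as [l Hl]. apply is_series_C in Hl. destruct Hl as [A B].
    apply is_series_C. split; apply Series_correct; eexists; eassumption. }
  assert (Ab : abs_conv b 1).
  { apply (bounded_abs_conv b (M / (1 - alpha))). intros n.
    now apply (moment_series_bound a f M alpha n). }
  assert (Tb : taylor b (Cpseries b)).
  { intros z Hz. now apply (Cpseries_correct b 1). }
  exists (Cpseries b), a, b. split; [exact Ta|split; [exact Hb|split; [exact Tb|]]].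
  now apply (taylor_analytic b).
Qed.

(** * The change of path *)

Lemma one_minus_lower (w z : C) : Cmod w <= 1 -> Cmod z < 1 ->
  1 - Cmod z <= Cmod (Cminus (RtoC 1) (Cmult w z)).
Proof.
  intros Hw Hz.
  assert (T : Cmod (RtoC 1) <= Cmod (Cminus (RtoC 1) (Cmult w z)) + Cmod (Cmult w z)).
  { replace (RtoC 1) with (Cplus (Cminus (RtoC 1) (Cmult w z)) (Cmult w z)) at 1 by ring.
    apply Cmod_triangle. }
  rewrite Cmod_1, Cmod_mult in T. assert (Cmod w * Cmod z <= 1 * Cmod z).
  { apply Rmult_le_compat_r; [apply Cmod_ge_0|exact Hw]. }
  lra.
Qed.

Lemma one_minus_neq_0 (w z : C) : Cmod w <= 1 -> Cmod z < 1 ->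
  Cminus (RtoC 1) (Cmult w z) <> RtoC 0.
Proof.
  intros Hw Hz. apply Cmod_gt_0. assert (H := one_minus_lower w z Hw Hz). lra.
Qed.

(** Path independence is built into a primitive on the whole disk: its value at [w] is the integral
    of the kernel along any curve from 0 to [w]. *)
Definition is_kernel_primitive (f : C -> C) (z : C) (P : C -> C) : Prop :=
  P (RtoC 0) = RtoC 0 /\
  forall w, disk w -> cderiv P w (Cmult (f w) (Cinv (Cminus (RtoC 1) (Cmult w z)))).

Lemma kernel_primitive_exists (a : nat -> C) (f : C -> C) (z : C) :
  taylor a f -> disk z -> exists P, is_kernel_primitive f z P.
Proof.
  intros Ta Hz.
  set (q := fun w => Cinv (Cminus (RtoC 1) (Cmult w z))).
  assert (Cq : forall w, disk w -> continuous q w).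
  { intros w Hw. apply continuous_Cinv.
    - apply continuous_Cminus; [apply continuous_const|].
      apply continuous_Cmult; [apply continuous_id|apply continuous_const].
    - apply one_minus_neq_0; [unfold disk in Hw; lra|exact Hz]. }
  destruct (holo_pseries (fun w => Cmult (f w) (q w))
    (fun w => Cplus (Cmult (Cpseries (deriv_seq a) w) (q w)) 
                    (Cmult (f w) (Cmult z (Cmult (q w) (q w))))) 1 Rlt_0_1) as [c Hc].
  { intros w Hw. destruct (taylor_holo _ _ Ta w Hw) as [D Cd]. split.
    - apply cderiv_mult; [exact D|]. apply cderiv_inv_affine.
      apply one_minus_neq_0; [lra|exact Hz].
    - assert (Cf := cderiv_continuous _ _ _ D). specialize (Cq w Hw).
      apply continuous_Cplus; [now apply continuous_Cmult|].
      apply continuous_Cmult; [exact Cf|]. apply continuous_Cmult; [apply continuous_const|].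
      now apply continuous_Cmult. }
  exists (Cpseries (prim_seq c)). split; [apply Cpseries_zero|].
  intros w Hw. assert (A : abs_conv c 1) by now apply (pseries_abs_conv c 1 _ Hc).
  assert (E := is_pseries_Cpseries _ _ _ (Hc w Hw)). cbv beta in E. fold (q w). rewrite <- E.
  now apply (cderiv_prim c 1).
Qed.

Lemma curve_deriv_sum_n (h dh : nat -> R -> C) (t : R) (N : nat) :
  (forall n, curve_deriv (h n) t (dh n t)) ->
  curve_deriv (fun s => sum_n (G := C_NormedModule) (fun n => h n s) N) t
              (sum_n (G := C_NormedModule) (fun n => dh n t) N).
Proof.
  intros H. induction N as [|N IH].
  - rewrite sum_O. apply (curve_deriv_ext (h 0%nat)); [intros; now rewrite sum_O|apply H].
  - rewrite sum_Sn.
    apply (curve_deriv_ext (fun s => Cplus (sum_n (G := C_NormedModule) (fun n => h n s) N) (h (S N) s))).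
    + intros. now rewrite sum_Sn.
    + now apply curve_deriv_plus.
Qed.

Lemma curve_deriv_minus (h k : R -> C) (t : R) (l m : C) :
  curve_deriv h t l -> curve_deriv k t m ->
  curve_deriv (fun s => Cminus (h s) (k s)) t (Cminus l m).
Proof.
  intros H K.
  replace (Cminus l m) with (Cplus l (Cplus (Cmult (RtoC 0) (k t)) (Cmult (Copp (RtoC 1)) m))) by ring.
  apply (curve_deriv_ext (fun s => Cplus (h s) (Cmult (Copp (RtoC 1)) (k s)))); [intros; ring|].
  apply curve_deriv_plus; [exact H|].
  apply (curve_deriv_mult (fun _ => Copp (RtoC 1))); [apply curve_deriv_const|exact K].
Qed.

Lemma filterlim_sum_n_C {T : Type} {F : (T -> Prop) -> Prop} {FF : Filter F}
  (h : nat -> T -> C) (l : nat -> C) (N : nat) :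
  (forall n, filterlim (h n) F (locally (l n))) ->
  filterlim (fun s => sum_n (G := C_NormedModule) (fun n => h n s) N) F
    (locally (sum_n (G := C_NormedModule) l N)).
Proof.
  intros H. induction N as [|N IH].
  - rewrite sum_O. apply (filterlim_ext (h 0%nat)); [intros; now rewrite sum_O|apply H].
  - rewrite sum_Sn.
    apply (filterlim_ext (fun s => plus (sum_n (G := C_NormedModule) (fun n => h n s) N) (h (S N) s))).
    + intros. now rewrite sum_Sn.
    + apply (filterlim_comp_2 (G := locally (sum_n (G := C_NormedModule) l N)) (H := locally (l (S N))));
      [exact IH|apply H|apply (filterlim_plus (V := C_NormedModule))].
Qed.

Lemma sum_n_Cmult_l (c : C) (u : nat -> C) (N : nat) :
  sum_n (G := C_NormedModule) (fun n => Cmult c (u n)) N =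
  Cmult c (sum_n (G := C_NormedModule) u N).
Proof. exact (sum_n_mult_l (K := C_Ring) c u N). Qed.

Lemma geom_tail (x : C) (N : nat) : Cminus (RtoC 1) x <> RtoC 0 ->
  Cminus (Cinv (Cminus (RtoC 1) x)) (sum_n (G := C_NormedModule) (Cpow x) N) =
  Cmult (Cpow x (S N)) (Cinv (Cminus (RtoC 1) x)).
Proof.
  intros Hx. assert (G := geom_sum_C x N).
  set (s := sum_n (G := C_NormedModule) (Cpow x) N : C) in *.
  change (Cmult (Cminus (RtoC 1) x) s = Cminus (RtoC 1) (Cpow x (S N))) in G.
  replace (Cpow x (S N)) with (Cminus (RtoC 1) (Cmult (Cminus (RtoC 1) x) s)).
  2:{ rewrite G. ring. }
  field. exact Hx.
Qed.

(** Truncating the geometric series of [1 / (1 - t z)] leaves the tail [(t z) ^ (N+1) / (1 - t z)].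
    The bound is independent of [r], which permits exchanging the limits in [N] and in [r]. *)
Lemma kernel_primitive_partial (a : nat -> C) (f P : C -> C) (M alpha r : R) (z : C) (N : nat) :
  taylor a f -> 0 <= M -> 0 < alpha < 1 -> growth M alpha f -> disk z ->
  is_kernel_primitive f z P -> 0 <= r < 1 ->
  Cmod (Cminus (P (RtoC r)) (sum_n (G := C_NormedModule) (fun n => Cmult (Cpow z n) (moment a n r)) N))
  <= M / (1 - Cmod z) / (1 - alpha) * Cmod z ^ S N.
Proof.
  intros Ta HM Ha Hg Hz [P0 HP] Hr. unfold disk in Hz.
  set (h := fun t => Cminus (P (RtoC t))
     (sum_n (G := C_NormedModule) (fun n => Cmult (Cpow z n) (moment a n t)) N)).
  assert (Hd : forall t, 0 <= t < 1 -> Cmod (RtoC t) < 1).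
  { intros t Ht. rewrite Cmod_R, Rabs_pos_eq; lra. }
  set (dh := fun t => Cmult (f (RtoC t)) (Cmult (Cpow (Cmult (RtoC t) z) (S N))
               (Cinv (Cminus (RtoC 1) (Cmult (RtoC t) z))))).
  assert (H0 : h 0 = RtoC 0).
  { unfold h. rewrite P0. rewrite (sum_n_ext _ (fun n => Cmult (RtoC 0) (Cpow z n))).
    - rewrite sum_n_Cmult_l. ring.
    - intros n. rewrite moment_0. eqC. ring. }
  assert (Q0 := Cmod_ge_0 z).
  assert (PN : 0 <= Cmod z ^ S N) by now apply pow_le.
  assert (I : 0 < / (1 - Cmod z)) by (apply Rinv_0_lt_compat; lra).
  replace (Cminus (P (RtoC r)) _) with (Cminus (h r) (h 0)).
  2:{ rewrite H0. unfold h. ring. }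
  replace (M / (1 - Cmod z) / (1 - alpha) * Cmod z ^ S N) with
     ((M * (Cmod z ^ S N / (1 - Cmod z))) / (1 - alpha)) by (field; lra).
  apply (radial_bound h dh _ alpha r); try lra.
  - apply Rmult_le_pos; [exact HM|]. apply Rmult_le_pos; lra.
  - intros t Ht. specialize (Hd t Ht).
    replace (dh t) with (Cminus (Cmult (Cmult (f (RtoC t)) (Cinv (Cminus (RtoC 1) (Cmult (RtoC t) z)))) (RtoC 1))
      (sum_n (G := C_NormedModule) (fun n => Cmult (Cpow z n) (Cmult (RtoC (t ^ n)) (f (RtoC t)))) N)).
    + apply curve_deriv_minus.
      * apply (curve_deriv_comp P RtoC); [apply HP, Hd|apply curve_deriv_RtoC].
      * apply (curve_deriv_sum_n (fun n t => Cmult (Cpow z n) (moment a n t))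
          (fun n t => Cmult (Cpow z n) (Cmult (RtoC (t ^ n)) (f (RtoC t))))). intros n.
        replace (Cmult (Cpow z n) (Cmult (RtoC (t ^ n)) (f (RtoC t)))) with
          (Cplus (Cmult (RtoC 0) (moment a n t)) (Cmult (Cpow z n) (Cmult (RtoC (t ^ n)) (f (RtoC t))))) by ring.
        apply (curve_deriv_mult (fun _ => Cpow z n)); [apply curve_deriv_const|].
        apply curve_deriv_moment; [exact Ta|]. rewrite Rabs_pos_eq; lra.
    + unfold dh. rewrite <- geom_tail.
      2:{ apply one_minus_neq_0; lra. }
      rewrite (sum_n_ext _ (fun n => Cmult (f (RtoC t)) (Cpow (Cmult (RtoC t) z) n))).
      * rewrite sum_n_Cmult_l. set (s := sum_n (Cpow (Cmult (RtoC t) z)) N : C). ring.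
      * intros n. rewrite Cpow_mult_l, RtoC_pow. eqC. ring.
  - intros t Ht. specialize (Hd t Ht). unfold dh.
    assert (G := growth_radial M alpha t f Hg Ht).
    assert (L := one_minus_lower (RtoC t) z ltac:(lra) Hz).
    rewrite !Cmod_mult, Cmod_pow, Cmod_mult, Cmod_inv, (Cmod_R t), (Rabs_pos_eq t)
      by (lra || (apply one_minus_neq_0; lra)).
    assert (X : (t * Cmod z) ^ S N * / Cmod (Cminus (RtoC 1) (Cmult (RtoC t) z)) 
       <= Cmod z ^ S N / (1 - Cmod z)).
    { apply Rmult_le_compat.
      - apply pow_le. apply Rmult_le_pos; lra.
      - left. apply Rinv_0_lt_compat. lra.
      - apply pow_incr. split; [apply Rmult_le_pos; lra|nra].
      - apply Rinv_le_contravar; lra. }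
    replace (M * (Cmod z ^ S N / (1 - Cmod z)) * Rpower (1 - t) (- alpha)) with
      (M * Rpower (1 - t) (- alpha) * (Cmod z ^ S N / (1 - Cmod z))) by ring.
    apply Rmult_le_compat; [apply Cmod_ge_0| |exact G|exact X].
    apply Rmult_le_pos.
    + apply pow_le. apply Rmult_le_pos; lra.
    + left. apply Rinv_0_lt_compat. lra.
Qed.

(** An [eps / 3] argument: [N] is fixed first, by the tail estimate uniform in [r] and by
    convergence of the series of [g z]; then [r] tends to 1 in finitely many moments. *)
Lemma kernel_primitive_radial_lim (a b : nat -> C) (f g P : C -> C) (M alpha : R) (z : C) :
  taylor a f -> 0 <= M -> 0 < alpha < 1 -> growth M alpha f -> disk z ->
  is_kernel_primitive f z P -> taylor b g ->
  (forall n, is_series (V := C_NormedModule) (moment_seq a n) (b n)) ->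
  filterlim (fun r => P (RtoC r)) (at_left 1) (locally (g z)).
Proof.
  intros Ta HM Ha Hg Hz HP Tb Hb Q HQ. apply locally_Cmod in HQ. destruct HQ as [eps [He HQ]].
  set (s := fun N => sum_n (G := C_NormedModule) (fun n => Cmult (Cpow z n) (b n)) N).
  assert (E1 : eventually (fun N => Cmod (Cminus (s N) (g z)) < eps / 3)).
  { apply (filterlim_Cmod_near s (g z)); [lra|].
    exact (proj1 (is_pseries_Cpow _ _ _) (Tb z Hz)). }
  set (K := M / (1 - Cmod z) / (1 - alpha)).
  assert (E2 : eventually (fun N => Rabs (K * Cmod z ^ S N) < eps / 3)).
  { assert (L : is_lim_seq (fun N => K * Cmod z ^ S N) 0).
    { replace (Finite 0) with (Rbar_mult K 0) by (simpl; f_equal; ring).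
      apply is_lim_seq_scal_l. apply (is_lim_seq_incr_1 (fun n => Cmod z ^ n)).
      apply is_lim_seq_geom. rewrite Rabs_pos_eq; [exact Hz|apply Cmod_ge_0]. }
    assert (B := proj1 (filterlim_locally (F := eventually) _ 0) L (mkposreal (eps / 3) ltac:(lra))).
    generalize B. apply filter_imp. intros n Hn.
    unfold ball in Hn; simpl in Hn; unfold AbsRing_ball, abs, minus, plus, opp in Hn; simpl in Hn.
    rewrite Ropp_0, Rplus_0_r in Hn. exact Hn. }
  destruct (filter_ex _ (filter_and _ _ E1 E2)) as [N [A1 A2]].
  assert (L : filterlim (fun r => sum_n (G := C_NormedModule) (fun n => Cmult (Cpow z n) (moment a n r)) N)
     (at_left 1) (locally (s N))).
  { apply (filterlim_sum_n_C (fun n r => Cmult (Cpow z n) (moment a n r))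
      (fun n => Cmult (Cpow z n) (b n))). intros n.
    apply filterlim_Cmult; [apply filterlim_const|]. apply moment_lim, Hb. }
  assert (E3 := filterlim_Cmod_near _ _ (eps / 3) ltac:(lra) L).
  assert (E4 := at_left_interval 0 1 Rlt_0_1).
  unfold filtermap. generalize (filter_and _ _ E3 E4). apply filter_imp. intros r [B1 B2].
  apply HQ.
  assert (B3 := kernel_primitive_partial a f P M alpha r z N Ta HM Ha Hg Hz HP ltac:(lra)).
  fold K in B3. assert (B4 := Rle_abs (K * Cmod z ^ S N)).
  set (S := sum_n (G := C_NormedModule) (fun n => Cmult (Cpow z n) (moment a n r)) N : C) in *.
  replace (Cminus (P (RtoC r)) (g z)) with
    (Cplus (Cminus (P (RtoC r)) S) (Cplus (Cminus S (s N)) (Cminus (s N) (g z)))) by ring.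
  eapply Rle_lt_trans; [apply Cmod_triangle|].
  eapply Rle_lt_trans; [apply Rplus_le_compat_l, Cmod_triangle|].
  lra.
Qed.

Definition path_den (z : C) (t : R) : C := Cminus (RtoC 1) (Cmult (RtoC (1 - t)) z).
Definition path (z : C) (t : R) : C := Cdiv (RtoC t) (path_den z t).

Lemma path_den_lower (z : C) (t : R) : 0 <= t <= 1 ->
  1 - (1 - t) * Cmod z <= Cmod (path_den z t).
Proof.
  intros Ht. unfold path_den.
  assert (T : Cmod (RtoC 1) <= Cmod (Cminus (RtoC 1) (Cmult (RtoC (1 - t)) z)) + Cmod (Cmult (RtoC (1 - t)) z)).
  { replace (RtoC 1) with (Cplus (Cminus (RtoC 1) (Cmult (RtoC (1 - t)) z)) (Cmult (RtoC (1 - t)) z)) at 1 by ring.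
    apply Cmod_triangle. }
  rewrite Cmod_1, Cmod_mult, Cmod_R, Rabs_pos_eq in T by lra. lra.
Qed.

Lemma path_den_upper (z : C) (t : R) : 0 <= t <= 1 ->
  Cmod (path_den z t) <= 1 + (1 - t) * Cmod z.
Proof.
  intros Ht. unfold path_den, Cminus. eapply Rle_trans; [apply Cmod_triangle|].
  rewrite Cmod_1, Cmod_opp, Cmod_mult, Cmod_R, Rabs_pos_eq by lra. lra.
Qed.

Lemma path_den_gt (z : C) (t : R) : disk z -> 0 <= t < 1 -> t < Cmod (path_den z t).
Proof.
  intros Hz Ht. assert (L := path_den_lower z t ltac:(lra)). unfold disk in Hz.
  assert ((1 - t) * Cmod z < 1 - t) by nra. lra.
Qed.

Lemma path_den_neq_0 (z : C) (t : R) : disk z -> 0 <= t < 1 -> path_den z t <> RtoC 0.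
Proof. intros Hz Ht. apply Cmod_gt_0. assert (L := path_den_gt z t Hz Ht). lra. Qed.

Lemma Cmod_path (z : C) (t : R) : disk z -> 0 <= t < 1 ->
  Cmod (path z t) = t / Cmod (path_den z t).
Proof.
  intros Hz Ht. unfold path.
  rewrite Cmod_div, Cmod_R, Rabs_pos_eq; [reflexivity|lra|now apply path_den_neq_0].
Qed.

(** [1 - |path|] is [(A - t) / A] with [A = |path_den|]; here [A - t >= (1 - t) (1 - |z|)] and
    [A <= 2]. Together with [path_to_1] this is the Stolz condition at 1. *)
Lemma path_disk_quant (z : C) (t : R) : disk z -> 0 <= t < 1 ->
  (1 - t) * (1 - Cmod z) / 2 <= 1 - Cmod (path z t).
Proof.
  intros Hz Ht. rewrite Cmod_path by assumption.
  assert (L := path_den_lower z t ltac:(lra)). assert (U := path_den_upper z t ltac:(lra)).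
  assert (G := path_den_gt z t Hz Ht). unfold disk in Hz. assert (Q := Cmod_ge_0 z).
  set (A := Cmod (path_den z t)) in *.
  apply (Rmult_le_reg_r A); [lra|].
  replace ((1 - t / A) * A) with (A - t) by (field; lra).
  assert (A <= 2) by nra. 
  assert (0 <= (1 - t) * (1 - Cmod z)) by (apply Rmult_le_pos; lra).
  nra.
Qed.

Lemma path_disk (z : C) (t : R) : disk z -> 0 <= t < 1 -> disk (path z t).
Proof.
  intros Hz Ht. assert (Q := path_disk_quant z t Hz Ht). unfold disk in *.
  assert (0 < (1 - t) * (1 - Cmod z)) by (apply Rmult_lt_0_compat; lra). lra.
Qed.

Lemma path_to_1 (z : C) (t : R) : disk z -> 0 <= t < 1 ->
  Cmod (Cminus (path z t) (RtoC 1)) <= 2 * (1 - t) / (1 - Cmod z).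
Proof.
  intros Hz Ht. assert (N := path_den_neq_0 z t Hz Ht).
  replace (Cminus (path z t) (RtoC 1)) with
    (Cdiv (Cmult (RtoC (1 - t)) (Cminus z (RtoC 1))) (path_den z t)).
  2:{ unfold path. replace (Cdiv (RtoC t) (path_den z t)) with 
        (Cdiv (Cminus (RtoC 1) (RtoC (1 - t))) (path_den z t)).
      - unfold path_den in *. field. exact N.
      - f_equal. rewrite <- RtoC_minus. f_equal. ring. }
  rewrite Cmod_div, Cmod_mult, Cmod_R, Rabs_pos_eq by (lra || exact N).
  assert (L := path_den_lower z t ltac:(lra)). unfold disk in Hz. assert (Q := Cmod_ge_0 z).
  assert (B : Cmod (Cminus z (RtoC 1)) <= 2).
  { unfold Cminus. eapply Rle_trans; [apply Cmod_triangle|]. rewrite Cmod_opp, Cmod_1. lra. }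
  assert (L' : 1 - Cmod z <= Cmod (path_den z t)) by nra.
  unfold Rdiv. apply Rmult_le_compat.
  - apply Rmult_le_pos; [lra|apply Cmod_ge_0].
  - left. apply Rinv_0_lt_compat. lra.
  - nra.
  - apply Rinv_le_contravar; lra.
Qed.

Lemma curve_deriv_path (z : C) (t : R) : disk z -> 0 <= t < 1 ->
  curve_deriv (path z) t (Cdiv (Cminus (RtoC 1) z) (Cmult (path_den z t) (path_den z t))).
Proof.
  intros Hz Ht. assert (N := path_den_neq_0 z t Hz Ht).
  assert (D1 : curve_deriv (path_den z) t z).
  { apply (curve_deriv_ext (fun s => Cplus (Cminus (RtoC 1) z) (Cmult (RtoC s) z))).
    - intros s. unfold path_den. rewrite RtoC_minus. ring.
    - assert (D := curve_deriv_plus _ _ _ _ _ (curve_deriv_const (Cminus (RtoC 1) z) t)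
        (curve_deriv_mult _ _ _ _ _ (curve_deriv_RtoC t) (curve_deriv_const z t))).
      cbv beta in D.
      replace (Cplus (RtoC 0) (Cplus (Cmult (RtoC 1) z) (Cmult (RtoC t) (RtoC 0)))) with z in D by ring.
      exact D. }
  (* Writes [1 / path_den] as [1 / (1 - v)] with [v = 1 - path_den], to fit the reciprocal rule. *)
  assert (D2 := cderiv_inv_affine (RtoC 1) (Cminus (RtoC 1) (path_den z t))).
  replace (Cminus (RtoC 1) (Cmult (Cminus (RtoC 1) (path_den z t)) (RtoC 1)))
    with (path_den z t) in D2 by ring.
  specialize (D2 N).
  assert (D3 := curve_deriv_comp _ (fun s => Cminus (RtoC 1) (path_den z s)) t _ _ D2 
     (curve_deriv_minus _ _ _ _ _ (curve_deriv_const (RtoC 1) t) D1)).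
  assert (D4 := curve_deriv_mult _ _ _ _ _ (curve_deriv_RtoC t) D3).
  cbv beta in D4.
  replace (Cdiv (Cminus (RtoC 1) z) (Cmult (path_den z t) (path_den z t))) with
    (Cplus (Cmult (RtoC 1) (Cinv (Cminus (RtoC 1) (Cmult (Cminus (RtoC 1) (path_den z t)) (RtoC 1)))))
           (Cmult (RtoC t) (Cmult (Cmult (RtoC 1) (Cmult (Cinv (path_den z t)) (Cinv (path_den z t))))
                                  (Cminus (RtoC 0) z)))).
  - apply (curve_deriv_ext (fun s => Cmult (RtoC s) (Cinv (Cminus (RtoC 1) (Cmult (Cminus (RtoC 1) (path_den z s)) (RtoC 1)))))).
    + intros s. unfold path, Cdiv. f_equal. f_equal. ring.
    + exact D4.
  - replace (Cminus (RtoC 1) (Cmult (Cminus (RtoC 1) (path_den z t)) (RtoC 1)))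
      with (path_den z t) by ring.
    replace (Cminus (RtoC 1) z) with (Cminus (path_den z t) (Cmult (RtoC t) z)).
    2:{ unfold path_den. rewrite RtoC_minus. ring. }
    field. exact N.
Qed.

(** The integrand [f w / (1 - w z) dw] along [path z] is [f (path z t) / path_den z t dt]. *)
Lemma curve_deriv_primitive_path (f P : C -> C) (z : C) (t : R) :
  is_kernel_primitive f z P -> disk z -> 0 <= t < 1 ->
  curve_deriv (fun s => P (path z s)) t (Cdiv (f (path z t)) (path_den z t)).
Proof.
  intros [_ HP] Hz Ht. assert (N := path_den_neq_0 z t Hz Ht).
  assert (Hd := path_disk z t Hz Ht).
  assert (D := curve_deriv_comp P (path z) t _ _ (HP _ Hd) (curve_deriv_path z t Hz Ht)).
  assert (N1 : Cminus (RtoC 1) z <> RtoC 0).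
  { replace (Cminus (RtoC 1) z) with (Cminus (RtoC 1) (Cmult (RtoC 1) z)) by ring.
    apply one_minus_neq_0; [rewrite Cmod_1; lra|exact Hz]. }
  (* The factor [1 - z] appears here and in the derivative of the path, and cancels. *)
  assert (E : Cminus (RtoC 1) (Cmult (path z t) z) = Cdiv (Cminus (RtoC 1) z) (path_den z t)).
  { unfold path. replace (Cminus (RtoC 1) z) with (Cminus (path_den z t) (Cmult (RtoC t) z)).
    2:{ unfold path_den. rewrite RtoC_minus. ring. }
    field. exact N. }
  rewrite E in D.
  replace (Cdiv (f (path z t)) (path_den z t)) with
   (Cmult (Cmult (f (path z t)) (Cinv (Cdiv (Cminus (RtoC 1) z) (path_den z t))))
          (Cdiv (Cminus (RtoC 1) z) (Cmult (path_den z t) (path_den z t)))).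
  - exact D.
  - field. split; assumption.
Qed.

(** By convexity the chord from [|w|] to [w] stays in the closed disc of radius [|w|], where the
    growth bound at that radius controls [f]. *)
Lemma segment_bound (f P : C -> C) (M alpha : R) (z w : C) :
  0 <= M -> 0 < alpha -> growth M alpha f -> disk z -> disk w -> is_kernel_primitive f z P ->
  Cmod (Cminus (P w) (P (RtoC (Cmod w)))) <=
  M * Rpower (1 - Cmod w) (- alpha) / (1 - Cmod z) * Cmod (Cminus w (RtoC (Cmod w))).
Proof.
  intros HM Ha Hg Hz Hw [_ HP]. unfold disk in *. set (rho := Cmod w) in *.
  assert (R0 : 0 <= rho) by apply Cmod_ge_0.
  set (seg := fun t => Cplus (RtoC rho) (Cmult (RtoC t) (Cminus w (RtoC rho)))).
  assert (Hs : forall t, 0 <= t <= 1 -> Cmod (seg t) <= rho).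
  { intros t Ht. unfold seg.
    replace (Cplus _ _) with (Cplus (Cmult (RtoC (1 - t)) (RtoC rho)) (Cmult (RtoC t) w)).
    2:{ rewrite RtoC_minus. ring. }
    eapply Rle_trans; [apply Cmod_triangle|].
    rewrite !Cmod_mult, !Cmod_R, !Rabs_pos_eq by lra. fold rho. lra. }
  set (k := M * Rpower (1 - rho) (- alpha) / (1 - Cmod z) * Cmod (Cminus w (RtoC rho))).
  assert (Ds : forall t, curve_deriv seg t (Cminus w (RtoC rho))).
  { intros t. replace (Cminus w (RtoC rho)) with (Cplus (RtoC 0) (Cplus (Cmult (RtoC 1) (Cminus w (RtoC rho)))
       (Cmult (RtoC t) (RtoC 0)))) by ring.
    apply curve_deriv_plus; [apply curve_deriv_const|].
    apply (curve_deriv_mult RtoC (fun _ => Cminus w (RtoC rho)));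
      [apply curve_deriv_RtoC|apply curve_deriv_const]. }
  assert (B := curve_mean_value (fun t => P (seg t))
     (fun t => Cmult (Cmult (f (seg t)) (Cinv (Cminus (RtoC 1) (Cmult (seg t) z)))) (Cminus w (RtoC rho)))
     (fun t => k * t) (fun _ => k) 0 1 Rle_0_1).
  cbv beta in B.
  replace (seg 1) with w in B by (unfold seg; ring).
  replace (seg 0) with (RtoC rho) in B by (unfold seg; ring).
  replace (k * 1 - k * 0) with k in B by ring.
  apply B.
  - intros t Ht. apply curve_deriv_comp; [|apply Ds]. apply HP. specialize (Hs t Ht). lra.
  - intros t _. auto_derive; [exact I|ring].
  - intros t Ht. specialize (Hs t Ht). unfold k. rewrite !Cmod_mult.
    apply Rmult_le_compat_r; [apply Cmod_ge_0|].
    rewrite Cmod_inv by (apply one_minus_neq_0; lra).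
    assert (L := one_minus_lower (seg t) z ltac:(lra) Hz).
    apply Rmult_le_compat; [apply Cmod_ge_0|left; apply Rinv_0_lt_compat; lra| |apply Rinv_le_contravar; lra].
    eapply Rle_trans; [apply Hg; unfold disk; lra|].
    apply Rmult_le_compat_l; [exact HM|].
    rewrite !Rpower_Ropp. apply Rinv_le_contravar; [apply Rpower_pos|].
    apply Rle_Rpower_l; lra.
Qed.

(** [path z] ends at [1] inside a Stolz angle, where the growth of [f] leaves
    only [(1 - t) ^ (1 - alpha)] between the path and the radius. *)
Lemma path_radial_gap (f P : C -> C) (M alpha t : R) (z : C) :
  0 <= M -> 0 < alpha < 1 -> growth M alpha f -> disk z -> is_kernel_primitive f z P -> 0 <= t < 1 ->
  Cmod (Cminus (P (path z t)) (P (RtoC (Cmod (path z t))))) <=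
  16 * M / (1 - Cmod z) ^ 4 * Rpower (1 - t) (1 - alpha).
Proof.
  intros HM Ha Hg Hz HP Ht.
  assert (Hw := path_disk z t Hz Ht). assert (G := path_disk_quant z t Hz Ht).
  assert (T1 := path_to_1 z t Hz Ht).
  eapply Rle_trans; [apply (segment_bound f P M alpha z); try assumption; lra|].
  set (w := path z t) in *. set (e := 1 - Cmod z) in *.
  assert (He : 0 < e <= 1) by (unfold e, disk in *; assert (Q := Cmod_ge_0 z); lra).
  unfold disk in Hw. set (u := 1 - Cmod w) in *.
  assert (Hu : 0 < u) by (unfold u; lra).
  assert (B1 : u <= 2 * (1 - t) / e).
  { eapply Rle_trans; [|exact T1].
    assert (X : Cmod (RtoC 1) <= Cmod (Cminus w (RtoC 1)) + Cmod w).
    { replace (RtoC 1) with (Cplus (Copp (Cminus w (RtoC 1))) w) at 1 by ring.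
      rewrite <- (Cmod_opp (Cminus w (RtoC 1))). apply Cmod_triangle. }
    rewrite Cmod_1 in X. unfold u. lra. }
  (* The Stolz condition: [|w - 1| <= 2 (1 - t) / e] and [u >= (1 - t) e / 2] give
     [|w - 1| <= 4 u / e ^ 2]. The remaining [u] is absorbed by another [4 u / e ^ 2]. *)
  assert (B2 : Cmod (Cminus w (RtoC (Cmod w))) <= 8 / e ^ 2 * u).
  { replace (Cminus w (RtoC (Cmod w))) with (Cplus (Cminus w (RtoC 1)) (RtoC u)).
    2:{ unfold u. rewrite RtoC_minus. ring. }
    eapply Rle_trans; [apply Cmod_triangle|]. rewrite Cmod_R, (Rabs_pos_eq u) by lra.
    assert (X : 2 * (1 - t) / e <= 4 / e ^ 2 * u).
    { apply (Rmult_le_reg_r (e ^ 2)); [apply pow_lt; lra|].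
      replace (2 * (1 - t) / e * e ^ 2) with (4 * ((1 - t) * e / 2)) by (field; lra).
      replace (4 / e ^ 2 * u * e ^ 2) with (4 * u) by (field; lra). lra. }
    assert (u <= 4 / e ^ 2 * u).
    { apply (Rmult_le_reg_r (e ^ 2)); [apply pow_lt; lra|].
      replace (4 / e ^ 2 * u * e ^ 2) with (4 * u) by (field; lra).
      assert (e ^ 2 <= 1) by (rewrite <- (pow1 2); apply pow_incr; lra). nra. }
    replace (8 / e ^ 2 * u) with (4 / e ^ 2 * u + 4 / e ^ 2 * u) by (field; lra). lra. }
  assert (B3 : Rpower u (- alpha) * u = Rpower u (1 - alpha)).
  { rewrite <- (Rpower_1 u) at 2 by exact Hu. rewrite <- Rpower_plus. f_equal. ring. }
  assert (B4 : Rpower u (1 - alpha) <= 2 / e * Rpower (1 - t) (1 - alpha)).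
  { apply (Rle_trans _ (Rpower (2 / e * (1 - t)) (1 - alpha))).
    - apply Rle_Rpower_l; [lra|]. split; [exact Hu|].
      replace (2 / e * (1 - t)) with (2 * (1 - t) / e) by (field; lra). exact B1.
    - assert (2 <= 2 / e).
      { apply (Rmult_le_reg_r e); [lra|]. replace (2 / e * e) with 2 by (field; lra). lra. }
      rewrite <- Rpower_mult_distr by lra.
      apply Rmult_le_compat_r; [left; apply Rpower_pos|].
      rewrite <- (Rpower_1 (2 / e)) at 2 by lra. apply Rle_Rpower; lra. }
  assert (PM : 0 <= M * Rpower u (- alpha) / e).
  { apply Rmult_le_pos; [apply Rmult_le_pos; [exact HM|left; apply Rpower_pos]|left; apply Rinv_0_lt_compat; lra]. }
  apply (Rle_trans _ (M * Rpower u (- alpha) / e * (8 / e ^ 2 * u))).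
  { now apply Rmult_le_compat_l. }
  replace (M * Rpower u (- alpha) / e * (8 / e ^ 2 * u)) with
    (8 * M / e ^ 3 * (Rpower u (- alpha) * u)) by (field; lra).
  rewrite B3.
  replace (16 * M / e ^ 4 * Rpower (1 - t) (1 - alpha)) with
    (8 * M / e ^ 3 * (2 / e * Rpower (1 - t) (1 - alpha))) by (field; lra).
  apply Rmult_le_compat_l; [|exact B4].
  apply Rmult_le_pos; [lra|]. left. apply Rinv_0_lt_compat, pow_lt. lra.
Qed.

Lemma Rpower_at_left_1 (K b : R) : 0 < b ->
  forall eps, 0 < eps -> at_left 1 (fun t => K * Rpower (1 - t) b < eps).
Proof.
  intros Hb eps He. 
  set (K' := Rabs K + 1). assert (HK : 0 < K') by (unfold K'; generalize (Rabs_pos K); lra).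
  assert (P : 0 < Rpower (eps / K') (/ b)) by apply Rpower_pos.
  exists (mkposreal _ P). intros t Ht Hx.
  unfold ball in Ht; simpl in Ht; unfold AbsRing_ball, abs, minus, plus, opp in Ht; simpl in Ht.
  apply Rabs_def2 in Ht.
  assert (Q := Rpower_pos (1 - t) b).
  assert (L : Rpower (1 - t) b < eps / K').
  { replace (eps / K') with (Rpower (Rpower (eps / K') (/ b)) b).
    - apply Rlt_Rpower_l; [exact Hb|]. lra.
    - rewrite Rpower_mult, Rinv_l, Rpower_1 by (lra || now apply Rdiv_lt_0_compat). reflexivity. }
  apply (Rmult_lt_compat_l K') in L; [|exact HK].
  replace (K' * (eps / K')) with eps in L by (field; lra).
  assert (K <= K') by (unfold K'; generalize (Rle_abs K); lra). nra.
Qed.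

(** The modulus of [path z t] tends to 1 from the left, so the radial limit applies along it;
    [path_radial_gap] compares the path with its moduli. *)
Theorem hilbert_path_lim (a b : nat -> C) (f g P : C -> C) (M alpha : R) (z : C) :
  taylor a f -> 0 <= M -> 0 < alpha < 1 -> growth M alpha f -> disk z ->
  is_kernel_primitive f z P -> taylor b g ->
  (forall n, is_series (V := C_NormedModule) (moment_seq a n) (b n)) ->
  filterlim (fun t => P (path z t)) (at_left 1) (locally (g z)).
Proof.
  intros Ta HM Ha Hg Hz HP Tb Hb.
  assert (L := kernel_primitive_radial_lim a b f g P M alpha z Ta HM Ha Hg Hz HP Tb Hb).
  assert (I01 := at_left_interval 0 1 Rlt_0_1).
  assert (Lr : filterlim (fun t => Cmod (path z t)) (at_left 1) (at_left 1)).
  { intros Q [d HQ]. unfold filtermap.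
    assert (E := Rpower_at_left_1 (2 / (1 - Cmod z)) 1 Rlt_0_1 d (cond_pos d)).
    generalize (filter_and _ _ E I01). apply filter_imp. intros t [A B].
    rewrite Rpower_1 in A by lra.
    assert (D := path_disk z t Hz ltac:(lra)). assert (T1 := path_to_1 z t Hz ltac:(lra)).
    apply HQ; [|exact D].
    unfold ball; simpl; unfold AbsRing_ball, abs, minus, plus, opp; simpl.
    assert (X : Cmod (RtoC 1) <= Cmod (Cminus (path z t) (RtoC 1)) + Cmod (path z t)).
    { replace (RtoC 1) with (Cplus (Copp (Cminus (path z t) (RtoC 1))) (path z t)) at 1 by ring.
      rewrite <- (Cmod_opp (Cminus (path z t) (RtoC 1))). apply Cmod_triangle. }
    rewrite Cmod_1 in X. unfold disk in D, Hz.
    replace (2 / (1 - Cmod z) * (1 - t)) with (2 * (1 - t) / (1 - Cmod z)) in A by (field; lra).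
    apply Rabs_def1; lra. }
  assert (L2 := filterlim_comp _ _ _ _ _ _ _ _ Lr L).
  intros Q HQ. apply locally_Cmod in HQ. destruct HQ as [eps [He HQ]].
  assert (E1 := filterlim_Cmod_near _ _ (eps / 2) ltac:(lra) L2).
  assert (E2 := Rpower_at_left_1 (16 * M / (1 - Cmod z) ^ 4) (1 - alpha) ltac:(lra) (eps / 2) ltac:(lra)).
  unfold filtermap. generalize (filter_and _ _ I01 (filter_and _ _ E1 E2)).
  apply filter_imp. intros t [B0 [B1 B2]]. apply HQ.
  assert (B3 := path_radial_gap f P M alpha t z HM Ha Hg Hz HP ltac:(lra)).
  replace (Cminus (P (path z t)) (g z)) with
    (Cplus (Cminus (P (path z t)) (P (RtoC (Cmod (path z t))))) 
           (Cminus (P (RtoC (Cmod (path z t)))) (g z))) by ring.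
  eapply Rle_lt_trans; [apply Cmod_triangle|]. lra.
Qed.

(** * The pointwise estimate and the integrals *)

Lemma exp_monotone (x y : R) : x <= y -> exp x <= exp y.
Proof.
  intros [H| ->]; [left; now apply exp_increasing|apply Rle_refl].
Qed.

Lemma monotone_from_derivative (F dF : R -> R) (a b : R) : a <= b ->
  (forall s, a <= s <= b -> is_derive F s (dF s)) ->
  (forall s, a <= s <= b -> 0 <= dF s) -> F a <= F b.
Proof.
  intros Hab HD Hp.
  destruct (MVT_gen F a b dF) as [c [Hc E]].
  - rewrite Rmin_left, Rmax_right by lra. intros x Hx. apply HD. lra.
  - rewrite Rmin_left, Rmax_right by lra. intros x Hx. apply continuity_pt_filterlim.
    apply (ex_derive_continuous (V := R_NormedModule)). eexists. apply HD. lra.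
  - rewrite Rmin_left, Rmax_right in Hc by lra. specialize (Hp c Hc).
    assert (0 <= dF c * (b - a)) by (apply Rmult_le_pos; lra). lra.
Qed.

(** With [s = |path_den|], the expression is the reciprocal of [s (1 - t ^ 2 / s ^ 2) ^ alpha].
    Minus its logarithmic derivative has the sign of [s ^ 2 + (2 alpha - 1) t ^ 2], positive since
    [s > t] and [2 alpha - 1 > -1]. Hence the smallest [|path_den|] is the worst. *)
Lemma modulus_factor_decreasing (alpha t s1 s2 : R) : 0 < alpha < 1 -> 0 < t < s1 -> s1 <= s2 ->
  Rpower s2 (2 * alpha - 1) * Rpower (s2 ^ 2 - t ^ 2) (- alpha) <=
  Rpower s1 (2 * alpha - 1) * Rpower (s1 ^ 2 - t ^ 2) (- alpha).
Proof.
  intros Ha Ht Hs. unfold Rpower. rewrite <- !exp_plus.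
  assert (H := monotone_from_derivative
    (fun s => - ((2 * alpha - 1) * ln s + - alpha * ln (s ^ 2 - t ^ 2)))
    (fun s => (s ^ 2 + (2 * alpha - 1) * t ^ 2) / (s * (s ^ 2 - t ^ 2))) s1 s2 Hs).
  cbv beta in H.
  assert (Pos : forall s, s1 <= s <= s2 -> 0 < s ^ 2 - t ^ 2) by (intros; nra).
  assert (X : - ((2 * alpha - 1) * ln s1 + - alpha * ln (s1 ^ 2 - t ^ 2)) <=
              - ((2 * alpha - 1) * ln s2 + - alpha * ln (s2 ^ 2 - t ^ 2))).
  { apply H.
    - intros s Hx. specialize (Pos s Hx). auto_derive; [split; [lra|split; [lra|exact I]]|].
      field. split; lra.
    - intros s Hx. specialize (Pos s Hx). apply Rmult_le_pos; [nra|].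
      left. apply Rinv_0_lt_compat. apply Rmult_lt_0_compat; lra. }
  apply exp_monotone. lra.
Qed.

(** Logarithm of [G] at [x = 1 - y], up to a term in [t] alone, after the common factor [1 - t - x]
    of numerator and denominator is cancelled. It therefore makes sense at [y = t], where [G] is a
    quotient 0 / 0. *)
Definition logG (alpha t y : R) : R :=
  (2 * alpha - 1) * ln y + alpha * ln (2 - t - y) - alpha * ln (y + t).

(** Numerator of minus the derivative of [logG] in [y]; the two terms with [alpha] combine because
    [(2 - t - y) + (y + t) = 2]. *)
Definition critical (alpha t y : R) : R :=
  2 * alpha * y - (2 * alpha - 1) * (2 - t - y) * (y + t).

Lemma G_exp (alpha t x : R) : 0 < t < 1 -> 0 <= x < 1 - t ->
  G alpha t x = exp (- (2 * alpha) * ln (1 - t) + logG alpha t (1 - x)).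
Proof.
  intros Ht Hx. unfold G, Rpower. rewrite <- exp_plus. f_equal.
  assert (N : x / (1 - t) = x * / (1 - t)) by reflexivity.
  rewrite Rabs_pos_eq.
  2:{ apply Rmult_le_pos; [lra|]. left. apply Rinv_0_lt_compat. lra. }
  replace ((1 - (x / (1 - t)) ^ 2) / ((1 - x) ^ 2 - t ^ 2)) with
    ((2 - t - (1 - x)) / (((1 - t) * (1 - t)) * ((1 - x) + t))).
  2:{ field. repeat split; nra. }
  assert (P : 0 < (1 - t) * (1 - t)) by (apply Rmult_lt_0_compat; lra).
  rewrite ln_div by (lra || (apply Rmult_lt_0_compat; lra)).
  rewrite (ln_mult ((1 - t) * (1 - t))), (ln_mult (1 - t)) by lra. unfold logG. ring.
Qed.

Lemma is_derive_logG (alpha t y : R) : 0 < t < 1 -> t <= y <= 1 ->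
  is_derive (logG alpha t) y (- critical alpha t y / (y * (2 - t - y) * (y + t))).
Proof.
  intros Ht Hy. unfold logG. auto_derive.
  - repeat split; lra.
  - unfold critical. field. lra.
Qed.

Lemma logG_le_right (alpha t y1 y2 : R) : 0 < t < 1 -> t <= y1 -> y1 <= y2 -> y2 <= 1 ->
  (forall y, y1 <= y <= y2 -> 0 <= critical alpha t y) -> logG alpha t y2 <= logG alpha t y1.
Proof.
  intros Ht H1 H12 H2 Hc.
  assert (H := monotone_from_derivative (fun y => - logG alpha t y)
    (fun y => critical alpha t y / (y * (2 - t - y) * (y + t))) y1 y2 H12).
  cbv beta in H. enough (- logG alpha t y1 <= - logG alpha t y2) by lra. apply H.
  - intros s Hs.
    replace (critical alpha t s / (s * (2 - t - s) * (s + t))) with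
      (- (- critical alpha t s / (s * (2 - t - s) * (s + t)))) by (field; lra).
    apply (is_derive_opp (V := R_NormedModule)). apply is_derive_logG; lra.
  - intros s Hs. apply Rmult_le_pos; [now apply Hc|]. left. apply Rinv_0_lt_compat.
    repeat apply Rmult_lt_0_compat; lra.
Qed.

Lemma logG_le_left (alpha t y1 y2 : R) : 0 < t < 1 -> t <= y1 -> y1 <= y2 -> y2 <= 1 ->
  (forall y, y1 <= y <= y2 -> critical alpha t y <= 0) -> logG alpha t y1 <= logG alpha t y2.
Proof.
  intros Ht H1 H12 H2 Hc.
  apply (monotone_from_derivative (logG alpha t)
    (fun y => - critical alpha t y / (y * (2 - t - y) * (y + t))) y1 y2 H12).
  - intros s Hs. apply is_derive_logG; lra.
  - intros s Hs. specialize (Hc s Hs). apply Rmult_le_pos; [lra|]. left. apply Rinv_0_lt_compat.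
    repeat apply Rmult_lt_0_compat; lra.
Qed.

(** The limit of [G] as [x] tends to [1 - t]. *)
Lemma logG_t (alpha t : R) : 0 < t < 1 ->
  exp (- (2 * alpha) * ln (1 - t) + logG alpha t t) = Rpower t (alpha - 1) / Rpower (1 - t) alpha.
Proof.
  intros Ht. unfold Rdiv. rewrite <- Rpower_Ropp. unfold Rpower. rewrite <- exp_plus. f_equal.
  unfold logG. replace (2 - t - t) with (2 * (1 - t)) by ring. replace (t + t) with (2 * t) by ring.
  rewrite !ln_mult by lra. ring.
Qed.

(** Monotonicity of [critical alpha t y / y] in [y], multiplied out. *)
Lemma critical_ratio (alpha t y1 y2 : R) : 1 / 2 < alpha -> 0 < t < 1 -> 0 <= y1 <= y2 ->
  y2 * critical alpha t y1 <= y1 * critical alpha t y2.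
Proof.
  intros Ha Ht Hy.
  assert (E : y1 * critical alpha t y2 - y2 * critical alpha t y1 =
     (2 * alpha - 1) * (y2 - y1) * (y1 * y2 + t * (2 - t))) by (unfold critical; ring).
  assert (0 <= (2 * alpha - 1) * (y2 - y1) * (y1 * y2 + t * (2 - t))).
  { apply Rmult_le_pos; [apply Rmult_le_pos; lra|]. nra. }
  lra.
Qed.

(** It suffices that [critical] is nonnegative on [[t, 1]]. For [alpha <= 1 / 2] both of its terms
    are. Otherwise [critical_ratio] reduces this to [y = t], where [critical] equals
    [2 t ((4 alpha - 2) t - (3 alpha - 2))]: this is the origin of [split_point] and of the
    threshold [2 / 3]. *)
Lemma G_le_endpoint (alpha t x : R) : 0 < alpha < 1 -> 0 < t < 1 -> 0 <= x < 1 - t ->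
  (2 / 3 < alpha -> split_point alpha <= t) ->
  G alpha t x <= Rpower t (alpha - 1) / Rpower (1 - t) alpha.
Proof.
  intros Ha Ht Hx Hs. rewrite G_exp, <- logG_t by assumption.
  apply exp_monotone. apply Rplus_le_compat_l.
  apply logG_le_right; try lra. intros y Hy.
  destruct (Rle_dec alpha (1 / 2)) as [L|L].
  - unfold critical. 
    assert (0 <= (1 - 2 * alpha) * ((2 - t - y) * (y + t))).
    { apply Rmult_le_pos; [lra|apply Rmult_le_pos; lra]. }
    assert (0 <= alpha * y) by (apply Rmult_le_pos; lra). lra.
  - assert (Ct : 0 <= critical alpha t t).
    { replace (critical alpha t t) with (t * ((4 * alpha - 2) * 2 * t - 2 * (3 * alpha - 2)))
        by (unfold critical; ring).
      apply Rmult_le_pos; [lra|].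
      destruct (Rle_dec alpha (2 / 3)) as [L2|L2].
      - assert (0 <= (4 * alpha - 2) * t) by (apply Rmult_le_pos; lra). lra.
      - specialize (Hs ltac:(lra)). unfold split_point in Hs.
        apply (Rmult_le_compat_l (4 * alpha - 2)) in Hs; [|lra].
        replace ((4 * alpha - 2) * ((3 * alpha - 2) / (4 * alpha - 2))) with (3 * alpha - 2) in Hs by (field; lra).
        lra. }
    assert (R1 := critical_ratio alpha t t y ltac:(lra) Ht ltac:(lra)).
    assert (0 <= y * critical alpha t t) by (apply Rmult_le_pos; lra).
    apply (Rmult_le_reg_l t); lra.
Qed.

Definition y0 (alpha t : R) : R := 1 - x0 alpha t.

(** A quarter of the discriminant of [critical] as a quadratic in [y], written so that its
    positivity for [alpha > 1 / 2] is visible. The root [y0] takes the plus sign; the roots have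
    product [- t (2 - t)], so it is the positive one. *)
Definition disc (alpha t : R) : R := (1 - alpha) ^ 2 + 2 * alpha * (2 * alpha - 1) * t.

Lemma y0_eq (alpha t : R) : 1 / 2 < alpha ->
  y0 alpha t = (sqrt (disc alpha t) - (1 - alpha + (2 * alpha - 1) * t)) / (2 * alpha - 1).
Proof.
  intros Ha. unfold y0, x0, disc.
  replace (4 * alpha ^ 2 * t - 2 * alpha * t + alpha ^ 2 - 2 * alpha + 1)
    with ((1 - alpha) ^ 2 + 2 * alpha * (2 * alpha - 1) * t) by ring.
  field. lra.
Qed.

Lemma disc_pos (alpha t : R) : 1 / 2 < alpha < 1 -> 0 < t -> 0 < disc alpha t.
Proof.
  intros Ha Ht. unfold disc.
  assert (0 < (1 - alpha) ^ 2) by (apply pow_lt; lra).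
  assert (0 < 2 * alpha * (2 * alpha - 1) * t) by (repeat apply Rmult_lt_0_compat; lra).
  lra.
Qed.

Lemma critical_y0 (alpha t : R) : 1 / 2 < alpha < 1 -> 0 < t -> critical alpha t (y0 alpha t) = 0.
Proof.
  intros Ha Ht. rewrite y0_eq by lra.
  assert (P := disc_pos alpha t Ha Ht).
  assert (S := sqrt_sqrt (disc alpha t) ltac:(lra)).
  set (r := sqrt (disc alpha t)) in *.
  unfold critical.
  apply (Rmult_eq_reg_l (2 * alpha - 1)); [|lra].
  transitivity (r * r - disc alpha t); [|lra]. unfold disc. field. lra.
Qed.

Lemma y0_pos (alpha t : R) : 1 / 2 < alpha < 1 -> 0 < t < 1 -> 0 < y0 alpha t.
Proof.
  intros Ha Ht. rewrite y0_eq by lra. apply Rdiv_lt_0_compat; [|lra].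
  assert (X : 1 - alpha + (2 * alpha - 1) * t < sqrt (disc alpha t)); [|lra].
  rewrite <- (sqrt_pow2 (1 - alpha + (2 * alpha - 1) * t)).
  2:{ assert (0 <= (2 * alpha - 1) * t) by (apply Rmult_le_pos; lra). lra. }
  apply sqrt_lt_1_alt. split; [apply pow2_ge_0|]. unfold disc.
  (* This quantity is the difference of the two radicands. *)
  assert (0 < (2 * alpha - 1) ^ 2 * (t * (2 - t))).
  { apply Rmult_lt_0_compat; [apply pow_lt; lra|apply Rmult_lt_0_compat; lra]. }
  nra.
Qed.

Lemma split_point_bounds (alpha : R) : 2 / 3 < alpha < 1 -> 0 < split_point alpha < 1 / 2.
Proof.
  intros Ha. unfold split_point. split.
  - apply Rdiv_lt_0_compat; lra.
  - apply (Rmult_lt_reg_r (4 * alpha - 2)); [lra|].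
    unfold Rdiv at 1. rewrite Rmult_assoc, Rinv_l by lra. lra.
Qed.

Lemma y0_lt_1 (alpha t : R) : 1 / 2 < alpha < 1 -> 0 < t < 1 -> y0 alpha t < 1.
Proof.
  intros Ha Ht.
  assert (Z := critical_y0 alpha t ltac:(lra) ltac:(lra)).
  assert (C1 : 0 < critical alpha t 1).
  { replace (critical alpha t 1) with (2 * alpha - (2 * alpha - 1) * (1 - t ^ 2)) by (unfold critical; ring).
    assert (0 <= (2 * alpha - 1) * t ^ 2) by (apply Rmult_le_pos; [lra|apply pow2_ge_0]). lra. }
  destruct (Rlt_dec (y0 alpha t) 1) as [|N]; [assumption|exfalso].
  assert (R1 := critical_ratio alpha t 1 (y0 alpha t) ltac:(lra) ltac:(lra) ltac:(lra)).
  rewrite Z in R1. nra.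
Qed.

(** [critical] is negative at [t] exactly because [t < split_point]; as [critical / y] increases and
    vanishes at [y0], the root lies to the right of [t]. *)
Lemma y0_bounds (alpha t : R) : 2 / 3 < alpha < 1 -> 0 < t < split_point alpha ->
  t < y0 alpha t < 1.
Proof.
  intros Ha Ht. assert (B := split_point_bounds alpha Ha).
  assert (P := y0_pos alpha t ltac:(lra) ltac:(lra)).
  assert (Z := critical_y0 alpha t ltac:(lra) ltac:(lra)).
  assert (Ct : critical alpha t t < 0).
  { replace (critical alpha t t) with (t * (2 * ((4 * alpha - 2) * t) - 2 * (3 * alpha - 2)))
      by (unfold critical; ring).
    assert (Hs : (4 * alpha - 2) * t < 3 * alpha - 2).
    { destruct Ht as [_ Hs]. unfold split_point in Hs.
      apply (Rmult_lt_compat_l (4 * alpha - 2)) in Hs; [|lra].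
      replace ((4 * alpha - 2) * ((3 * alpha - 2) / (4 * alpha - 2))) with (3 * alpha - 2) in Hs by (field; lra).
      exact Hs. }
    nra. }
  split.
  - destruct (Rlt_dec t (y0 alpha t)) as [|N]; [assumption|exfalso].
    assert (R1 := critical_ratio alpha t (y0 alpha t) t ltac:(lra) ltac:(lra) ltac:(lra)).
    rewrite Z in R1. nra.
  - apply y0_lt_1; lra.
Qed.

Lemma G_x0_exp (alpha t : R) : 2 / 3 < alpha < 1 -> 0 < t < split_point alpha ->
  G alpha t (x0 alpha t) = exp (- (2 * alpha) * ln (1 - t) + logG alpha t (y0 alpha t)).
Proof.
  intros Ha Ht. assert (B := split_point_bounds alpha Ha).
  assert (Y := y0_bounds alpha t Ha Ht). unfold y0 in *. apply G_exp; lra.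
Qed.

Lemma G_le_x0 (alpha t x : R) : 2 / 3 < alpha < 1 -> 0 < t < split_point alpha -> 0 <= x < 1 - t ->
  G alpha t x <= G alpha t (x0 alpha t).
Proof.
  intros Ha Ht Hx. assert (B := split_point_bounds alpha Ha).
  assert (Y := y0_bounds alpha t Ha Ht).
  assert (Z := critical_y0 alpha t ltac:(lra) ltac:(lra)).
  rewrite G_x0_exp, G_exp by (assumption || lra).
  apply exp_monotone. apply Rplus_le_compat_l.
  destruct (Rle_dec (1 - x) (y0 alpha t)) as [L|L].
  - apply logG_le_left; try lra. intros y Hy.
    assert (R1 := critical_ratio alpha t y (y0 alpha t) ltac:(lra) ltac:(lra) ltac:(lra)).
    rewrite Z, Rmult_0_r in R1. apply (Rmult_le_reg_l (y0 alpha t)); lra.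
  - apply logG_le_right; try lra. intros y Hy.
    assert (R1 := critical_ratio alpha t (y0 alpha t) y ltac:(lra) ltac:(lra) ltac:(lra)).
    rewrite Z, Rmult_0_r in R1. apply (Rmult_le_reg_l (y0 alpha t)); lra.
Qed.

(** The constant [exp (1 / alpha)] alone contributes [1 / alpha >= 1]. With a weight of at least 1,
    the logarithm may be dropped wherever only finiteness matters. *)
Lemma log_arg_lower (alpha s : R) : 0 < alpha < 1 -> 0 < s <= 1 -> 1 <= ln (2 * exp (1 / alpha) / s).
Proof.
  intros Ha Hs.
  assert (E := exp_pos (1 / alpha)).
  assert (I : 1 <= / s) by (rewrite <- Rinv_1; apply Rinv_le_contravar; lra).
  assert (I2 : 1 <= 1 / alpha).
  { apply (Rmult_le_reg_r alpha); [lra|]. replace (1 / alpha * alpha) with 1 by (field; lra). lra. }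
  apply (Rle_trans _ (ln (exp (1 / alpha)))); [now rewrite ln_exp|].
  apply ln_le; [exact E|]. unfold Rdiv. nra.
Qed.

Lemma log_factor_ge_1 (alpha t : R) : 0 < alpha < 1 -> 0 < t < 1 -> 1 <= log_factor alpha t.
Proof.
  intros Ha Ht. unfold log_factor.
  replace ((2 - t) ^ 2 * exp (1 / alpha) / (2 - 2 * t)) with
    (2 * exp (1 / alpha) / ((4 - 4 * t) / (2 - t) ^ 2)) by (field; lra).
  assert (P : 0 < (2 - t) ^ 2) by (apply pow_lt; lra).
  apply log_arg_lower; [exact Ha|]. split; [apply Rdiv_lt_0_compat; lra|].
  apply (Rmult_le_reg_r ((2 - t) ^ 2)); [exact P|].
  replace ((4 - 4 * t) / (2 - t) ^ 2 * (2 - t) ^ 2) with (4 - 4 * t) by (field; lra).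
  assert (0 <= t ^ 2) by apply pow2_ge_0. nra.
Qed.

(** [log_factor] is the logarithmic weight at [s = (4 - 4 t) / (2 - t) ^ 2], the value of
    [1 - |path| ^ 2] when [|path_den| = 2 - t], approached as [z] tends to [-1]. The weight
    decreases in [s]. *)
Lemma log_factor_le (alpha t s : R) : 0 < alpha < 1 -> 0 < t < 1 -> 0 < s ->
  s * (2 - t) ^ 2 <= 4 - 4 * t -> log_factor alpha t <= ln (2 * exp (1 / alpha) / s).
Proof.
  intros Ha Ht Hs H. unfold log_factor.
  assert (E := exp_pos (1 / alpha)).
  assert (P : 0 < (2 - t) ^ 2) by (apply pow_lt; lra).
  apply ln_le.
  - apply Rdiv_lt_0_compat; [now apply Rmult_lt_0_compat|lra].
  - apply (Rmult_le_reg_r (s * (2 - 2 * t))); [apply Rmult_lt_0_compat; lra|].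
    replace ((2 - t) ^ 2 * exp (1 / alpha) / (2 - 2 * t) * (s * (2 - 2 * t))) with
      (exp (1 / alpha) * (s * (2 - t) ^ 2)) by (field; lra).
    replace (2 * exp (1 / alpha) / s * (s * (2 - 2 * t))) with
      (exp (1 / alpha) * (4 - 4 * t)) by (field; lra).
    apply Rmult_le_compat_l; lra.
Qed.

(** * Continuity and integrability of the two integrands *)

Lemma continuous_Rpower {T : UniformSpace} (f : T -> R) (x : T) (b : R) :
  continuous f x -> 0 < f x -> continuous (fun y => Rpower (f y) b) x.
Proof.
  intros Hf P. unfold Rpower.
  apply (continuous_comp (fun y => b * ln (f y)) exp); [|apply continuous_exp].
  apply continuous_Rmult; [apply continuous_const|].
  apply (continuous_comp f ln); [exact Hf|now apply continuous_ln].
Qed.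

Lemma continuous_log_factor (alpha t : R) : t < 1 -> continuous (log_factor alpha) t.
Proof.
  intros Ht. apply (ex_derive_continuous (V := R_NormedModule)). unfold log_factor.
  auto_derive. assert (E := exp_pos (1 / alpha)). unfold Rdiv in E. repeat split; try lra.
  apply Rmult_lt_0_compat; [|apply Rinv_0_lt_compat; lra].
  apply Rmult_lt_0_compat; [apply Rmult_lt_0_compat; lra|exact E].
Qed.

Lemma continuous_main (alpha t : R) : 0 < alpha < 1 -> 0 < t < 1 -> continuous (main_integrand alpha) t.
Proof.
  intros Ha Ht. unfold main_integrand.
  assert (L := log_factor_ge_1 alpha t Ha Ht).
  apply continuous_Rmult.
  - apply (continuous_Rpower (fun t : R => t)); [apply continuous_id|lra].
  - apply continuous_Rinv_pt.
    + apply continuous_Rmult; [|apply continuous_log_factor; lra].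
      apply continuous_Rpower; [|lra].
      apply continuous_Rminus; [apply continuous_const|apply continuous_id].
    + apply Rgt_not_eq. apply Rmult_lt_0_compat; [apply Rpower_pos|lra].
Qed.

Lemma locally_between (u v t : R) (P : R -> Prop) : u < t < v ->
  (forall s, u < s < v -> P s) -> locally t P.
Proof.
  intros Ht HP. apply (locally_interval P t u v); simpl; try lra.
  intros y H1 H2. apply HP. split; assumption.
Qed.

(** Continuous on the whole interval, unlike [G_integrand], whose defining
    formula is a quotient [0 / 0] at [split_point]. *)
Definition G_reduced (alpha t : R) : R :=
  exp (- (2 * alpha) * ln (1 - t) + logG alpha t (y0 alpha t)) / log_factor alpha t.

Lemma continuous_G_reduced (alpha t : R) : 1 / 2 < alpha < 1 -> 0 < t < 1 ->
  continuous (G_reduced alpha) t.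
Proof.
  intros Ha Ht.
  assert (L := log_factor_ge_1 alpha t ltac:(lra) ltac:(lra)).
  unfold G_reduced. apply continuous_Rmult.
  2:{ apply continuous_Rinv_pt; [apply continuous_log_factor; lra|lra]. }
  assert (Y1 := y0_pos alpha t Ha Ht). assert (Y2 := y0_lt_1 alpha t Ha Ht).
  assert (Cy : continuous (y0 alpha) t).
  { apply (continuous_ext (fun t => (sqrt (disc alpha t) - (1 - alpha + (2 * alpha - 1) * t)) / (2 * alpha - 1))).
    { intros s. symmetry. apply y0_eq. lra. }
    assert (D := disc_pos alpha t ltac:(lra) ltac:(lra)). unfold disc in *.
    apply (ex_derive_continuous (V := R_NormedModule)). auto_derive.
    simpl in D. unfold Rminus in D. lra. }
  assert (Cln : forall h : R -> R, continuous h t -> 0 < h t -> continuous (fun s => ln (h s)) t).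
  { intros h Hh Ph. apply (continuous_comp h ln); [exact Hh|now apply continuous_ln]. }
  apply (continuous_comp (fun s => - (2 * alpha) * ln (1 - s) + logG alpha s (y0 alpha s)) exp);
    [|apply continuous_exp].
  apply continuous_Rplus.
  - apply continuous_Rmult; [apply continuous_const|]. apply Cln; [|lra].
    apply continuous_Rminus; [apply continuous_const|apply continuous_id].
  - unfold logG. apply continuous_Rminus; [apply continuous_Rplus|];
      (apply continuous_Rmult; [apply continuous_const|]); apply Cln; try lra.
    + exact Cy.
    + apply continuous_Rminus; [|exact Cy].
      apply continuous_Rminus; [apply continuous_const|apply continuous_id].
    + apply continuous_Rplus; [exact Cy|apply continuous_id].
Qed.

Lemma G_integrand_reduced (alpha t : R) : 2 / 3 < alpha < 1 -> 0 < t < split_point alpha ->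
  G_integrand alpha t = G_reduced alpha t.
Proof.
  intros Ha Ht. unfold G_integrand, G_reduced. now rewrite G_x0_exp.
Qed.

Lemma continuous_G_integrand (alpha t : R) : 2 / 3 < alpha < 1 -> 0 < t < split_point alpha ->
  continuous (G_integrand alpha) t.
Proof.
  intros Ha Ht. assert (B := split_point_bounds alpha Ha).
  apply (continuous_ext_loc _ (G_reduced alpha)).
  { apply (locally_between 0 (split_point alpha)); [exact Ht|].
    intros s Hs. symmetry. now apply G_integrand_reduced. }
  apply continuous_G_reduced; lra.
Qed.

(** The sum of the two endpoint singularities rather than their product, because the sum has an
    elementary primitive. *)
Definition majorant (alpha t : R) : R := Rpower t (alpha - 1) + Rpower (1 - t) (- alpha).

Lemma main_integrand_pos (alpha t : R) : 0 < alpha < 1 -> 0 < t < 1 -> 0 <= main_integrand alpha t.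
Proof.
  intros Ha Ht. unfold main_integrand. assert (L := log_factor_ge_1 alpha t Ha Ht).
  left. apply Rdiv_lt_0_compat; [apply Rpower_pos|].
  apply Rmult_lt_0_compat; [apply Rpower_pos|lra].
Qed.

Lemma G_integrand_pos (alpha t : R) : 0 < alpha < 1 -> 0 < t < 1 -> 0 <= G_integrand alpha t.
Proof.
  intros Ha Ht. unfold G_integrand, G. assert (L := log_factor_ge_1 alpha t Ha Ht).
  left. apply Rdiv_lt_0_compat; [|lra]. apply Rmult_lt_0_compat; apply Rpower_pos.
Qed.

Lemma Rpower_neg_half (t b : R) : 1 / 2 <= t -> -1 <= b <= 0 -> Rpower t b <= 2.
Proof.
  intros Ht Hb. replace b with (- (- b)) by ring. rewrite Rpower_Ropp.
  rewrite <- (Rinv_inv 2). apply Rinv_le_contravar; [lra|].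
  apply (Rle_trans _ (Rpower (1 / 2) (- b))).
  - rewrite <- (Rinv_inv (Rpower _ _)). apply Rinv_le_contravar.
    { apply Rinv_0_lt_compat, Rpower_pos. }
    rewrite <- Rpower_Ropp. replace (- - b) with b by ring.
    replace (Rpower (1 / 2) b) with (Rpower 2 (- b)).
    + rewrite <- (Rpower_1 2) at 2 by lra. apply Rle_Rpower; lra.
    + unfold Rpower. f_equal. replace (1 / 2) with (/ 2) by field.
      rewrite ln_Rinv by lra. ring.
  - apply Rle_Rpower_l; lra.
Qed.

(** On each half of [(0, 1)] the singular factor of the opposite end is at most 2. The constant 8 is
    the one that [G_integrand_le] requires. *)
Lemma main_integrand_le (alpha t : R) : 0 < alpha < 1 -> 0 < t < 1 ->
  main_integrand alpha t <= 8 * majorant alpha t.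
Proof.
  intros Ha Ht. unfold main_integrand, majorant. assert (L := log_factor_ge_1 alpha t Ha Ht).
  assert (P1 := Rpower_pos t (alpha - 1)). assert (P2 := Rpower_pos (1 - t) (- alpha)).
  assert (P3 := Rpower_pos (1 - t) alpha).
  apply (Rle_trans _ (Rpower t (alpha - 1) * Rpower (1 - t) (- alpha))).
  - rewrite Rpower_Ropp. apply Rmult_le_compat_l; [lra|].
    apply Rinv_le_contravar; [exact P3|]. nra.
  - destruct (Rle_dec t (1 / 2)) as [H|H].
    + assert (X := Rpower_neg_half (1 - t) (- alpha) ltac:(lra) ltac:(lra)). nra.
    + assert (X := Rpower_neg_half t (alpha - 1) ltac:(lra) ltac:(lra)). nra.
Qed.

(** From [y0 + t >= y0 >= t] the powers of [y0] contribute at most [t ^ (alpha - 1)]. The factors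
    [2 - t - y0 <= 2] and [1 - t >= 1 / 2] contribute at most [2 ^ (3 alpha)], hence 8. *)
Lemma G_integrand_le (alpha t : R) : 2 / 3 < alpha < 1 -> 0 < t < split_point alpha ->
  G_integrand alpha t <= 8 * majorant alpha t.
Proof.
  intros Ha Ht. assert (B := split_point_bounds alpha Ha).
  assert (L := log_factor_ge_1 alpha t ltac:(lra) ltac:(lra)).
  assert (Y := y0_bounds alpha t Ha Ht).
  unfold G_integrand, majorant.
  assert (P1 := Rpower_pos t (alpha - 1)). assert (P2 := Rpower_pos (1 - t) (- alpha)).
  assert (X : G alpha t (x0 alpha t) <= 8 * Rpower t (alpha - 1)).
  { rewrite G_x0_exp by assumption. unfold Rpower.
    replace (8 * exp ((alpha - 1) * ln t)) with (exp (3 * ln 2 + (alpha - 1) * ln t)).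
    2:{ rewrite exp_plus. f_equal.
        replace (3 * ln 2) with (ln 2 + ln 2 + ln 2) by ring.
        rewrite !exp_plus, exp_ln by lra. ring. }
    apply exp_monotone. unfold logG.
    assert (L1 : ln (y0 alpha t) <= ln (y0 alpha t + t)) by (apply ln_le; lra).
    assert (L2 : ln (2 - t - y0 alpha t) <= ln 2) by (apply ln_le; lra).
    assert (L3 : ln t <= ln (y0 alpha t)) by (apply ln_le; lra).
    assert (L4 : - ln 2 <= ln (1 - t)).
    { rewrite <- ln_Rinv by lra. apply ln_le; lra. }
    assert (L5 : ln 1 < ln 2) by (apply ln_increasing; lra). rewrite ln_1 in L5.
    assert (A1 : alpha * ln (y0 alpha t) <= alpha * ln (y0 alpha t + t)) by (apply Rmult_le_compat_l; lra).
    assert (A2 : alpha * ln (2 - t - y0 alpha t) <= alpha * ln 2) by (apply Rmult_le_compat_l; lra).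
    assert (A3 : (1 - alpha) * ln t <= (1 - alpha) * ln (y0 alpha t)) by (apply Rmult_le_compat_l; lra).
    assert (A4 : (2 * alpha) * - ln 2 <= (2 * alpha) * ln (1 - t)) by (apply Rmult_le_compat_l; lra).
    assert (A5 : 3 * alpha * ln 2 <= 3 * ln 2) by (apply Rmult_le_compat_r; lra).
    lra. }
  assert (Q : 0 <= G alpha t (x0 alpha t)) by (unfold G; left; apply Rmult_lt_0_compat; apply Rpower_pos).
  apply (Rle_trans _ (G alpha t (x0 alpha t) / 1)).
  - apply Rmult_le_compat_l; [exact Q|]. apply Rinv_le_contravar; lra.
  - lra.
Qed.

Lemma is_RInt_majorant (alpha s t : R) : 0 < alpha < 1 -> 0 < s -> s <= t -> t < 1 ->
  exists I, is_RInt (majorant alpha) s t I /\ I <= / alpha + / (1 - alpha).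
Proof.
  intros Ha Hs Hst Ht.
  set (F := fun x => Rpower x alpha / alpha - Rpower (1 - x) (1 - alpha) / (1 - alpha)).
  exists (minus (F t) (F s)). split.
  - apply (is_RInt_derive (V := R_CompleteNormedModule) F).
    + intros x Hx. rewrite Rmin_left, Rmax_right in Hx by lra. unfold majorant, F.
      apply (is_derive_plus (V := R_NormedModule) (fun x => Rpower x alpha / alpha)
        (fun x => - (Rpower (1 - x) (1 - alpha) / (1 - alpha)))).
      * unfold Rpower. auto_derive; [lra|].
        replace (alpha * ln x) with ((alpha - 1) * ln x + ln x) by ring.
        rewrite exp_plus, exp_ln by lra. field. lra.
      * apply is_derive_Rpower_maj; lra.
    + intros x Hx. rewrite Rmin_left, Rmax_right in Hx by lra. unfold majorant.
      apply continuous_Rplus.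
      * apply (continuous_Rpower (fun t : R => t)); [apply continuous_id|lra].
      * apply continuous_Rpower; [|lra].
        apply continuous_Rminus; [apply continuous_const|apply continuous_id].
  - assert (Q1 : 0 < / alpha) by (apply Rinv_0_lt_compat; lra).
    assert (Q2 : 0 < / (1 - alpha)) by (apply Rinv_0_lt_compat; lra).
    assert (Le1 : forall x b, 0 < x <= 1 -> 0 <= b -> Rpower x b <= 1).
    { intros x b Hx Hb. apply (Rle_trans _ (Rpower 1 b)); [apply Rle_Rpower_l; lra|].
      unfold Rpower. rewrite ln_1, Rmult_0_r, exp_0. lra. }
    assert (A1 := Le1 t alpha ltac:(lra) ltac:(lra)).
    assert (A2 := Le1 (1 - s) (1 - alpha) ltac:(lra) ltac:(lra)).
    assert (B1 := Rpower_pos s alpha). assert (B2 := Rpower_pos (1 - t) (1 - alpha)).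
    unfold F, minus, plus, opp; simpl. unfold Rdiv. nra.
Qed.

Lemma RInt_le_majorant (alpha s t : R) (f : R -> R) : 0 < alpha < 1 -> 0 < s -> s <= t -> t < 1 ->
  ex_RInt f s t -> (forall x, s < x < t -> f x <= 8 * majorant alpha x) ->
  RInt f s t <= 8 * (/ alpha + / (1 - alpha)).
Proof.
  intros Ha Hs Hst Ht Ef Hf.
  destruct (is_RInt_majorant alpha s t Ha Hs Hst Ht) as [I [HI BI]].
  assert (HI8 := is_RInt_scal _ _ _ 8 _ HI).
  apply (Rle_trans _ (8 * I)); [|lra].
  apply (is_RInt_le f (fun x => 8 * majorant alpha x) s t _ _ Hst (RInt_correct _ _ _ Ef) HI8 Hf).
Qed.

Lemma RInt_nonneg_mono (f : R -> R) (a b c d : R) : a <= b -> b <= c -> c <= d ->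
  ex_RInt f a d -> (forall x, a < x < d -> 0 <= f x) -> RInt f b c <= RInt f a d.
Proof.
  intros H1 H2 H3 E P.
  assert (E1 : ex_RInt f a c) by (apply (ex_RInt_Chasles_1 (V := R_CompleteNormedModule) f a c d); [lra|exact E]).
  assert (E2 : ex_RInt f c d) by (apply (ex_RInt_Chasles_2 (V := R_CompleteNormedModule) f a c d); [lra|exact E]).
  assert (E3 : ex_RInt f a b) by (apply (ex_RInt_Chasles_1 (V := R_CompleteNormedModule) f a b c); [lra|exact E1]).
  assert (E4 : ex_RInt f b c) by (apply (ex_RInt_Chasles_2 (V := R_CompleteNormedModule) f a b c); [lra|exact E1]).
  assert (C1 := RInt_Chasles (V := R_CompleteNormedModule) f a c d E1 E2).
  assert (C2 := RInt_Chasles (V := R_CompleteNormedModule) f a b c E3 E4).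
  assert (P1 : 0 <= RInt f a b) by (apply RInt_ge_0; [exact H1|exact E3|intros; apply P; lra]).
  assert (P2 : 0 <= RInt f c d) by (apply RInt_ge_0; [exact H3|exact E2|intros; apply P; lra]).
  unfold plus in C1, C2; simpl in C1, C2. lra.
Qed.

(** For a nonnegative integrand the integrals over [[s, c]] increase as [s] decreases, so their
    supremum is the improper integral. The second conclusion, on compact subintervals, is what
    [curve_improper_bound] consumes. *)
Lemma improper_left (f : R -> R) (u c K : R) : u < c ->
  (forall s, u < s < c -> ex_RInt f s c) -> (forall s, u < s < c -> 0 <= f s) ->
  (forall s, u < s < c -> RInt f s c <= K) ->
  exists l, is_RInt_gen f (at_right u) (at_point c) l /\
    forall s t, u < s -> s <= t -> t < c -> RInt f s t <= l.
Proof.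
  intros Huc Ef Pf BK.
  assert (Mono : forall s s' t, u < s -> s <= s' -> s' <= t -> t <= c -> s < c -> RInt f s' t <= RInt f s c).
  { intros s s' t H1 H2 H3 H4 H5. apply RInt_nonneg_mono; try lra; [apply Ef; lra|].
    intros x Hx. apply Pf. lra. }
  destruct (completeness (fun x => exists s, u < s < c /\ x = RInt f s c)) as [l [Ul Ll]].
  - exists K. intros x [s [Hs ->]]. now apply BK.
  - exists (RInt f ((u + c) / 2) c), ((u + c) / 2). split; [lra|reflexivity].
  - exists l. split.
    + intros P [eps HP].
      assert (W : exists s, u < s < c /\ l - eps < RInt f s c).
      { apply NNPP. intros N.
        assert (l <= l - eps); [|generalize (cond_pos eps); lra].
        apply Ll. intros x [s [Hs ->]]. apply Rnot_lt_le. intros Q. apply N. now exists s. }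
      destruct W as [s0 [Hs0 W]].
      apply (Filter_prod _ _ _ (fun s => u < s < s0) (fun b => b = c)).
      * apply at_right_interval. lra.
      * reflexivity.
      * intros x y Hx ->. exists (RInt f x c). split.
        { apply (RInt_correct (V := R_CompleteNormedModule)). simpl. apply Ef. lra. }
        apply HP. unfold ball; simpl; unfold AbsRing_ball, abs, minus, plus, opp; simpl.
        assert (A : RInt f x c <= l) by (apply Ul; exists x; split; [lra|reflexivity]).
        assert (A' := Mono x s0 c ltac:(lra) ltac:(lra) ltac:(lra) ltac:(lra) ltac:(lra)).
        apply Rabs_def1; lra.
    + intros s t H1 H2 H3. apply (Rle_trans _ (RInt f s c)).
      * apply Mono; lra.
      * apply Ul. exists s. split; [lra|reflexivity].
Qed.

Lemma improper_right (f : R -> R) (c v K : R) : c < v ->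
  (forall s, c < s < v -> ex_RInt f c s) -> (forall s, c < s < v -> 0 <= f s) ->
  (forall s, c < s < v -> RInt f c s <= K) ->
  exists l, is_RInt_gen f (at_point c) (at_left v) l /\
    forall s t, c < s -> s <= t -> t < v -> RInt f s t <= l.
Proof.
  intros Hcv Ef Pf BK.
  assert (Mono : forall s t t', c <= s -> s <= t -> t <= t' -> c < t' -> t' < v -> RInt f s t <= RInt f c t').
  { intros s s' t H1 H2 H3 H4 H5. apply RInt_nonneg_mono; try lra; [apply Ef; lra|].
    intros x Hx. apply Pf. lra. }
  destruct (completeness (fun x => exists s, c < s < v /\ x = RInt f c s)) as [l [Ul Ll]].
  - exists K. intros x [s [Hs ->]]. now apply BK.
  - exists (RInt f c ((c + v) / 2)), ((c + v) / 2). split; [lra|reflexivity].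
  - exists l. split.
    + intros P [eps HP].
      assert (W : exists s, c < s < v /\ l - eps < RInt f c s).
      { apply NNPP. intros N.
        assert (l <= l - eps); [|generalize (cond_pos eps); lra].
        apply Ll. intros x [s [Hs ->]]. apply Rnot_lt_le. intros Q. apply N. now exists s. }
      destruct W as [s0 [Hs0 W]].
      apply (Filter_prod _ _ _ (fun b => b = c) (fun s => s0 < s < v)).
      * reflexivity.
      * apply at_left_interval. lra.
      * intros x y -> Hy. exists (RInt f c y). split.
        { apply (RInt_correct (V := R_CompleteNormedModule)). simpl. apply Ef. lra. }
        apply HP. unfold ball; simpl; unfold AbsRing_ball, abs, minus, plus, opp; simpl.
        assert (A : RInt f c y <= l) by (apply Ul; exists y; split; [lra|reflexivity]).
        assert (A' := Mono c s0 y ltac:(lra) ltac:(lra) ltac:(lra) ltac:(lra) ltac:(lra)).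
        apply Rabs_def1; lra.
    + intros s t H1 H2 H3. apply (Rle_trans _ (RInt f c t)).
      * apply Mono; lra.
      * apply Ul. exists t. split; [lra|reflexivity].
Qed.

Lemma main_improper_left (alpha m : R) : 0 < alpha < 1 -> 0 < m < 1 ->
  exists l, is_RInt_gen (main_integrand alpha) (at_right 0) (at_point m) l /\
    forall s t, 0 < s -> s <= t -> t < m -> RInt (main_integrand alpha) s t <= l.
Proof.
  intros Ha Hm.
  assert (Ex : forall s, 0 < s < m -> ex_RInt (main_integrand alpha) s m).
  { intros s Hs. apply (ex_RInt_continuous (V := R_CompleteNormedModule)). intros x Hx.
    rewrite Rmin_left, Rmax_right in Hx by lra. apply continuous_main; lra. }
  apply (improper_left _ 0 m (8 * (/ alpha + / (1 - alpha)))); [lra|exact Ex| |].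
  - intros s Hs. apply main_integrand_pos; lra.
  - intros s Hs. apply RInt_le_majorant; try lra; [now apply Ex|].
    intros x Hx. apply main_integrand_le; lra.
Qed.

Lemma main_improper_right (alpha m : R) : 0 < alpha < 1 -> 0 < m < 1 ->
  exists l, is_RInt_gen (main_integrand alpha) (at_point m) (at_left 1) l /\
    forall s t, m < s -> s <= t -> t < 1 -> RInt (main_integrand alpha) s t <= l.
Proof.
  intros Ha Hm.
  assert (Ex : forall s, m < s < 1 -> ex_RInt (main_integrand alpha) m s).
  { intros s Hs. apply (ex_RInt_continuous (V := R_CompleteNormedModule)). intros x Hx.
    rewrite Rmin_left, Rmax_right in Hx by lra. apply continuous_main; lra. }
  apply (improper_right _ m 1 (8 * (/ alpha + / (1 - alpha)))); [lra|exact Ex| |].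
  - intros s Hs. apply main_integrand_pos; lra.
  - intros s Hs. apply RInt_le_majorant; try lra; [now apply Ex|].
    intros x Hx. apply main_integrand_le; lra.
Qed.

Lemma G_improper (alpha : R) : 2 / 3 < alpha < 1 ->
  exists l, is_RInt_gen (G_integrand alpha) (at_right 0) (at_point (split_point alpha)) l /\
    forall s t, 0 < s -> s <= t -> t < split_point alpha -> RInt (G_integrand alpha) s t <= l.
Proof.
  intros Ha. assert (B := split_point_bounds alpha Ha).
  assert (Ex : forall s, 0 < s < split_point alpha -> ex_RInt (G_integrand alpha) s (split_point alpha)).
  (* The two integrands agree on the open interval, which determines the integral; [G_reduced] is
     continuous up to and including [split_point]. *)
  { intros s Hs. apply (ex_RInt_ext (G_reduced alpha)).
    - intros x Hx. rewrite Rmin_left, Rmax_right in Hx by lra. symmetry.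
      apply G_integrand_reduced; lra.
    - apply (ex_RInt_continuous (V := R_CompleteNormedModule)). intros x Hx.
      rewrite Rmin_left, Rmax_right in Hx by lra. apply continuous_G_reduced; lra. }
  apply (improper_left _ 0 (split_point alpha) (8 * (/ alpha + / (1 - alpha)))); [lra|exact Ex| |].
  - intros s Hs. apply G_integrand_pos; lra.
  - intros s Hs. apply RInt_le_majorant; try lra; [now apply Ex|].
    intros x Hx. apply G_integrand_le; lra.
Qed.

(** * The norm bound *)

Lemma weighted_norm_le (v : R -> R) (f : C -> C) (M : R) :
  Rbar_le (weighted_norm v f) M <->
  forall z, disk z -> v (1 - Cmod z ^ 2) * Cmod (f z) <= M.
Proof.
  unfold weighted_norm.
  destruct (Lub_Rbar_correct (fun r : R => exists z : C,
    disk z /\ r = v (1 - Cmod z ^ 2) * Cmod (f z))) as [U L].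
  split.
  - intros H z Hz.
    assert (K := Rbar_le_trans _ _ _ (U _ (ex_intro _ z (conj Hz eq_refl))) H). exact K.
  - intros H. apply L. intros r [z [Hz ->]]. now apply H.
Qed.

Lemma weighted_norm_finite (v : R -> R) (f : C -> C) :
  Rbar_lt (weighted_norm v f) p_infty -> exists M, Rbar_le (weighted_norm v f) (Finite M).
Proof.
  destruct (weighted_norm v f) as [m| |]; intros H.
  - exists m. apply Rbar_le_refl.
  - destruct H.
  - exists 0. exact I.
Qed.

Lemma disk_sqr (z : C) : disk z -> 0 < 1 - Cmod z ^ 2 <= 1.
Proof.
  intros Hz. unfold disk in Hz. assert (P := Cmod_ge_0 z). nra.
Qed.

(** The logarithm is at least 1 and [1 - |z| <= 1 - |z| ^ 2]; the value at 0 shows that [M] is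
    nonnegative. *)
Lemma korenblum_log_growth (alpha M : R) (f : C -> C) : 0 < alpha < 1 ->
  Rbar_le (korenblum_log_norm alpha f) M -> 0 <= M /\ growth M alpha f.
Proof.
  intros Ha H. assert (K := proj1 (weighted_norm_le _ _ _) H). cbv beta in K.
  assert (B : forall z, disk z -> Rpower (1 - Cmod z ^ 2) alpha * Cmod (f z) <= M).
  { intros z Hz. specialize (K z Hz).
    assert (S := disk_sqr z Hz). assert (L := log_arg_lower alpha _ Ha S).
    assert (P := Rpower_pos (1 - Cmod z ^ 2) alpha). assert (Q := Cmod_ge_0 (f z)).
    set (l := ln (2 * exp (1 / alpha) / (1 - Cmod z ^ 2))) in *.
    assert (0 <= Rpower (1 - Cmod z ^ 2) alpha * Cmod (f z)) by (apply Rmult_le_pos; lra).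
    nra. }
  assert (HM : 0 <= M).
  { assert (D0 : disk (RtoC 0)) by (unfold disk; rewrite Cmod_0; lra).
    eapply Rle_trans; [|exact (B (RtoC 0) D0)].
    apply Rmult_le_pos; [left; apply Rpower_pos|apply Cmod_ge_0]. }
  split; [exact HM|]. intros z Hz. specialize (B z Hz).
  assert (S := disk_sqr z Hz). unfold disk in Hz. assert (Q := Cmod_ge_0 z).
  assert (P := Rpower_pos (1 - Cmod z) alpha). assert (F := Cmod_ge_0 (f z)).
  assert (R1 : Rpower (1 - Cmod z) alpha <= Rpower (1 - Cmod z ^ 2) alpha).
  { apply Rle_Rpower_l; [lra|]. nra. }
  rewrite Rpower_Ropp. apply (Rmult_le_reg_r (Rpower (1 - Cmod z) alpha)); [exact P|].
  rewrite Rmult_assoc, Rinv_l, Rmult_1_r by lra.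
  eapply Rle_trans; [|exact B]. rewrite Rmult_comm. now apply Rmult_le_compat_r.
Qed.

(** Splits [G] into the weight of the target space at [z] and the factor of
    [modulus_factor_decreasing] at [s = 1 - x], the smallest possible [|path_den|]. *)
Lemma G_radial (alpha t : R) (z : C) : 0 < t < 1 -> disk z ->
  G alpha t ((1 - t) * Cmod z) =
  Rpower (1 - Cmod z ^ 2) alpha *
  (Rpower (1 - (1 - t) * Cmod z) (2 * alpha - 1) *
   Rpower ((1 - (1 - t) * Cmod z) ^ 2 - t ^ 2) (- alpha)).
Proof.
  intros Ht Hz. assert (S := disk_sqr z Hz). assert (Q := Cmod_ge_0 z). unfold disk in Hz.
  unfold G. replace ((1 - t) * Cmod z / (1 - t)) with (Cmod z) by (field; lra).
  rewrite (Rabs_pos_eq (Cmod z)) by exact Q.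
  set (x := (1 - t) * Cmod z).
  assert (Hx : x < 1 - t) by (unfold x; nra).
  assert (P : 0 < (1 - x) ^ 2 - t ^ 2) by nra.
  unfold Rdiv. rewrite <- Rpower_mult_distr by (lra || now apply Rinv_0_lt_compat).
  replace (Rpower (/ ((1 - x) ^ 2 - t ^ 2)) alpha) with (Rpower ((1 - x) ^ 2 - t ^ 2) (- alpha)).
  - ring.
  - unfold Rpower. f_equal. rewrite ln_Rinv by exact P. ring.
Qed.

(** The norm of [f] is used once, at [path z t]. Its logarithmic weight is then bounded at the
    largest [|path_den|] and its power weight at the smallest, two extremes that no single [z]
    attains together. *)
Lemma integrand_pointwise (alpha t : R) (f : C -> C) (z : C) : 0 < alpha < 1 -> 0 < t < 1 ->
  Rbar_le (korenblum_log_norm alpha f) 1 -> disk z ->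
  Rpower (1 - Cmod z ^ 2) alpha * Cmod (Cdiv (f (path z t)) (path_den z t)) <=
  G alpha t ((1 - t) * Cmod z) / log_factor alpha t.
Proof.
  intros Ha Ht Hn Hz.
  assert (Hp := path_disk z t Hz ltac:(lra)).
  assert (K := proj1 (weighted_norm_le _ _ _) Hn _ Hp). cbv beta in K.
  assert (S := disk_sqr _ Hp).
  assert (L := path_den_lower z t ltac:(lra)). assert (U := path_den_upper z t ltac:(lra)).
  assert (Gt := path_den_gt z t Hz ltac:(lra)).
  assert (N := path_den_neq_0 z t Hz ltac:(lra)).
  assert (LF := log_factor_ge_1 alpha t Ha Ht).
  rewrite G_radial, Cmod_div by assumption. unfold Rdiv. rewrite !Rmult_assoc.
  apply Rmult_le_compat_l; [left; apply Rpower_pos|].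
  rewrite Cmod_path in K, S by (assumption || lra).
  assert (Q := Cmod_ge_0 z). assert (Hz' := Hz). unfold disk in Hz'.
  set (A := Cmod (path_den z t)) in *.
  set (x := (1 - t) * Cmod z) in *.
  assert (Hx : 0 <= x < 1 - t) by (unfold x; nra).
  assert (PA : 0 < A ^ 2 - t ^ 2) by nra.
  assert (E : 1 - (t / A) ^ 2 = (A ^ 2 - t ^ 2) / A ^ 2) by (field; lra).
  (* Here [A <= 1 + x <= 2 - t] enters. *)
  assert (LL : log_factor alpha t <= ln (2 * exp (1 / alpha) / (1 - (t / A) ^ 2))).
  { apply log_factor_le; try assumption; try lra. rewrite E.
    apply (Rmult_le_reg_r (A ^ 2)); [apply pow_lt; lra|].
    replace ((A ^ 2 - t ^ 2) / A ^ 2 * (2 - t) ^ 2 * A ^ 2) with ((A ^ 2 - t ^ 2) * (2 - t) ^ 2) by (field; lra).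
    assert (A ^ 2 <= (2 - t) ^ 2) by (apply pow_incr; lra).
    assert (0 <= t ^ 2) by apply pow2_ge_0. nra. }
  assert (D := modulus_factor_decreasing alpha t (1 - x) A Ha ltac:(lra) L).
  set (F := Cmod (f (path z t))) in *. assert (HF : 0 <= F) by apply Cmod_ge_0.
  (* The power weight at [path z t] times [A] is the reciprocal of the decreasing factor at [A]. *)
  assert (E2 : Rpower (1 - (t / A) ^ 2) alpha * (A * (Rpower A (2 * alpha - 1) * Rpower (A ^ 2 - t ^ 2) (- alpha))) = 1).
  { assert (EA : A * Rpower A (2 * alpha - 1) = Rpower A (2 * alpha)).
    { rewrite <- (Rpower_1 A) at 1 by lra. rewrite <- Rpower_plus. f_equal. ring. }
    rewrite <- (Rmult_assoc A), EA, E. unfold Rpower. rewrite <- !exp_plus.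
    transitivity (exp 0); [f_equal|apply exp_0].
    rewrite ln_div by (lra || (apply pow_lt; lra)).
    replace (ln (A ^ 2)) with (ln A + ln A).
    - ring.
    - rewrite <- ln_mult by lra. f_equal. ring. }
  set (k := Rpower (1 - (t / A) ^ 2) alpha) in *.
  assert (Pk : 0 < k) by apply Rpower_pos.
  set (g1 := Rpower A (2 * alpha - 1) * Rpower (A ^ 2 - t ^ 2) (- alpha)) in *.
  assert (F1 : F * / A * log_factor alpha t <= g1).
  { apply (Rmult_le_reg_l (k * A)); [apply Rmult_lt_0_compat; lra|].
    replace (k * A * (F * / A * log_factor alpha t)) with (k * log_factor alpha t * F) by (field; lra).
    replace (k * A * g1) with 1 by lra.
    eapply Rle_trans; [|exact K]. apply Rmult_le_compat_r; [exact HF|].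
    apply Rmult_le_compat_l; lra. }
  apply (Rmult_le_reg_r (log_factor alpha t)); [lra|].
  rewrite !Rmult_assoc, Rinv_l, Rmult_1_r by lra. lra.
Qed.

Lemma at_right_near (x y : R) (P : R -> Prop) : x < y -> at_right x P ->
  exists t, x < t < y /\ P t.
Proof.
  intros Hy H.
  destruct (filter_ex _ (filter_and _ _ H (at_right_interval _ _ Hy))) as [t [A B]]. now exists t.
Qed.

(** Neither a derivative of [h] nor a bound on [b] is available at the ends, so the mean value
    inequality is used on compact subintervals and the ends are reached by limits. The factor [k]
    will be the weight of the target space at [z]. *)
Lemma curve_improper_bound (h dh : R -> C) (b : R -> R) (u v k I : R) (hu hv : C) :
  u < v -> 0 < k ->
  (forall t, u < t < v -> curve_deriv h t (dh t)) ->
  (forall t, u < t < v -> continuous b t) ->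
  (forall t, u < t < v -> k * Cmod (dh t) <= b t) ->
  (forall s t, u < s -> s <= t -> t < v -> RInt b s t <= I) ->
  filterlim h (at_right u) (locally hu) -> filterlim h (at_left v) (locally hv) ->
  k * Cmod (Cminus hv hu) <= I.
Proof.
  intros Huv Hk Dh Cb Hb HI Lu Lv.
  assert (B : forall s t, u < s -> s <= t -> t < v -> k * Cmod (Cminus (h t) (h s)) <= I).
  { intros s t Hs Hst Ht. eapply Rle_trans; [|exact (HI s t Hs Hst Ht)].
    (* The primitive of the majorant [b / k] of [|dh|] is the integral of [b] from [s], divided by
       [k]. *)
    assert (X := curve_mean_value h dh (fun x => / k * RInt b s x) (fun x => / k * b x) s t Hst).
    cbv beta in X.
    replace (/ k * RInt b s t - / k * RInt b s s) with (/ k * RInt b s t) in X.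
    2:{ rewrite RInt_point. change (@zero R_CompleteNormedModule) with 0. ring. }
    apply (Rmult_le_reg_l (/ k)); [now apply Rinv_0_lt_compat|].
    rewrite <- Rmult_assoc, Rinv_l, Rmult_1_l by lra. apply X.
    - intros x Hx. apply Dh. lra.
    - intros x Hx. apply is_derive_scal.
      apply (is_derive_RInt b (RInt b s) s x).
      + apply (locally_between u v); [lra|]. intros y Hy.
        apply (RInt_correct (V := R_CompleteNormedModule)).
        apply (ex_RInt_continuous (V := R_CompleteNormedModule)). intros w Hw. apply Cb.
        split.
        * eapply Rlt_le_trans; [|apply Hw]. apply Rmin_glb_lt; lra.
        * eapply Rle_lt_trans; [apply Hw|]. apply Rmax_lub_lt; lra.
      + apply Cb. lra.
    - intros x Hx. apply (Rmult_le_reg_l k); [exact Hk|].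
      rewrite <- Rmult_assoc, Rinv_r, Rmult_1_l by lra. apply Hb. lra. }
  apply le_epsilon. intros eps He.
  assert (He' : 0 < eps / (2 * k)) by (apply Rdiv_lt_0_compat; lra).
  destruct (at_right_near u ((u + v) / 2) _ ltac:(lra) (filterlim_Cmod_near _ _ _ He' Lu)) as [s [Hs As]].
  destruct (at_left_near v ((u + v) / 2) _ ltac:(lra) (filterlim_Cmod_near _ _ _ He' Lv)) as [t [Ht At]].
  specialize (B s t ltac:(lra) ltac:(lra) ltac:(lra)).
  assert (T : Cmod (Cminus hv hu) <= Cmod (Cminus (h t) (h s)) + (Cmod (Cminus (h s) hu) + Cmod (Cminus (h t) hv))).
  { replace (Cminus hv hu) with (Cplus (Cminus (h t) (h s)) (Cplus (Cminus (h s) hu) (Copp (Cminus (h t) hv)))) by ring.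
    eapply Rle_trans; [apply Cmod_triangle|]. apply Rplus_le_compat_l.
    eapply Rle_trans; [apply Cmod_triangle|]. rewrite Cmod_opp. lra. }
  apply (Rmult_le_compat_l k) in T; [|lra].
  assert (X : k * (Cmod (Cminus (h s) hu) + Cmod (Cminus (h t) hv)) <= k * (eps / (2 * k) + eps / (2 * k))).
  { apply Rmult_le_compat_l; lra. }
  replace (k * (eps / (2 * k) + eps / (2 * k))) with eps in X by (field; lra). lra.
Qed.

(** Covers both ranges of [alpha]: the majorant may change its formula at [m]. It must hold for
    every [x] in [[0, 1 - t)] because [x = (1 - t) |z|] with [z] arbitrary. *)
Lemma hilbert_norm_le (alpha m I1 I2 : R) (b1 b2 : R -> R) : 0 < alpha < 1 -> 0 < m < 1 ->
  (forall t, 0 < t < m -> continuous b1 t) -> (forall t, m < t < 1 -> continuous b2 t) ->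
  (forall t x, 0 < t < m -> 0 <= x < 1 - t -> G alpha t x / log_factor alpha t <= b1 t) ->
  (forall t x, m < t < 1 -> 0 <= x < 1 - t -> G alpha t x / log_factor alpha t <= b2 t) ->
  (forall s t, 0 < s -> s <= t -> t < m -> RInt b1 s t <= I1) ->
  (forall s t, m < s -> s <= t -> t < 1 -> RInt b2 s t <= I2) ->
  Rbar_le (hilbert_norm alpha) (Finite (I1 + I2)).
Proof.
  intros Ha Hm C1 C2 B1 B2 HI1 HI2. unfold hilbert_norm, operator_norm.
  apply (proj2 (proj2_sig (Rbar_ex_lub _))). intros r [f [g [Xf [Nf [[a [b [Ta [Hb [Tb Ag]]]]] ->]]]]].
  apply weighted_norm_le. intros z Hz. cbv beta.
  destruct (korenblum_log_growth alpha 1 f Ha Nf) as [HM Hg].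
  destruct (kernel_primitive_exists a f z Ta Hz) as [P HP].
  set (k := Rpower (1 - Cmod z ^ 2) alpha). assert (Hk : 0 < k) by apply Rpower_pos.
  set (h := fun t => P (path z t)).
  set (dh := fun t => Cdiv (f (path z t)) (path_den z t)).
  assert (Dh : forall t, 0 <= t < 1 -> curve_deriv h t (dh t)).
  { intros t Ht. now apply curve_deriv_primitive_path. }
  assert (Ch : forall t, 0 <= t < 1 -> continuous h t).
  { intros t Ht. eapply curve_deriv_continuous. now apply Dh. }
  assert (Lim : filterlim h (at_left 1) (locally (g z))).
  { now apply (hilbert_path_lim a b f g P 1 alpha z). }
  assert (H0 : h 0 = RtoC 0).
  { unfold h. replace (path z 0) with (RtoC 0); [apply HP|].
    unfold path. field. apply path_den_neq_0; [exact Hz|lra]. }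
  assert (Q := Cmod_ge_0 z).
  assert (PW : forall t, 0 < t < 1 -> exists x, 0 <= x < 1 - t /\ k * Cmod (dh t) <= G alpha t x / log_factor alpha t).
  { intros t Ht. exists ((1 - t) * Cmod z). split.
    - unfold disk in Hz. split; [apply Rmult_le_pos; lra|nra].
    - now apply integrand_pointwise. }
  assert (Lr : forall t, 0 <= t < 1 -> filterlim h (at_right t) (locally (h t))).
  { intros t Ht. apply (filterlim_filter_le_1 (F := locally t) (G := at_right t)); 
      [apply filter_le_within|now apply Ch]. }
  assert (Ll : forall t, 0 <= t < 1 -> filterlim h (at_left t) (locally (h t))).
  { intros t Ht. apply (filterlim_filter_le_1 (F := locally t) (G := at_left t)); 
      [apply filter_le_within|now apply Ch]. }
  assert (E1 : k * Cmod (Cminus (h m) (h 0)) <= I1).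
  { apply (curve_improper_bound h dh b1 0 m); try assumption; try lra.
    - intros t Ht. apply Dh. lra.
    - intros t Ht. destruct (PW t ltac:(lra)) as [x [Hx Hle]].
      eapply Rle_trans; [exact Hle|]. now apply B1.
    - apply Lr. lra.
    - apply Ll. lra. }
  assert (E2 : k * Cmod (Cminus (g z) (h m)) <= I2).
  { apply (curve_improper_bound h dh b2 m 1); try assumption; try lra.
    - intros t Ht. apply Dh. lra.
    - intros t Ht. destruct (PW t ltac:(lra)) as [x [Hx Hle]].
      eapply Rle_trans; [exact Hle|]. now apply B2.
    - apply Lr. lra. }
  assert (T : Cmod (g z) <= Cmod (Cminus (h m) (h 0)) + Cmod (Cminus (g z) (h m))).
  { replace (g z) with (Cplus (Cminus (h m) (h 0)) (Cminus (g z) (h m))) at 1.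
    - apply Cmod_triangle.
    - rewrite H0. ring. }
  apply (Rmult_le_compat_l k) in T; [|lra]. lra.
Qed.

Lemma G_div_le_main (alpha t x : R) : 0 < alpha < 1 -> 0 < t < 1 -> 0 <= x < 1 - t ->
  (2 / 3 < alpha -> split_point alpha <= t) ->
  G alpha t x / log_factor alpha t <= main_integrand alpha t.
Proof.
  intros Ha Ht Hx Hs. assert (L := log_factor_ge_1 alpha t Ha Ht).
  assert (E := G_le_endpoint alpha t x Ha Ht Hx Hs). assert (P := Rpower_pos (1 - t) alpha).
  unfold main_integrand.
  replace (Rpower t (alpha - 1) / (Rpower (1 - t) alpha * log_factor alpha t)) with
    (Rpower t (alpha - 1) / Rpower (1 - t) alpha / log_factor alpha t) by (field; lra).
  apply Rmult_le_compat_r; [left; apply Rinv_0_lt_compat; lra|exact E].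
Qed.

Theorem theorem3p2 (alpha : R) (halpha0 : 0 < alpha) (halpha1 : alpha < 1) :
  (forall f : C -> C, korenblum_log alpha f -> exists g : C -> C, hilbert f g) /\
  (alpha <= 2 / 3 ->
     ex_RInt_gen (main_integrand alpha) (at_right 0) (at_left 1) /\
     Rbar_le (hilbert_norm alpha)
       (Finite (RInt_gen (main_integrand alpha) (at_right 0) (at_left 1)))) /\
  (2 / 3 < alpha ->
     ex_RInt_gen (G_integrand alpha)
       (at_right 0) (at_point (split_point alpha)) /\
     ex_RInt_gen (main_integrand alpha)
       (at_point (split_point alpha)) (at_left 1) /\
     Rbar_le (hilbert_norm alpha)
       (Finite (RInt_gen (G_integrand alpha)
                  (at_right 0) (at_point (split_point alpha))
                + RInt_gen (main_integrand alpha)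
                    (at_point (split_point alpha)) (at_left 1)))).
Proof.
  assert (Ha : 0 < alpha < 1) by lra.
  split; [|split].
  - intros f [Af Nf]. destruct (weighted_norm_finite _ _ Nf) as [M HM].
    destruct (korenblum_log_growth alpha M f Ha HM) as [M0 Hg].
    now apply (hilbert_defined f M alpha).
  - intros H23.
    (* The integral is improper at both ends; the interior point [1 / 2] is arbitrary, and the two
       halves are glued by Chasles' relation. *)
    destruct (main_improper_left alpha (1 / 2) Ha ltac:(lra)) as [l1 [I1 B1]].
    destruct (main_improper_right alpha (1 / 2) Ha ltac:(lra)) as [l2 [I2 B2]].
    assert (I := is_RInt_gen_Chasles _ _ _ _ I1 I2).
    split; [now exists (plus l1 l2)|].
    rewrite (is_RInt_gen_unique _ _ I).
    apply (hilbert_norm_le alpha (1 / 2) l1 l2 (main_integrand alpha) (main_integrand alpha)); try assumption.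
    + lra.
    + intros t Ht. apply continuous_main; lra.
    + intros t Ht. apply continuous_main; lra.
    + intros t x Ht Hx. apply G_div_le_main; lra.
    + intros t x Ht Hx. apply G_div_le_main; lra.
  - intros H23. assert (Hs := split_point_bounds alpha ltac:(lra)).
    destruct (G_improper alpha ltac:(lra)) as [l1 [I1 B1]].
    destruct (main_improper_right alpha (split_point alpha) Ha ltac:(lra)) as [l2 [I2 B2]].
    split; [now exists l1|]. split; [now exists l2|].
    rewrite (is_RInt_gen_unique _ _ I1), (is_RInt_gen_unique _ _ I2).
    apply (hilbert_norm_le alpha (split_point alpha) l1 l2 (G_integrand alpha) (main_integrand alpha)); try assumption.
    + lra.
    + intros t Ht. apply continuous_G_integrand; lra.
    + intros t Ht. apply continuous_main; lra.
    + intros t x Ht Hx. assert (L := log_factor_ge_1 alpha t Ha ltac:(lra)).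
      apply Rmult_le_compat_r; [left; apply Rinv_0_lt_compat; lra|].
      apply G_le_x0; lra.
    + intros t x Ht Hx. apply G_div_le_main; lra.
Qed.
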